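(* Let $(M,F)$ be a connected complete Finsler space of dimension $n\ge2$ whose Ricci tensor is positive semi-definite, i.e. the matrix $(Ric_{ij}(x,y))$ is positive semi-definite for every $(x,y)\in TM_0$. Then the intrinsic projectively invariant pseudo-distance $d_M$ is trivial, that is, $d_M(x,y)=0$ for all $x,y\in M$.
   Context: A Finsler structure on an $n$-dimensional manifold $M$ is a function $F:TM\to[0,\infty)$ that is $C^\infty$ on the slit tangent bundle $TM_0=TM\setminus\{0\}$, satisfies $F(x,\lambda y)=\lambda F(x,y)$ for $\lambda>0$, and for which $g_{ij}:=\left[\tfrac12F^2\right]_{y^iy^j}$ is positive definite on $TM_0$. Its spray coefficients are $G^i:=\tfrac12 g^{il}\{[F^2]_{x^ky^l}y^k-[F^2]_{x^l}\}$. Geodesics parameterized by arc length $s$ (so $F(x,dx/ds)=1$) are solutions of $\frac{d^2x^i}{ds^2}+G^i(x,\frac{dx}{ds})=0$. Complete means that every arc-length geodesic extends to all $s\in(-\infty,\infty)$. Riemann curvature: $R^i_k=\frac{\partial G^i}{\partial x^k}-\frac12 y^j\frac{\partial^2G^i}{\partial x^j\partial y^k}+\frac12 G^j\frac{\partial^2G^i}{\partial y^j\partial y^k}-\frac14\frac{\partial G^i}{\partial y^j}\frac{\partial G^j}{\partial y^k}$. The Ricci scalar $Ric$ is defined by $F^2Ric=R^i_i$, and the Ricci tensor (Akbar-Zadeh) is $Ric_{ik}:=\frac12(F^2Ric)_{y^iy^k}$. The Schwarzian derivative of $p(s)$ with $p'\ne0$ is $\{p,s\}=\frac{p'''}{p'}-\frac32\left(\frac{p''}{p'}\right)^2$.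 A projective parameter of an arc-length geodesic $x(s)$ is a solution $p(s)$ of $\{p,s\}=\frac{2}{n-1}Ric_{jk}\frac{dx^j}{ds}\frac{dx^k}{ds}$, where $Ric_{jk}$ is evaluated at $(x(s),dx/ds)$; it is unique up to linear fractional transformations $p\mapsto\frac{ap+b}{cp+d}$, $ad-bc\ne0$. Let $I=(-1,1)$. A map $f:I\to M$ is called projective if it is a geodesic $f(u)$ whose parameter $u$ is a projective parameter. Fix a constant $k>0$. The Funk distance on $I$ is $$D_f(a,b)=\frac1{2k}\left(\left|\ln\frac{(1-a)(1+b)}{(1-b)(1+a)}\right|+\ln\frac{1-a^2}{1-b^2}\right),\quad a,b\in I.$$ A chain $\alpha$ of geodesic segments from $x$ to $y$ consists of points $x=x_0,x_1,\dots,x_m=y$ of $M$, pairs $a_1,b_1,\dots,a_m,b_m\in I$, and projective maps $f_1,\dots,f_m:I\to M$ with $f_i(a_i)=x_{i-1}$, $f_i(b_i)=x_i$. Its length is $L(\alpha)=\sum_iD_f(a_i,b_i)$, and $d_M(x,y):=\inf_\alpha L(\alpha)$ over all chains from $x$ to $y$. *)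

(* Defs.v *)
From HB Require Import structures.
From mathcomp Require Import all_boot all_order all_algebra.
From mathcomp Require Import all_classical all_reals all_analysis.

Set Implicit Arguments.
Unset Strict Implicit.
Unset Printing Implicit Defensive.

Import Order.TTheory GRing.Theory Num.Theory.
Import numFieldNormedType.Exports.

Local Open Scope classical_set_scope.
Local Open Scope ring_scope.

(* To be used with [U] open.  Quantifying over all directions [v] is the same
   as quantifying over the coordinate directions, for continuous iterated
   partial derivatives. *)
Fixpoint Ck_on (R : realType) (V W : normedModType R) (U : set V) (m : nat)
    (f : V -> W) : Prop :=
  (forall x, U x -> {for x, continuous f}) /\
  match m with
  | 0%N => True
  | m'.+1 => forall v, (forall x, U x -> derivable f x v) /\
                       Ck_on U m' (fun x => 'D_v f x)
  end.

Definition smooth_on (R : realType) (V W : normedModType R) (U : set V)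
    (f : V -> W) : Prop :=
  forall m, Ck_on U m f.

(* Charts are total functions, meaningful on [chart_dom a] only; [chart_inv a]
   is the inverse chart, meaningful on the open set
   [chart a @` chart_dom a] only.  The atlas need not be maximal. *)
Record manifold (R : realType) (n : nat) := Manifold {
  carrier :> topologicalType;
  manifold_hausdorff : hausdorff_space carrier;
  manifold_second_countable : @second_countable carrier;
  chart_idx : Type;
  chart_dom : chart_idx -> set carrier;
  chart : chart_idx -> carrier -> 'rV[R]_n;
  chart_inv : chart_idx -> 'rV[R]_n -> carrier;
  chart_dom_open : forall a, open (chart_dom a);
  chart_cover : forall x, exists a, chart_dom a x;
  chart_image_open : forall a, open (chart a @` chart_dom a);
  chartK : forall a x, chart_dom a x -> chart_inv a (chart a x) = x;
  chart_continuous : forall a x, chart_dom a x ->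
    {for x, continuous (chart a)};
  chart_inv_continuous : forall a z, (chart a @` chart_dom a) z ->
    {for z, continuous (chart_inv a)};
  transition_smooth : forall a b,
    smooth_on (chart a @` (chart_dom a `&` chart_dom b))
              (chart b \o chart_inv a)
}.

Definition transition (R : realType) (n : nat) (M : manifold R n)
    (a b : chart_idx M) : 'rV[R]_n -> 'rV[R]_n :=
  chart b \o @chart_inv R n M a.

(* A point [(x, y)] of a chart of TM is a pair of row vectors: the coordinates
   of the base point and the components of the tangent vector. *)
Definition dx (R : realType) (n : nat) (i : 'I_n)
    (h : 'rV[R]_n * 'rV[R]_n -> R) (z : 'rV[R]_n * 'rV[R]_n) : R :=
  'D_(delta_mx 0 i : 'rV[R]_n, 0 : 'rV[R]_n) h z.

Definition dy (R : realType) (n : nat) (i : 'I_n)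
    (h : 'rV[R]_n * 'rV[R]_n -> R) (z : 'rV[R]_n * 'rV[R]_n) : R :=
  'D_(0 : 'rV[R]_n, delta_mx 0 i : 'rV[R]_n) h z.

(* In this block, [L] is the expression of the Finsler function in a chart.  A
   composite [dy k (dx j h)] is the second derivative [h_{x^j y^k}]. *)
Section LocalFormulas.
Variables (R : realType) (n : nat) (L : 'rV[R]_n * 'rV[R]_n -> R).
Implicit Types (z : 'rV[R]_n * 'rV[R]_n) (i j k l : 'I_n).

Definition energy z : R := L z ^+ 2.

Definition fundamental z : 'M[R]_n :=
  \matrix_(i, j) dy j (dy i (fun w => 2^-1 * energy w)) z.

(* Normalized so that arc-length geodesics solve [x'' + G(x, x') = 0]. *)
Definition spray i z : R :=
  2^-1 * \sum_l invmx (fundamental z) i l *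
    ((\sum_k dy l (dx k energy) z * z.2 0 k) - dx l energy z).

Definition riemann i k z : R :=
  dx k (spray i) z
  - 2^-1 * (\sum_j z.2 0 j * dy k (dx j (spray i)) z)
  + 2^-1 * (\sum_j spray j z * dy k (dy j (spray i)) z)
  - 4^-1 * (\sum_j dy j (spray i) z * dy k (spray j) z).

Definition ricci_scalar z : R := (\sum_i riemann i i z) / L z ^+ 2.

Definition ricci_tensor z : 'M[R]_n :=
  \matrix_(i, k) (2^-1 * dy k (dy i (fun w => L w ^+ 2 * ricci_scalar w)) z).

End LocalFormulas.

Definition quad_form (R : realType) (n : nat) (A : 'M[R]_n) (v : 'rV[R]_n) : R :=
  \sum_i \sum_j A i j * v 0 i * v 0 j.

(* TM is glued from the sets [chart a @` chart_dom a] times R^n along the maps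
   [(x, y) |-> (tau x, d tau_x y)], [tau] running over the transition maps; so
   a function on TM is a family [finsler_fun a] of functions of the chart
   coordinates that is compatible with these maps.  Values of
   [finsler_fun a] off [tangent_chart a] play no role. *)
Definition tangent_chart (R : realType) (n : nat) (M : manifold R n)
    (a : chart_idx M) : set ('rV[R]_n * 'rV[R]_n) :=
  [set z | (chart a @` chart_dom a) z.1].

Definition slit_chart (R : realType) (n : nat) (M : manifold R n)
    (a : chart_idx M) : set ('rV[R]_n * 'rV[R]_n) :=
  [set z | tangent_chart a z /\ z.2 != 0].

Record finsler (R : realType) (n : nat) (M : manifold R n) := Finsler {
  finsler_fun : chart_idx M -> 'rV[R]_n * 'rV[R]_n -> R;
  finsler_compat : forall (a b : chart_idx M) (p : M) (y : 'rV[R]_n),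
    chart_dom a p -> chart_dom b p ->
    finsler_fun b (chart b p, 'D_y (transition a b) (chart a p)) =
    finsler_fun a (chart a p, y);
  finsler_ge0 : forall a z, tangent_chart a z -> 0 <= finsler_fun a z;
  finsler_smooth : forall a, smooth_on (slit_chart a) (finsler_fun a);
  finsler_homogeneous : forall a (x y : 'rV[R]_n) (lambda : R),
    tangent_chart a (x, y) -> 0 < lambda ->
    finsler_fun a (x, lambda *: y) = lambda * finsler_fun a (x, y);
  finsler_posdef : forall a z, slit_chart a z ->
    forall v, v != 0 -> 0 < quad_form (fundamental (finsler_fun a) z) v
}.

Section FinslerSpace.
Variables (R : realType) (n : nat) (M : manifold R n) (F : finsler M).

Definition ricci_psd : Prop :=
  forall (a : chart_idx M) z, slit_chart a z ->
    forall v, 0 <= quad_form (ricci_tensor (finsler_fun F a) z) v.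

Definition open_interval (J : set R) : Prop :=
  [/\ open J, is_interval J & J !=set0].

Definition local_curve (c : R -> M) (a : chart_idx M) : R -> 'rV[R]_n :=
  chart a \o c.

Definition velocity (c : R -> M) (a : chart_idx M) (s : R) :
    'rV[R]_n * 'rV[R]_n :=
  (local_curve c a s, derive1 (local_curve c a) s).

Definition arclength_geodesic (J : set R) (c : R -> M) : Prop :=
  forall s, J s ->
    {for s, continuous c} /\
    forall a, chart_dom a (c s) ->
      [/\ derivable (local_curve c a) s 1,
          derivable (derive1 (local_curve c a)) s 1,
          finsler_fun F a (velocity c a s) = 1 &
          forall i, derive1n 2 (local_curve c a) s 0 i
                    + spray (finsler_fun F a) i (velocity c a s) = 0].

Definition complete_finsler : Prop :=
  forall (J : set R) (c : R -> M),
    open_interval J -> arclength_geodesic J c ->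
    exists c' : R -> M,
      arclength_geodesic setT c' /\ (forall s, J s -> c' s = c s).

Definition schwarzian (p : R -> R) (s : R) : R :=
  derive1n 3 p s / derive1 p s
  - 3 / 2 * (derive1n 2 p s / derive1 p s) ^+ 2.

Definition projective_parameter (J : set R) (c : R -> M) (p : R -> R) : Prop :=
  forall s, J s ->
    [/\ derivable p s 1, derivable (derive1 p) s 1,
        derivable (derive1n 2 p) s 1,
        derive1 p s != 0 &
        forall a, chart_dom a (c s) ->
          schwarzian p s =
          2 / (n%:R - 1) *
          quad_form (ricci_tensor (finsler_fun F a) (velocity c a s))
                    (velocity c a s).2].

Definition funk_interval : set R := [set u | -1 < u < 1].

(* Only the values of [f] on [funk_interval] matter.  Both signs of p' are
   allowed: projective parameters are defined up to all linear fractional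
   transformations with nonzero determinant. *)
Definition projective_map (f : R -> M) : Prop :=
  exists (J : set R) (c : R -> M) (p : R -> R),
    [/\ open_interval J, arclength_geodesic J c, projective_parameter J c p,
        set_bij J funk_interval p & forall s, J s -> f (p s) = c s].

End FinslerSpace.

Definition funk_dist (R : realType) (k a b : R) : R :=
  (2 * k)^-1 * (`|ln (((1 - a) * (1 + b)) / ((1 - b) * (1 + a)))|
                + ln ((1 - a ^+ 2) / (1 - b ^+ 2))).

(* A chain with [m] segments; the [i]-th segment, numbered from 0, joins [pt i]
   to [pt i.+1].  Only [pt i] for i <= m and [a i], [b i], [f i] for i < m
   matter. *)
Definition is_chain (R : realType) (n : nat) (M : manifold R n) (F : finsler M)
    (x y : M) (m : nat) (pt : nat -> M) (a b : nat -> R) (f : nat -> R -> M) :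
    Prop :=
  [/\ (0 < m)%N, pt 0%N = x, pt m = y &
      forall i, (i < m)%N ->
        [/\ funk_interval (a i), funk_interval (b i), projective_map F (f i),
            f i (a i) = pt i & f i (b i) = pt i.+1]].

(* Valued in the extended reals, so that the infimum over an empty set of
   chains is [+oo] and not the default value 0 of [inf]. *)
Definition pseudo_dist (R : realType) (n : nat) (M : manifold R n)
    (F : finsler M) (k : R) (x y : M) : \bar R :=
  ereal_inf [set l : \bar R | exists m pt a b f,
    is_chain F x y m pt a b f /\
    l = (\sum_(i < m) funk_dist k (a i) (b i))%:E].

(* Main.v *)
Require Import Defs.
From HB Require Import structures.
From mathcomp Require Import all_boot all_order all_algebra.
From mathcomp Require Import all_classical all_reals all_analysis.
From mathcomp Require Import ring lra.

Set Implicit Arguments.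
Unset Strict Implicit.
Unset Printing Implicit Defensive.

Import Order.TTheory GRing.Theory Num.Theory.
Import numFieldNormedType.Exports.

Local Open Scope classical_set_scope.
Local Open Scope ring_scope.

(** Along an arc-length geodesic c defined on the whole line put Q =
    Ric (c', c') / (n - 1), a continuous function, non-negative by assumption.
    Projective parameters of c are the solutions of {p, s} = 2 Q, that is, the
    quotients of two independent solutions of w'' + Q w = 0. Let v and u be the
    solutions with v = 1, v' = 0 and u = 0, u' = 1 at a given s0, and for T > 0
    consider w = T v - u and y = T v + u. Because Q >= 0, a solution is concave
    where it is positive; so w, which decreases at s0, vanishes at a first
    b > s0, and y vanishes at a last a < s0. The Wronskian of w and y is a
    constant, which keeps both positive between a and b; hence
    p = (y - w) / (y + w) = u / (T v) increases from -1 at a to 1 at b, and c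
    read in the parameter p is a projective map
    ([projective_reparametrization]). When T tends to infinity, p (s) tends to
    0 = p (s0) for each s near s0, and with it the Funk distance between p (s)
    and p (s0) ([funk_dist_small]). Completeness enters because a and b may move
    away as T grows.

    To be joined by chains of arbitrarily small length is an equivalence
    relation. Near each of its points a geodesic stays in one class
    ([geodesic_locally_linked]), hence it stays in one class altogether because
    the line is connected ([connected_relation]). As M is connected too, it
    remains to see that classes are open in M, and for this that all points
    close to a given one lie on geodesics through a common point
    ([geodesics_to_common_point]). Geodesics from p to a target fixed in advance
    are found by solving the two-point problem x'' + G (x, x') = 0, x (0) = p,
    x (T) = x0 + T w in a chart, with w a fixed nonzero vector and T small
    ([local_bvp]). Velocities then stay close to w, away from the zero section,
    where the spray need not be smooth; and since the target does not move with
    p, no inverse function theorem for the exponential map is called for. This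
    problem, and the linear equation above, are both solved by the contraction
    principle for a norm weighted by an exponential ([ode_functional]).

    The curve found in one chart has to be a geodesic in all charts, and
    Ric (c', c') has to be continuous across charts: the spray and the Ricci
    tensor must be shown to transform correctly. For the spray this follows from
    the Euler-Lagrange equations of the energy, which determine it
    ([spray_change]). For the curvature, differentiating the law of the spray
    shows that the matrices P = dG/dy and S = dG/dx change like the coefficients
    of J'' + P J' + S J = 0, the linearised geodesic equation, under a
    substitution by a moving frame, and the curvature is the combination
    S - P'/2 - P^2/4, which such a substitution only conjugates
    ([gauge_curvature]); its trace does not change, and neither does the Hessian
    of that trace along the fibres ([ricci_change]). *)

(** * Directional derivatives and functions of class C^k *)

Section Lines.
Context {R : realType} {V : normedModType R}.

Lemma is_derive_line {W : normedModType R} (f : V -> W) x v (t : R) :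
  derivable f (x + t *: v) v ->
  is_derive t 1 (fun s => f (x + s *: v)) ('D_v f (x + t *: v)).
Proof.
set g := fun s : R => _.
have gE : (fun h : R => h^-1 *: (g (h *: 1 + t) - g t)) =
          (fun h : R => h^-1 *: (f (h *: v + (x + t *: v)) - f (x + t *: v))).
  apply/funext => h; rewrite /g; congr (_ *: (f _ - _)).
  by rewrite [h *: 1]mulr1 scalerDl addrCA.
by move=> df; split; [rewrite /derivable gE|rewrite /derive gE].
Qed.

(** The increment h is a coordinate of a vector in most uses, so its sign is
    left free. *)
Lemma line_MVT (f : V -> R) x v (h : R) :
  (forall c : R, `|c| <= `|h| -> derivable f (x + c *: v) v) ->
  exists2 c : R, `|c| <= `|h| & f (x + h *: v) - f x = h * 'D_v f (x + c *: v).
Proof.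
move=> df; pose g (s : R) := f (x + s *: v).
have dg (c : R) : `|c| <= `|h| -> is_derive c 1 g ('D_v f (x + c *: v)).
  by move=> /df; exact: is_derive_line.
have g0 : g 0 = f x by rewrite /g scale0r addr0.
have gc (c d : R) : (forall z, z \in `[c, d] -> `|z| <= `|h|) ->
    {within `[c, d], continuous g}.
  move=> cd; apply: derivable_within_continuous => z /cd zh.
  by case: (dg z zh).
have [h0|h0] := leP 0 h.
- have := h0; rewrite le_eqVlt => /orP[/eqP <-|h1].
    by exists 0; rewrite // scale0r addr0 subrr mul0r.
  have B z : z \in `[0, h] -> `|z| <= `|h|.
    by rewrite in_itv /= => /andP[z0 zh]; rewrite !ger0_norm.
  have [c ch E] := MVT h1 (fun z zh => dg z (B z (subset_itv_oo_cc zh))) (gc _ _ B).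
  exists c; first by apply: B; exact: subset_itv_oo_cc.
  by rewrite -g0 -/(g h) E subr0 mulrC.
- have B z : z \in `[h, 0] -> `|z| <= `|h|.
    by rewrite in_itv /= => /andP[z0 zh]; rewrite !ler0_norm ?lerN2// ltW.
  have [c ch E] := MVT h0 (fun z zh => dg z (B z (subset_itv_oo_cc zh))) (gc _ _ B).
  exists c; first by apply: B; exact: subset_itv_oo_cc.
  have -> : f (x + h *: v) - f x = - (g 0 - g h) by rewrite g0 opprB.
  by rewrite E sub0r mulrN opprK mulrC.
Qed.

End Lines.

(** A finite system of coordinates bounded by the norm, through which statements
    about all directions reduce to finitely many. Row vectors and pairs of them,
    the points of a tangent bundle, have one each; indices are natural numbers
    so that partial sums can be treated by recursion. *)
Record coords (R : realType) (V : normedModType R) := Coords {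
  coord_num : nat;
  coord_vec : nat -> V;
  coord_fun : nat -> V -> R;
  coord_fun_linear : forall i, linear (coord_fun i : V -> R^o);
  coord_fun_le : forall i v, `|coord_fun i v| <= `|v|;
  coord_funK : forall v, v = \sum_(i < coord_num) coord_fun i v *: coord_vec i
}.

Section RowCoords.
Context {R : realType} {n : nat}.

Definition row_vec (i : nat) : 'rV[R]_n :=
  oapp (fun j : 'I_n => delta_mx 0 j) 0 (insub i).

Definition row_fun (i : nat) (v : 'rV[R]_n) : R :=
  oapp (fun j : 'I_n => v 0 j) 0 (insub i).

Lemma coord_le_norm (v : 'rV[R]_n) j : `|v 0 j| <= `|v|.
Proof.
rewrite [leRHS]/Num.Def.normr/= mx_normrE.
exact: (le_bigmax _ (fun ij => `|v ij.1 ij.2|) (0, j)).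
Qed.

Lemma row_normP (v : 'rV[R]_n) (e : R) :
  0 <= e -> (forall j, `|v 0 j| <= e) -> `|v| <= e.
Proof.
move=> e0 ve; rewrite /Num.Def.normr/= mx_normrE (bigmax_le _ e0)//= => -[i j] _.
by rewrite ord1.
Qed.

Definition row_coords : coords 'rV[R]_n.
Proof.
apply: (@Coords R 'rV[R]_n n row_vec row_fun).
- by move=> i a u v; rewrite /row_fun; case: insub => [j|] /=; rewrite ?scaler0 ?addr0// !mxE.
- move=> i v; rewrite /row_fun; case: insub => [j|] /=; last by rewrite normr0.
  exact: coord_le_norm.
- move=> v; rewrite [LHS]row_sum_delta; apply: eq_bigr => i _.
  by rewrite /row_fun /row_vec valK.
Defined.

End RowCoords.
Arguments row_coords {R n}.

Section PairCoords.
Context {R : realType} {V W : normedModType R}.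

Lemma norm_fst_le (z : V * W) : `|z.1| <= `|z|.
Proof. by rewrite [leRHS]prod_normE le_max lexx. Qed.

Lemma norm_snd_le (z : V * W) : `|z.2| <= `|z|.
Proof. by rewrite [leRHS]prod_normE le_max lexx orbT. Qed.

Lemma pair_normP (z : V * W) (e : R) : `|z.1| <= e -> `|z.2| <= e -> `|z| <= e.
Proof. by move=> a b; rewrite prod_normE ge_max a b. Qed.

Definition pair_coords (A : coords V) (B : coords W) :
  coords (V * W)%type.
Proof.
pose N := coord_num A.
apply: (@Coords R (V * W)%type (N + coord_num B)
  (fun i => if (i < N)%N then (coord_vec A i, 0) else (0, coord_vec B (i - N)))
  (fun i z => if (i < N)%N then coord_fun A i z.1 else coord_fun B (i - N) z.2)).
- by move=> i a u v; case: ifP => _; rewrite coord_fun_linear.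
- move=> i v; case: ifP => _; apply: (le_trans (coord_fun_le _ _ _)).
    exact: norm_fst_le.
  exact: norm_snd_le.
- move=> v; rewrite big_split_ord/=.
  under eq_bigr do rewrite ltn_ord.
  under [X in _ + X]eq_bigr do rewrite ltnNge leq_addr/= addKn.
  case: v => a b /=; rewrite {1}(coord_funK A a) {1}(coord_funK B b).
  rewrite -[LHS]/(\sum_(i < N) coord_fun A i a *: coord_vec A i,
    \sum_(i < coord_num B) coord_fun B i b *: coord_vec B i).
  have sumL m (F : 'I_m -> V) : \sum_i (F i, 0 : W) = (\sum_i F i, 0).
    by elim/big_rec2: _ => // i y1 y2 _ ->; congr pair; rewrite /= addr0.
  have sumR m (F : 'I_m -> W) : \sum_i (0 : V, F i) = (0, \sum_i F i).
    by elim/big_rec2: _ => // i y1 y2 _ ->; congr pair; rewrite /= addr0.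
  under eq_bigr do rewrite -[_ *: _]/(_ *: _, _ *: _) scaler0.
  under [X in _ + X]eq_bigr do rewrite -[_ *: _]/(_ *: _, _ *: _) scaler0.
  by rewrite sumL sumR -[RHS]/(_ + _, _ + _) addr0 add0r.
Defined.

End PairCoords.

Section C1.
Context {R : realType} {V : normedModType R} (B : coords V).

Local Notation N := (coord_num B).
Local Notation e := (coord_vec B).
Local Notation co := (coord_fun B).

Lemma coord_sum_norm (k : nat) (v : V) (E : R) : (k <= N)%N ->
  (forall i : 'I_N, `|e i| <= E) ->
  `|\sum_(i < k) co i v *: e i| <= k%:R * (`|v| * E).
Proof.
move=> kN eE; apply: (le_trans (ler_norm_sum _ _ _)).
apply: (@le_trans _ _ (\sum_(i < k) `|v| * E)); last first.
  by rewrite sumr_const card_ord mulr_natl.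
apply: ler_sum => i _; rewrite normrZ ler_pM ?coord_fun_le//.
exact: (eE (widen_ord kN i)).
Qed.

(** The increment of f over h is telescoped along the broken line through the
    partial sums of h. By the mean value theorem each step equals a coordinate
    of h times a partial derivative at some point near x, and by continuity that
    derivative is close to the one at x. *)
Lemma C1_differentiable (f : V -> R) x :
  (forall i : 'I_N, \forall y \near x, derivable f y (e i)) ->
  (forall i : 'I_N, {for x, continuous (fun y => 'D_(e i) f y)}) ->
  differentiable f x.
Proof.
move=> df cf.
pose L v := \sum_(i < N) co i v * 'D_(e i) f x : R^o.
have Llin : linear (L : V -> R^o).
  move=> a u v; rewrite /L scaler_sumr -big_split /=; apply: eq_bigr => i _.
  rewrite coord_fun_linear mulrDl; congr (_ + _).
  by rewrite [RHS]mulrA.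
pose dL : {linear V -> R^o} := HB.pack L (GRing.isLinear.Build R V R^o _ L Llin).
pose E := \big[Num.max/0]_(i < N) `|e i|.
have eE (i : 'I_N) : `|e i| <= E by exact: (le_bigmax _ (fun i : 'I_N => `|e i|) i).
have E0 : 0 <= E by rewrite /E; elim/big_ind: _ => // a b a0 b0; rewrite le_max a0.
have Lc : continuous dL.
  apply/linear_bounded_continuous; apply/linear_boundedP.
  pose D := \sum_(i < N) `|'D_(e i) f x|.
  near=> r => v.
  rewrite /dL /= /L; apply: (le_trans (ler_norm_sum _ _ _)).
  apply: (@le_trans _ _ (D * `|v|)).
    rewrite mulr_suml; apply: ler_sum => i _.
    by rewrite normrM mulrC ler_wpM2l ?coord_fun_le.
  by rewrite ler_wpM2r// ltW//; near: r; exact: nbhs_pinfty_gt.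
suff H : f \o shift x = cst (f x) + dL +o_ 0 id.
  by apply/diff_locallyP; rewrite (diff_unique Lc H).
apply/eqaddoE/eqaddoP => _/posnumP[eps].
pose eps' := eps%:num / (N%:R + 1).
have eps'0 : 0 < eps' by rewrite divr_gt0// ltr_wpDl.
have [d d0 Hd] : exists2 d : R, 0 < d & forall y, `|y - x| < d -> forall i : 'I_N,
    derivable f y (e i) /\ `|'D_(e i) f y - 'D_(e i) f x| <= eps'.
  have : \forall y \near x, forall i : 'I_N,
      derivable f y (e i) /\ `|'D_(e i) f y - 'D_(e i) f x| <= eps'.
    apply: filter_forall => i; near=> y; split; first by near: y; exact: df.
    by rewrite distrC; near: y; move/cvgrPdist_le: (cf i); exact.
  move=> /nbhs_ballP[d /= d0 H]; exists d => // y yd; apply: H.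
  by rewrite -ball_normE /= distrC.
near=> h.
(* The broken line and the mean value points on its edges stay within d of x. *)
have hd : (N%:R + 2) * (`|h| * (E + 1)) < d.
  rewrite mulrCA -ltr_pdivlMr ?mulr_gt0 ?ltr_wpDl//.
  near: h; apply/nbhs_ballP; exists (d / ((N%:R + 2) * (E + 1))) => /=.
    by rewrite divr_gt0// mulr_gt0 ?ltr_wpDl.
  by move=> y; rewrite -ball_normE /= sub0r normrN.
have step k : (k <= N)%N ->
  `|f (x + \sum_(i < k) co i h *: e i) - f x
    - \sum_(i < k) co i h * 'D_(e i) f x| <= k%:R * (eps' * `|h|).
  elim: k => [|k IH] kN.
    by rewrite !big_ord0 addr0 !subrr normr0 mul0r.
  rewrite !big_ord_recr /=; set S := \sum_(i < k) co i h *: e i.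
  set T := \sum_(i < k) _.
  have near_x (c : R) : `|c| <= `|co k h| -> `|x + S + c *: e k - x| < d.
    move=> hc; apply: le_lt_trans hd.
    rewrite -(addrA x) [x + _]addrC addrK (le_trans (ler_normD _ _))//.
    have ekE : `|e k| <= E by exact: (eE (Ordinal kN)).
    apply: (@le_trans _ _ (k%:R * (`|h| * E) + `|h| * E)).
      rewrite lerD ?coord_sum_norm ?(ltnW kN)// normrZ ler_pM//.
      exact: (le_trans hc (coord_fun_le _ _ _)).
    rewrite -[X in _ + X]mul1r -mulrDl natr1 ler_pM ?mulr_ge0//.
      by rewrite -[2]/(2%:R) -natrD ler_nat addn2 ltnW// ltnS ltnW// ltnS ltnW.
    by rewrite ler_wpM2l ?lerDl.
  have [c ch E1] := line_MVT (fun c hc => (Hd _ (near_x c hc) (Ordinal kN)).1).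
  rewrite (_ : _ - _ = (f (x + S) - f x - T) +
     (co k h * ('D_(e k) f (x + S + c *: e k) - 'D_(e k) f x))); last first.
    by rewrite mulrBr -E1 addrA; ring.
  rewrite -[in leRHS]natr1 mulrDl mul1r (le_trans (ler_normD _ _))// lerD ?IH ?(ltnW kN)//.
  rewrite normrM mulrC ler_pM ?coord_fun_le//.
  by apply: (Hd _ (near_x c ch) (Ordinal kN)).2.
have := step N (leqnn N); rewrite -coord_funK => HN.
rewrite -[X in `|X| <= _]/(f (h + x) - (f x + L h)) [h + x]addrC opprD addrA.
apply: (le_trans HN); rewrite mulrA ler_wpM2r// /eps' mulrCA ger_pMr//.
by rewrite ler_pdivrMr ?mul1r ?lerDl ?ltr_wpDl.
Unshelve. all: by end_near. Qed.

End C1.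

Section IsDerive.
Context {R : realType}.

(** Directional derivatives are derivatives of functions of one real variable,
    for which being derivable and being differentiable agree; the rules below
    are deduced from those for differentials in this way. *)
Lemma is_derive_lineP {V W : normedModType R} (f : V -> W) x v d :
  is_derive x v f d <-> is_derive (0 : R) 1 (fun h => f (x + h *: v)) d.
Proof.
have gE : (fun h : R => h^-1 *: (f (x + (h *: (1:R) + 0 : R) *: v) - f (x + (0:R) *: v))) =
          (fun h : R => h^-1 *: (f (h *: v + x) - f x)).
  apply/funext => h; congr (_ *: (f _ - f _)); last by rewrite scale0r addr0.
  by rewrite [h *: 1]mulr1 addr0 addrC.
by split=> -[H1 H2]; split; rewrite /derivable /derive ?gE// -gE.
Qed.

Lemma is_derive_translate {V W : normedModType R} (f : V -> W) x v w :
  derivable f (x + w) v ->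
  is_derive x v (fun y => f (y + w)) ('D_v f (x + w)).
Proof.
have gE : (fun h : R => h^-1 *: (f (h *: v + x + w) - f (x + w))) =
          (fun h : R => h^-1 *: (f (h *: v + (x + w)) - f (x + w))).
  by apply/funext => h; rewrite addrA.
by move=> df; split; [rewrite /derivable gE|rewrite /derive gE].
Qed.

(** Only the curve h |-> g (x + h v) matters, so that g is differentiated in a
    single direction. *)
Lemma is_derive_chain {U V W : normedModType R} (g : U -> V) (f : V -> W) x v dg :
  is_derive x v g dg -> differentiable f (g x) ->
  is_derive x v (fun y => f (g y)) ('D_dg f (g x)).
Proof.
move=> /is_derive_lineP dgx df; apply/is_derive_lineP.
set gl := fun h : R => _ in dgx.
have gl0 : gl 0 = g x by rewrite /gl scale0r addr0.
have dgl : differentiable gl 0 by apply/derivable1_diffP; case: dgx.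
have dfl : differentiable f (gl 0) by rewrite gl0.
rewrite -[X in is_derive _ _ X _]/(f \o gl).
have dc : differentiable (f \o gl) 0 by exact: differentiable_comp.
split; first exact/derivable1_diffP.
have E : dg = 'd gl 0 1 by case: dgx => _ <-; rewrite deriveE.
by rewrite deriveE// diff_comp//= E gl0 deriveE.
Qed.

Lemma is_derive_pair {U V W : normedModType R} (f : U -> V) (g : U -> W) x v df dg :
  is_derive x v f df -> is_derive x v g dg ->
  is_derive x v (fun y => (f y, g y)) (df, dg).
Proof.
move=> /is_derive_lineP Hf /is_derive_lineP Hg; apply/is_derive_lineP.
set a := fun h : R => _ in Hf; set b := fun h : R => _ in Hg.
have da : differentiable a 0 by apply/derivable1_diffP; case: Hf.
have db : differentiable b 0 by apply/derivable1_diffP; case: Hg.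
have dab : differentiable (fun h => (a h, b h)) 0 by exact: differentiable_pair.
split; first exact/derivable1_diffP.
rewrite deriveE// diff_pair//=; congr (_, _).
  by rewrite -deriveE//; case: Hf.
by rewrite -deriveE//; case: Hg.
Qed.

Lemma is_derive_linear {V W : normedModType R} (f : {linear V -> W}) x v :
  continuous f -> is_derive x v f (f v).
Proof.
move=> cf; split; first exact/diff_derivable/linear_differentiable.
by rewrite deriveE ?diff_lin//; exact: linear_differentiable.
Qed.

Lemma is_derive_fst {U V W : normedModType R} (f : U -> (V * W)%type) x v d :
  is_derive x v f d -> is_derive x v (fun y => (f y).1) d.1.
Proof.
move=> df; have c : continuous (fst : (V * W)%type -> V) by move=> ?; exact: cvg_fst.
have := @is_derive_linear _ _ (fst : {linear (V * W)%type -> V}) (f x) d c.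
move=> [_ <-]; apply: (is_derive_chain (f := fst) df).
exact: linear_differentiable.
Qed.

Lemma is_derive_snd {U V W : normedModType R} (f : U -> (V * W)%type) x v d :
  is_derive x v f d -> is_derive x v (fun y => (f y).2) d.2.
Proof.
move=> df; have c : continuous (snd : (V * W)%type -> W) by move=> ?; exact: cvg_snd.
have := @is_derive_linear _ _ (snd : {linear (V * W)%type -> W}) (f x) d c.
move=> [_ <-]; apply: (is_derive_chain (f := snd) df).
exact: linear_differentiable.
Qed.

Lemma is_derive_row {U : normedModType R} {n} (M : U -> 'rV[R]_n) x v d :
  is_derive x v M d <-> forall i, is_derive x v (fun y => M y 0 i) (d 0 i).
Proof.
split=> [[dM <-] i|H].
  split; first exact: (derivable_mxP M x v).1.
  by rewrite derive_mx// mxE.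
have dM : derivable M x v.
  by apply/derivable_mxP => i j; rewrite ord1; case: (H j).
by split=> //; apply/rowP => i; rewrite derive_mx// mxE; case: (H i).
Qed.

Lemma is_derive_bigsum {V : normedModType R} (I : Type) (r : seq I) (P : pred I)
  (h : I -> V -> R) x v (dh : I -> R) :
  (forall i, P i -> is_derive x v (h i) (dh i)) ->
  is_derive x v (fun y => \sum_(i <- r | P i) h i y) (\sum_(i <- r | P i) dh i).
Proof.
move=> H; elim: r => [|i r IH].
  rewrite big_nil; under eq_fun do rewrite big_nil.
  exact: is_derive_cst.
rewrite big_cons; under eq_fun do rewrite big_cons.
by case: ifPn => // Pi; apply: is_deriveD; exact: H.
Qed.

End IsDerive.

Section Schwarz.
Context {R : realType} {V : normedModType R}.
Implicit Types (U : set V) (f : V -> R).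

Lemma Ck_on_continuous {W : normedModType R} U m (f : V -> W) x :
  Ck_on U m f -> U x -> {for x, continuous f}.
Proof. by case: m => [|m] [H _]; exact: H. Qed.

Lemma Ck_on_derivable {W : normedModType R} U m (f : V -> W) x v :
  Ck_on U m.+1 f -> U x -> derivable f x v.
Proof. by move=> [_ H] Ux; exact: (H v).1. Qed.
Arguments Ck_on_derivable {W U m f x} v _ _.

Lemma Ck_on_D {W : normedModType R} U m (f : V -> W) v :
  Ck_on U m.+1 f -> Ck_on U m (fun x => 'D_v f x).
Proof. by move=> [_ H]; exact: (H v).2. Qed.

Lemma Ck_onS {W : normedModType R} U m (f : V -> W) :
  Ck_on U m.+1 f -> Ck_on U m f.
Proof.
elim: m f => [|m IH] f; first by case=> H _; split.
case=> cf H; split=> // v; split; first exact: (H v).1.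
exact: IH (H v).2.
Qed.

Lemma Ck_on_eq {W : normedModType R} U m (f g : V -> W) : open U ->
  (forall x, U x -> f x = g x) -> Ck_on U m f -> Ck_on U m g.
Proof.
move=> oU; elim: m f g => [|m IH] f g fg [cf H].
  split=> // x Ux; rewrite /prop_for /continuous_at -(fg x Ux).
  apply: cvg_trans (cf x Ux); apply: near_eq_cvg.
  by near=> y; apply: fg; near: y; exact: open_nbhs_nbhs.
have nfg x : U x -> {near x, f =1 g}.
  by move=> Ux; near=> y; apply: fg; near: y; exact: open_nbhs_nbhs.
split=> [x Ux|v].
  rewrite /prop_for /continuous_at -(fg x Ux).
  by apply: cvg_trans (cf x Ux); exact: near_eq_cvg (nfg x Ux).
split=> [x Ux|]; first exact: near_eq_derivable (nfg x Ux) ((H v).1 x Ux).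
apply: IH (H v).2 => x Ux; apply: near_eq_derive; exact: nfg.
Unshelve. all: by end_near. Qed.

Lemma open_normP U x : open U -> U x ->
  exists2 d : R, 0 < d & forall y, `|y - x| < d -> U y.
Proof.
move=> oU Ux; have : nbhs x U by exact: open_nbhs_nbhs.
move=> /nbhs_ballP[d /= d0 H]; exists d => // y yd; apply: H.
by rewrite -ball_normE /= distrC.
Qed.

Lemma continuous_normP {W : normedModType R} (f : V -> W) x (e : R) :
  {for x, continuous f} -> 0 < e ->
  exists2 d : R, 0 < d & forall y, `|y - x| < d -> `|f y - f x| < e.
Proof.
move=> /cvgrPdist_lt/(_ e) H /H /nbhs_ballP[d /= d0 K]; exists d => // y yd.
by rewrite distrC; apply: K; rewrite -ball_normE /= distrC.
Qed.

(** The mean value theorem is used twice: in direction u for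
    y |-> f (y + s v) - f y, and then in direction v for the derivative of f
    along u. *)
Lemma second_difference U f (x u v : V) (d s : R) :
  (forall y, `|y - x| < d -> U y) -> Ck_on U 2 f ->
  `|s| * (`|u| + `|v|) < d ->
  exists2 y, `|y - x| < d &
    f (x + s *: u + s *: v) - f (x + s *: u) - (f (x + s *: v) - f x)
    = s * (s * 'D_v ('D_u f) y).
Proof.
move=> Ud Cf sd.
have near_x (c c' : R) : `|c| <= `|s| -> `|c'| <= `|s| ->
    `|x + c *: u + c' *: v - x| < d.
  move=> cs c's; apply: le_lt_trans sd.
  rewrite -(addrA x) [x + _]addrC addrK (le_trans (ler_normD _ _))//.
  by rewrite !normrZ mulrDr lerD// ler_wpM2r.
pose g y := f (y + s *: v) - f y.
have dg (c : R) : `|c| <= `|s| ->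
    is_derive (x + c *: u) u g ('D_u f (x + c *: u + s *: v) - 'D_u f (x + c *: u)).
  move=> cs; apply: is_deriveB.
    apply: is_derive_translate.
    exact: (Ck_on_derivable u Cf (Ud _ (near_x _ _ cs (lexx _)))).
  have x0 : `|x + c *: u - x| < d.
    by have := near_x _ 0 cs; rewrite normr0 scale0r addr0; apply.
  by apply: derivableP; exact: (Ck_on_derivable u Cf (Ud _ x0)).
have dg' (c : R) : `|c| <= `|s| -> derivable g (x + c *: u) u.
  by move=> cs; case: (dg c cs).
have [c cs E1] := line_MVT dg'.
have [c' c's E2] := @line_MVT _ _ (fun y => 'D_u f y) (x + c *: u) v s
  (fun c' hc' => Ck_on_derivable v (Ck_on_D u Cf) (Ud _ (near_x _ _ cs hc'))).
exists (x + c *: u + c' *: v); first exact: near_x.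
rewrite -E2 -(@derive_val _ _ _ _ _ _ _ (dg c cs)) -E1 /g.
by [].
Qed.

(** The second difference of f is symmetric in u and v, so each mixed derivative
    takes the same value at some point as near to x as desired, and both are
    continuous at x. *)
Lemma derive_swap U f (x u v : V) : open U -> Ck_on U 2 f -> U x ->
  'D_u ('D_v f) x = 'D_v ('D_u f) x.
Proof.
move=> oU Cf Ux; apply/eqP; rewrite -subr_eq0 -normr_eq0; apply/eqP.
apply/le_anti; rewrite normr_ge0 andbT; apply/ler_addgt0Pl => e e0; rewrite addr0.
have aux (a b a' b' : R) :
    `|a' - a| < e / 2 -> `|b' - b| < e / 2 -> b' = a' -> `|a - b| <= e.
  move=> A1 + E; rewrite E => A2.
  rewrite -(subrKA a') (splitr e) (le_trans (ler_normD _ _))// lerD// ltW//.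
  by rewrite distrC.
have [d0 d00 Ud] := open_normP oU Ux.
have e20 : 0 < e / 2 by rewrite divr_gt0.
have [d1 d10 H1] := continuous_normP (Ck_on_continuous (Ck_on_D u (Ck_on_D v Cf)) Ux) e20.
have [d2 d20 H2] := continuous_normP (Ck_on_continuous (Ck_on_D v (Ck_on_D u Cf)) Ux) e20.
pose d := Num.min d0 (Num.min d1 d2).
have dpos : 0 < d by rewrite !lt_min d00 d10.
pose s := d / 2 / (`|u| + `|v| + 1).
have s0 : 0 < s by rewrite !divr_gt0// ltr_wpDl// addr_ge0.
have sd : `|s| * (`|u| + `|v|) < d.
  rewrite ger0_norm ?ltW// /s mulrAC ltr_pdivrMr ?ltr_wpDl ?addr_ge0//.
  rewrite ltr_pM//; lra.
have Ud' y : `|y - x| < d -> U y.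
  by move=> yd; apply: Ud; apply: lt_le_trans yd _; rewrite ge_min lexx.
have [y yd E1] := second_difference Ud' Cf sd.
have sd' : `|s| * (`|v| + `|u|) < d by rewrite addrC.
have [z zd E2] := second_difference Ud' Cf sd'.
have E : 'D_v ('D_u f) y = 'D_u ('D_v f) z.
  have s00 : s != 0 by rewrite gt_eqF.
  move: E1 E2; rewrite [x + s *: v + _]addrAC.
  set a := 'D_v _ y; set b := 'D_u _ z.
  set p := f _; set q := f _; set r := f _; set t := f _.
  move: a b p q r t => a b p q r t E1 E2.
  have : s * (s * a) = s * (s * b).
    by rewrite -E1 -E2; ring.
  by move=> /(mulfI s00) /(mulfI s00).
have := H1 z (lt_le_trans zd _); rewrite !ge_min lexx !orbT => /(_ isT) A1.
have := H2 y (lt_le_trans yd _); rewrite !ge_min lexx !orbT => /(_ isT) A2.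
exact: (aux _ _ _ _ A1 A2 E).
Qed.

End Schwarz.
Arguments Ck_on_derivable {R V W U m f x} v _ _.

Section Directional.
Context {R : realType} {V : normedModType R} (B : coords V).
Implicit Types (U : set V) (f : V -> R).

Lemma Ck_differentiable U m f x :
  open U -> Ck_on U m.+1 f -> U x -> differentiable f x.
Proof.
move=> oU Cf Ux; apply: (C1_differentiable (B := B)) => i.
  near=> y; have Uy : U y by near: y; exact: open_nbhs_nbhs.
  exact: (Ck_on_derivable _ Cf Uy).
exact: (Ck_on_continuous (Ck_on_D _ Cf) Ux).
Unshelve. all: by end_near. Qed.

Lemma deriveD_dir f x u v : differentiable f x ->
  'D_(u + v) f x = 'D_u f x + 'D_v f x.
Proof. by move=> df; rewrite !deriveE// linearD. Qed.

Lemma deriveZ_dir f x (a : R) u : differentiable f x ->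
  'D_(a *: u) f x = a * 'D_u f x.
Proof. by move=> df; rewrite !deriveE// linearZ. Qed.

Lemma deriveN_dir f x u : differentiable f x -> 'D_(- u) f x = - 'D_u f x.
Proof. by move=> df; rewrite !deriveE// linearN. Qed.

Lemma derive_sum_dir f x (I : Type) (r : seq I) (P : pred I) (F : I -> V) :
  differentiable f x ->
  'D_(\sum_(i <- r | P i) F i) f x = \sum_(i <- r | P i) 'D_(F i) f x.
Proof.
by move=> df; rewrite deriveE// linear_sum; apply: eq_bigr => i _; rewrite deriveE.
Qed.

Lemma derive_coordsE f x v : differentiable f x ->
  'D_v f x = \sum_(i < coord_num B) coord_fun B i v * 'D_(coord_vec B i) f x.
Proof.
move=> df; rewrite {1}(coord_funK B v) derive_sum_dir//.
by apply: eq_bigr => i _; rewrite deriveZ_dir.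
Qed.

Lemma is_derive_coord {T : normedModType R} (w : T -> V) z v dw i :
  is_derive z v w dw ->
  is_derive z v (fun t => coord_fun B i (w t)) (coord_fun B i dw).
Proof.
move=> dwz.
pose L : {linear V -> R^o} := HB.pack (coord_fun B i : V -> R^o)
  (GRing.isLinear.Build R V R^o _ (coord_fun B i : V -> R^o) (coord_fun_linear B i)).
have cL : continuous L.
  apply/linear_bounded_continuous; apply/linear_boundedP.
  near=> r; have r1 : 1 <= r by near: r; exact: nbhs_pinfty_ge.
  by move=> y; rewrite (le_trans (coord_fun_le _ _ _))// ler_peMl.
have [_ E] := @is_derive_linear _ _ _ L (w z) dw cL.
rewrite -[X in is_derive _ _ _ X]/(L dw) -E.
exact: (is_derive_chain (f := L) dwz (linear_differentiable _ cL)).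
Unshelve. all: by end_near. Qed.

Lemma is_derive_continuous {W : normedModType R} (g : R -> W) (t : R) d :
  is_derive t 1 g d -> {for t, continuous g}.
Proof.
by move=> [dg _]; apply: differentiable_continuous; apply/derivable1_diffP.
Qed.

(** The product rule for a direction that moves with the point. Expanding the
    direction in coordinates turns the function into a sum of products of scalar
    functions. *)
Lemma is_derive_dir {T : normedModType R} U f (Psi w : T -> V) z v dPsi dw :
  open U -> Ck_on U 2 f -> U (Psi z) ->
  is_derive z v Psi dPsi -> is_derive z v w dw ->
  is_derive z v (fun t => 'D_(w t) f (Psi t))
    ('D_dPsi ('D_(w z) f) (Psi z) + 'D_dw f (Psi z)).
Proof.
move=> oU Cf Uz /is_derive_lineP dP /is_derive_lineP dW.
apply/is_derive_lineP.
set P := fun h : R => _ in dP; set W := fun h : R => _ in dW.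
have P0 : P 0 = Psi z by rewrite /P scale0r addr0.
have W0 : W 0 = w z by rewrite /W scale0r addr0.
rewrite -P0 -W0 -[X in is_derive _ _ X]/(fun h => 'D_(W h) f (P h)).
have UP : \forall h \near 0, U (P h).
  apply: (is_derive_continuous dP); apply: open_nbhs_nbhs; split => //.
  by rewrite P0.
have UP0 : U (P 0) by rewrite P0.
pose N := coord_num B; pose e i := coord_vec B i; pose c i := coord_fun B i.
have D1 y u : U y -> 'D_u f y = \sum_(i < N) c i u * 'D_(e i) f y.
  by move=> Uy; apply: derive_coordsE; exact: (Ck_differentiable oU Cf Uy).
have E1 u : 'D_u ('D_(W 0) f) (P 0) = \sum_(i < N) c i (W 0) * 'D_u ('D_(e i) f) (P 0).
  have dEi i : derivable ('D_(e i) f) (P 0) u.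
    exact: (Ck_on_derivable _ (Ck_on_D _ Cf)).
  have : is_derive (P 0) u (fun y => \sum_(i < N) c i (W 0) * 'D_(e i) f y)
    (\sum_(i < N) c i (W 0) * 'D_u ('D_(e i) f) (P 0)).
    by apply: is_derive_bigsum => i _; apply: is_deriveZ; exact: derivableP.
  move=> [_ <-]; apply: near_eq_derive; near=> y; apply: D1.
  by near: y; exact: open_nbhs_nbhs.
have : is_derive (0 : R) 1 (fun h => \sum_(i < N) c i (W h) * 'D_(e i) f (P h))
  (\sum_(i < N) (c i (W 0) *: 'D_dPsi ('D_(e i) f) (P 0) + 'D_(e i) f (P 0) *: c i dw)).
  apply: is_derive_bigsum => i _; apply: is_deriveM; first exact: is_derive_coord.
  apply: is_derive_chain; apply: (Ck_differentiable oU (Ck_on_D _ Cf)).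
  by rewrite P0.
rewrite big_split/= -E1.
rewrite (_ : \sum_(i < N) _ = 'D_dw f (P 0)); last first.
  by rewrite D1//; apply: eq_bigr => i _; rewrite mulrC.
apply: near_eq_is_derive; near=> h; rewrite D1//.
by near: h.
Unshelve. all: by end_near. Qed.

End Directional.

Section Closure.
Context {R : realType} {V : normedModType R}.
Variable U : set V.
Hypothesis oU : open U.
Implicit Types f g : V -> R.

Lemma Ck_on_cst {W : normedModType R} m (a : W) : Ck_on U m (fun _ : V => a).
Proof.
elim: m a => [|m IH] a; split=> //; try by move=> x _; exact: cst_continuous.
move=> v; split=> [x _|]; first exact: derivable_cst.
by apply: (Ck_on_eq (f := fun _ => 0) oU _ (IH 0)) => x _; rewrite (derive_cst a).
Qed.

Lemma Ck_onD m f g : Ck_on U m f -> Ck_on U m g -> Ck_on U m (fun x => f x + g x).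
Proof.
elim: m f g => [|m IH] f g [cf Hf] [cg Hg].
  by split=> // x Ux; apply: continuousD; [exact: cf|exact: cg].
split=> [x Ux|v]; first by apply: continuousD; [exact: cf|exact: cg].
split=> [x Ux|].
  by apply: derivableD; [exact: (Hf v).1|exact: (Hg v).1].
apply: Ck_on_eq (IH _ _ (Hf v).2 (Hg v).2) => // x Ux.
by rewrite -deriveD//; [exact: (Hf v).1|exact: (Hg v).1].
Qed.

Lemma Ck_onM m f g : Ck_on U m f -> Ck_on U m g -> Ck_on U m (fun x => f x * g x).
Proof.
elim: m f g => [|m IH] f g Cf Cg; have := Cf; have := Cg.
  move=> [cg _] [cf _].
  by split=> // x Ux; apply: continuousM; [exact: cf|exact: cg].
move=> [cg Hg] [cf Hf].
split=> [x Ux|v]; first by apply: continuousM; [exact: cf|exact: cg].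
split=> [x Ux|].
  by apply: derivableM; [exact: (Hf v).1|exact: (Hg v).1].
apply: Ck_on_eq (Ck_onD (IH _ _ (Ck_onS Cf) (Hg v).2) (IH _ _ (Ck_onS Cg) (Hf v).2)) => // x Ux.
by rewrite deriveM//; [exact: (Hf v).1|exact: (Hg v).1].
Qed.

Lemma Ck_onN m f : Ck_on U m f -> Ck_on U m (fun x => - f x).
Proof.
move=> Cf; apply: Ck_on_eq (Ck_onM (@Ck_on_cst R m (-1)) Cf) => // x _.
by rewrite mulN1r.
Qed.

Lemma Ck_on_sum m (I : Type) (r : seq I) (P : pred I) (F : I -> V -> R) :
  (forall i, P i -> Ck_on U m (F i)) ->
  Ck_on U m (fun x => \sum_(i <- r | P i) F i x).
Proof.
move=> H; elim: r => [|i r IH].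
  apply: (Ck_on_eq oU _ (@Ck_on_cst R m 0)) => x _.
  by rewrite big_nil.
have E x : \sum_(j <- i :: r | P j) F j x =
    if P i then F i x + \sum_(j <- r | P j) F j x else \sum_(j <- r | P j) F j x.
  by rewrite big_cons.
have [Pi|Pi] := boolP (P i).
  apply: (Ck_on_eq oU _ (Ck_onD (H i Pi) IH)) => x _.
  by rewrite E Pi.
apply: (Ck_on_eq oU _ IH) => x _.
by rewrite E (negPf Pi).
Qed.

Lemma Ck_on_prod m (I : Type) (r : seq I) (P : pred I) (F : I -> V -> R) :
  (forall i, P i -> Ck_on U m (F i)) ->
  Ck_on U m (fun x => \prod_(i <- r | P i) F i x).
Proof.
move=> H; elim: r => [|i r IH].
  apply: (Ck_on_eq oU _ (@Ck_on_cst R m 1)) => x _.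
  by rewrite big_nil.
have E x : \prod_(j <- i :: r | P j) F j x =
    if P i then F i x * \prod_(j <- r | P j) F j x else \prod_(j <- r | P j) F j x.
  by rewrite big_cons.
have [Pi|Pi] := boolP (P i).
  apply: (Ck_on_eq oU _ (Ck_onM (H i Pi) IH)) => x _.
  by rewrite E Pi.
apply: (Ck_on_eq oU _ IH) => x _.
by rewrite E (negPf Pi).
Qed.

(** The induction closes because the derivative of 1 / f is made of two factors
    1 / f, known to be of the previous class, and a derivative of f. *)
Lemma Ck_onV m f : (forall x, U x -> f x != 0) ->
  Ck_on U m f -> Ck_on U m (fun x => (f x)^-1).
Proof.
move=> f0; elim: m => [|m IH] Cf; have := Cf.
  by move=> [cf _]; split=> // x Ux; apply: continuousV; [exact: f0|exact: cf].
move=> [cf Hf]; split=> [x Ux|v].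
  by apply: continuousV; [exact: f0|exact: cf].
split=> [x Ux|]; first by apply: derivableV; [exact: f0|exact: (Hf v).1].
have C := IH (Ck_onS Cf).
apply: Ck_on_eq (Ck_onN (Ck_onM (Ck_onM C C) (Hf v).2)) => // x Ux.
rewrite deriveV; [|exact: f0|exact: (Hf v).1].
by rewrite -exprVn expr2 scaleNr.
Qed.

Lemma Ck_on_linear {W : normedModType R} m (L : {linear V -> W}) :
  continuous L -> Ck_on U m L.
Proof.
move=> cL; case: m => [|m]; first by split=> // x _; exact: cL.
split=> [x _|v]; first exact: cL.
split=> [x _|]; first by case: (is_derive_linear x v cL).
apply: Ck_on_eq (Ck_on_cst m (L v)) => // x _.
by case: (is_derive_linear x v cL).
Qed.

Lemma Ck_on_det m k (A : V -> 'M[R]_k) :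
  (forall i j, Ck_on U m (fun x => A x i j)) -> Ck_on U m (fun x => \det (A x)).
Proof.
move=> H; apply: Ck_on_sum => s _; apply: Ck_onM; first exact: Ck_on_cst.
exact: Ck_on_prod.
Qed.

Lemma Ck_on_invmx m k (A : V -> 'M[R]_k) i j :
  (forall x, U x -> A x \in unitmx) ->
  (forall i j, Ck_on U m (fun x => A x i j)) ->
  Ck_on U m (fun x => invmx (A x) i j).
Proof.
move=> Au H.
have C : Ck_on U m (fun x => (\det (A x))^-1 * cofactor (A x) j i).
  apply: Ck_onM.
    apply: Ck_onV; last exact: Ck_on_det.
    by move=> x /Au; rewrite unitmxE unitfE.
  apply: Ck_onM; first exact: Ck_on_cst.
  apply: Ck_on_det => i' j'.
  by apply: Ck_on_eq (H (lift j i') (lift i j')) => // x _; rewrite !mxE.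
by apply: Ck_on_eq C => // x /Au Ax; rewrite /invmx Ax !mxE.
Qed.

Lemma Ck_on_coord {n} m (f : V -> 'rV[R]_n) i :
  Ck_on U m f -> Ck_on U m (fun x => f x 0 i).
Proof.
elim: m f => [|m IH] f [cf H].
  split=> // x Ux; apply: (@continuous_comp _ _ _ f (fun M : 'rV[R]_n => M 0 i) x (cf x Ux)).
  exact: coord_continuous.
split=> [x Ux|v].
  by apply: (@continuous_comp _ _ _ f (fun M : 'rV[R]_n => M 0 i) x (cf x Ux)); exact: coord_continuous.
have [dv Cv] := H v; split=> [x Ux|].
  exact: (derivable_mxP f x v).1 (dv x Ux) 0 i.
apply: Ck_on_eq (IH _ Cv) => // x Ux.
by rewrite derive_mx ?mxE//; exact: dv.
Qed.

End Closure.

(** * The spray and the curvature in one chart *)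

Section Phase.
Context {R : realType} {n : nat}.
Local Notation rV := 'rV[R]_n.
Local Notation Z := ('rV[R]_n * 'rV[R]_n)%type.
Implicit Types (f : Z -> R) (z : Z) (u v w : rV) (U : set Z).

Definition phase_coords : coords Z := pair_coords row_coords row_coords.

Lemma Ck_diff U m f z : open U -> Ck_on U m.+1 f -> U z -> differentiable f z.
Proof. exact: (Ck_differentiable phase_coords). Qed.

Lemma pair_addE (a b : Z) : a + b = (a.1 + b.1, a.2 + b.2).
Proof. by []. Qed.

Lemma pair_scaleE (a : R) (b : Z) : a *: b = (a *: b.1, a *: b.2).
Proof. by []. Qed.

Lemma pair_oppE (b : Z) : - b = (- b.1, - b.2).
Proof. by []. Qed.

Lemma pair_splitE u w : (u, w) = (u, 0) + (0, w) :> Z.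
Proof. by rewrite pair_addE /= addr0 add0r. Qed.

Lemma hor_sumE u : (u, 0) = \sum_(k < n) u 0 k *: ((delta_mx 0 k, 0) : Z).
Proof.
rewrite {1}[u]row_sum_delta.
elim/big_rec2: _ => // i y1 y2 _ <-.
by rewrite pair_scaleE pair_addE /= scaler0 addr0.
Qed.

Lemma ver_sumE u : (0, u) = \sum_(k < n) u 0 k *: ((0, delta_mx 0 k) : Z).
Proof.
rewrite {1}[u]row_sum_delta.
elim/big_rec2: _ => // i y1 y2 _ <-.
by rewrite pair_scaleE pair_addE /= scaler0 addr0.
Qed.

Lemma derive_hor f z u : differentiable f z ->
  'D_(u, 0) f z = \sum_(k < n) u 0 k * dx k f z.
Proof.
move=> df; rewrite hor_sumE derive_sum_dir//; apply: eq_bigr => k _.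
by rewrite deriveZ_dir.
Qed.

Lemma derive_ver f z u : differentiable f z ->
  'D_(0, u) f z = \sum_(k < n) u 0 k * dy k f z.
Proof.
move=> df; rewrite ver_sumE derive_sum_dir//; apply: eq_bigr => k _.
by rewrite deriveZ_dir.
Qed.

Lemma derive_split f z u w : differentiable f z ->
  'D_(u, w) f z = 'D_(u, 0) f z + 'D_(0, w) f z.
Proof. by move=> df; rewrite pair_splitE deriveD_dir. Qed.

Lemma derive_hor2 U f z (v : Z) u : open U -> Ck_on U 2 f -> U z ->
  'D_v ('D_(u, 0) f) z = \sum_(k < n) u 0 k * 'D_v (dx k f) z.
Proof.
move=> oU Cf Uz.
have : is_derive z v (fun y => \sum_(k < n) u 0 k * dx k f y)
  (\sum_(k < n) u 0 k * 'D_v (dx k f) z).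
  apply: is_derive_bigsum => k _; apply: is_deriveZ; apply: derivableP.
  exact: (Ck_on_derivable v (Ck_on_D _ Cf) Uz).
move=> [_ <-]; apply: near_eq_derive; near=> y; apply: derive_hor.
have Uy : U y by near: y; exact: open_nbhs_nbhs.
exact: Ck_diff oU Cf Uy.
Unshelve. all: by end_near. Qed.

Lemma derive_ver2 U f z (v : Z) u : open U -> Ck_on U 2 f -> U z ->
  'D_v ('D_(0, u) f) z = \sum_(k < n) u 0 k * 'D_v (dy k f) z.
Proof.
move=> oU Cf Uz.
have : is_derive z v (fun y => \sum_(k < n) u 0 k * dy k f y)
  (\sum_(k < n) u 0 k * 'D_v (dy k f) z).
  apply: is_derive_bigsum => k _; apply: is_deriveZ; apply: derivableP.
  exact: (Ck_on_derivable v (Ck_on_D _ Cf) Uz).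
move=> [_ <-]; apply: near_eq_derive; near=> y; apply: derive_ver.
have Uy : U y by near: y; exact: open_nbhs_nbhs.
exact: Ck_diff oU Cf Uy.
Unshelve. all: by end_near. Qed.

Lemma derive_verver U f z v w : open U -> Ck_on U 2 f -> U z ->
  'D_(0, v) ('D_(0, w) f) z = \sum_(i < n) \sum_(k < n) dy k (dy i f) z * w 0 i * v 0 k.
Proof.
move=> oU Cf Uz; rewrite (derive_ver2 _ _ oU Cf Uz); apply: eq_bigr => i _.
rewrite derive_ver; last exact: Ck_diff oU (Ck_on_D _ Cf) Uz.
by rewrite mulr_sumr; apply: eq_bigr => k _; ring.
Qed.

Lemma quad_form_hessian U f z v (a : R) : open U -> Ck_on U 2 f -> U z ->
  quad_form (\matrix_(i, k) (a * dy k (dy i f) z)) v = a * 'D_(0, v) ('D_(0, v) f) z.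
Proof.
move=> oU Cf Uz; rewrite (derive_verver _ _ oU Cf Uz) /quad_form mulr_sumr.
apply: eq_bigr => i _; rewrite mulr_sumr; apply: eq_bigr => k _.
by rewrite mxE; ring.
Qed.

Definition slit (O : set rV) : set Z := [set z | O z.1 /\ z.2 != 0].

Lemma slit_open O : open O -> open (slit O).
Proof.
move=> oO; apply: openI.
  apply: (@open_comp _ _ (fst : Z -> rV)) => // z _; exact: cvg_fst.
rewrite [X in open X](_ : _ = (snd : Z -> rV) @^-1` (~` [set 0])); last first.
  by apply/seteqP; split => z /=; move/eqP.
apply: (@open_comp _ _ (snd : Z -> rV)) => [z _|]; first exact: cvg_snd.
apply: closed_openC; apply: accessible_closed_set1.
exact: hausdorff_accessible (@norm_hausdorff _ _).
Qed.

Definition homog (O : set rV) (k : nat) f :=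
  forall x y (a : R), slit O (x, y) -> 0 < a -> f (x, a *: y) = a ^+ k * f (x, y).

Lemma slit_scale O x y (a : R) : slit O (x, y) -> 0 < a -> slit O (x, a *: y).
Proof.
by move=> [/= Ox y0] a0; split => //=; rewrite scaler_eq0 negb_or gt_eqF.
Qed.

(** On the ray h |-> (x, (1 + h) y) the function is (1 + h)^k f (x, y). *)
Lemma euler O k f x y : slit O (x, y) -> homog O k f ->
  'D_(0, y) f (x, y) = k%:R * f (x, y).
Proof.
move=> Oxy Hf.
suff [_ E] : is_derive ((x, y) : Z) (0, y) f (k%:R * f (x, y)) by [].
apply/is_derive_lineP.
have H : is_derive (0 : R) 1 (fun h => f (x, y) * (1 + h) ^+ k) (k%:R * f (x, y)).
  have H0 : is_derive (0 : R) 1 (fun h => 1 + h) (0 + 1 : R) by exact: is_deriveD.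
  have := is_deriveZ (f (x, y)) (is_deriveX k H0).
  rewrite [X in is_derive _ _ X _](_ : _ = (fun h : R => f (x, y) * (1 + h) ^+ k)).
    move=> H1.
  apply: (is_derive_eq H1); rewrite /= add0r addr0 expr1n mulr1.
    by rewrite -[_ *: _]/(f (x, y) * (k%:R * 1)) mulr1 mulrC.
  by apply/funext => h; rewrite -[LHS]/(f (x, y) * _) exprfctE.
apply: near_eq_is_derive H; near=> h.
rewrite pair_scaleE pair_addE /= scaler0 addr0 mulrC -Hf//; last first.
  rewrite -ltrBlDl sub0r; near: h; apply/nbhs_ballP; exists 1 => //= h.
  by rewrite -ball_normE /= sub0r normrN ltr_norml => /andP[].
by rewrite scalerDl scale1r.
Unshelve. all: by end_near. Qed.

(** Both sides are the derivative at z of f composed with the linear map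
    (x, y) |-> (x, a y). *)
Lemma homog_derive O k f z (v : Z) (a : R) : open O ->
  (forall z, slit O z -> differentiable f z) ->
  homog O k f -> slit O z -> 0 < a ->
  'D_(v.1, a *: v.2) f (z.1, a *: z.2) = a ^+ k * 'D_v f z.
Proof.
move=> oO df Hf Oz a0.
have dfz := derivableP (@diff_derivable _ _ _ f z v (df _ Oz)).
have dS : is_derive z v (fun z : Z => (z.1, a *: z.2)) (v.1, a *: v.2).
  apply: is_derive_pair; first exact: is_derive_fst.
  by apply: is_deriveZ; exact: is_derive_snd.
have dfS : differentiable f (z.1, a *: z.2).
  by apply: df; apply: slit_scale => //; case: z Oz {dfz dS}.
have [_ <-] := is_derive_chain dS dfS.
have [_ E] := is_deriveZ (a ^+ k) dfz.
rewrite -[RHS]/(a ^+ k *: 'D_v f z) -E.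
apply: near_eq_derive; near=> y.
have Oy : slit O y by near: y; apply: open_nbhs_nbhs; split => //; exact: slit_open.
have Oy' : slit O (y.1, y.2) by exact: Oy.
by rewrite (Hf y.1 y.2 a Oy' a0) -surjective_pairing.
Unshelve. all: by end_near. Qed.

Lemma homog_hor O k f u : open O ->
  (forall z, slit O z -> differentiable f z) ->
  homog O k f -> homog O k ('D_(u, 0) f).
Proof.
move=> oO df Hf x y a Oxy a0.
by have := homog_derive (u, 0) oO df Hf Oxy a0; rewrite /= scaler0.
Qed.

Lemma homog_ver O k f u : open O ->
  (forall z, slit O z -> differentiable f z) ->
  homog O k.+1 f -> homog O k ('D_(0, u) f).
Proof.
move=> oO df Hf x y a Oxy a0.
have a00 : a != 0 by rewrite gt_eqF.
have E : a * 'D_(0, u) f (x, a *: y) = a ^+ k.+1 * 'D_(0, u) f (x, y).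
  rewrite -(homog_derive (0, u) oO df Hf Oxy a0) /=.
  rewrite -deriveZ_dir; last by apply: df; exact: slit_scale.
  by rewrite pair_scaleE /= scaler0.
by apply: (mulfI a00); rewrite E exprS mulrA.
Qed.

End Phase.

(** What the spray and the curvature see of a Finsler structure in one chart,
    of image O. *)
Record local_finsler (R : realType) (n : nat) (O : set 'rV[R]_n)
    (L : 'rV[R]_n * 'rV[R]_n -> R) : Prop := LocalFinsler {
  lf_open : open O;
  lf_smooth : smooth_on (slit O) L;
  lf_homog : homog O 1 L;
  lf_posdef : forall z, slit O z ->
    forall v, v != 0 -> 0 < quad_form (fundamental L z) v
}.

Definition spray_vec (R : realType) (n : nat) (L : 'rV[R]_n * 'rV[R]_n -> R) z :
  'rV[R]_n := \row_i spray L i z.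

Section LocalFinsler.
Context {R : realType} {n : nat}.
Local Notation rV := 'rV[R]_n.
Local Notation Z := ('rV[R]_n * 'rV[R]_n)%type.
Variables (O : set rV) (L : Z -> R).
Hypothesis HL : local_finsler O L.
Implicit Types (z : Z) (u v w q : rV).

Local Notation E := (energy L).
Local Notation G := (spray_vec L).

Let oO := lf_open HL.

Let oU : open (slit O). Proof. exact: slit_open. Qed.

Lemma energy_Ck m : Ck_on (slit O) m E.
Proof.
by apply: Ck_on_eq (Ck_onM oU (lf_smooth HL m) (lf_smooth HL m)).
Qed.

Lemma energy_diff z : slit O z -> differentiable E z.
Proof. exact: Ck_diff oU (energy_Ck 1). Qed.

Lemma energy_homog : homog O 2 E.
Proof. by move=> x y a Oz a0; rewrite /energy (lf_homog HL)// exprMn expr1. Qed.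

Lemma denergy_diff z (v : Z) : slit O z -> differentiable ('D_v E) z.
Proof. by move=> Oz; apply: (Ck_diff oU (Ck_on_D v (energy_Ck 2))). Qed.

Lemma denergy_ver_homog u : homog O 1 ('D_(0, u) E).
Proof. exact: homog_ver oO energy_diff energy_homog. Qed.

Lemma denergy_hor_homog u : homog O 2 ('D_(u, 0) E).
Proof. exact: homog_hor oO energy_diff energy_homog. Qed.

Lemma fundamentalE z : slit O z ->
  fundamental L z = \matrix_(i, j) (2^-1 * dy j (dy i E) z).
Proof.
move=> Oz; apply/matrixP => i j; rewrite !mxE.
pose ei : Z := (0, delta_mx 0 i); pose ej : Z := (0, delta_mx 0 j).
have d1 y : slit O y -> is_derive y ei (fun p => 2^-1 * E p) (2^-1 * 'D_ei E y).
  move=> Oy; apply: is_deriveZ; apply: derivableP.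
  exact: (Ck_on_derivable _ (energy_Ck 1) Oy).
have : is_derive z ej (fun p => 2^-1 * dy i E p) (2^-1 * dy j (dy i E) z).
  apply: is_deriveZ; apply: derivableP.
  exact: (Ck_on_derivable _ (Ck_on_D _ (energy_Ck 2)) Oz).
move=> [_ <-]; apply: near_eq_derive; near=> y.
have Oy : slit O y by near: y; exact: open_nbhs_nbhs.
by case: (d1 y Oy).
Unshelve. all: by end_near. Qed.

Lemma fundamental_quad z v : slit O z ->
  quad_form (fundamental L z) v = 2^-1 * 'D_(0, v) ('D_(0, v) E) z.
Proof.
by move=> Oz; rewrite fundamentalE// (quad_form_hessian _ _ oU (energy_Ck 2) Oz).
Qed.

(** Euler's identity is applied to E, of degree 2, and to its derivatives along
    the fibre, of degree 1. *)
Lemma energyE z : slit O z -> 2^-1 * 'D_(0, z.2) ('D_(0, z.2) E) z = E z.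
Proof.
case: z => x y Oz /=.
rewrite (euler Oz (denergy_ver_homog y)) (euler Oz energy_homog).
by rewrite mul1r mulKf.
Qed.

(** By [energyE], the energy at (x, y) is the value at y of the positive
    definite form given by the fundamental tensor. *)
Lemma energy_gt0 z : slit O z -> 0 < E z.
Proof.
move=> Oz; rewrite -(energyE Oz) -fundamental_quad//.
by apply: (lf_posdef HL) => //; case: Oz.
Qed.

Lemma finsler_neq0 z : slit O z -> L z != 0.
Proof.
by move=> /energy_gt0; rewrite /energy => /gt_eqF; rewrite sqrf_eq0 => ->.
Qed.

Lemma fundamental_unit z : slit O z -> fundamental L z \in unitmx.
Proof.
move=> Oz; rewrite -row_free_unit; apply: inj_row_free => v vA0.
apply/eqP/negPn/negP => v0; have := lf_posdef HL Oz v0.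
rewrite /quad_form exchange_big /= big1 ?ltxx// => j _.
rewrite -mulr_suml (_ : \sum_i _ = (v *m fundamental L z) 0 j).
  by rewrite vA0 mxE mul0r.
by rewrite mxE; apply: eq_bigr => i _; rewrite mulrC.
Qed.

Lemma spray_coordE z l : slit O z ->
  \sum_i dy i (dy l E) z * G z 0 i =
  \sum_k dy l (dx k E) z * z.2 0 k - dx l E z.
Proof.
move=> Oz.
pose r : 'cV[R]_n := \col_l (\sum_k dy l (dx k E) z * z.2 0 k - dx l E z).
have GE : (G z)^T = 2^-1 *: (invmx (fundamental L z) *m r).
  apply/colP => i; rewrite !mxE; congr (_ * _); apply: eq_bigr => m _.
  by rewrite mxE.
have H : (2 *: fundamental L z) *m (G z)^T = r.
  rewrite GE -scalemxAl -scalemxAr scalerA mulfV// scale1r.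
  by rewrite mulKVmx// fundamental_unit.
have := congr1 (fun M : 'cV[R]_n => M l 0) H; rewrite !mxE => <-.
apply: eq_bigr => i _; rewrite [X in _ = X * _]mxE fundamentalE// [X in _ = (_ * X) * _]mxE.
by rewrite [X in _ = _ * X]mxE mulrA mulfV// mul1r.
Qed.

(** The Euler-Lagrange equations of the energy tested on a vector u. Free of
    coordinates and of the inverse of the fundamental tensor, they can be
    carried through a change of chart. *)
Lemma spray_EL z u : slit O z ->
  'D_(0, G z) ('D_(0, u) E) z =
  'D_(0, u) ('D_(z.2, 0) E) z - 'D_(u, 0) E z.
Proof.
move=> Oz.
apply: (etrans (derive_ver2 (0, G z) u oU (energy_Ck 2) Oz)); apply/esym.
apply: (etrans (congr2 (fun a b : R => a - b)
  (derive_ver u (denergy_diff (z.2, 0) Oz)) (derive_hor u (energy_diff Oz)))).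
apply/esym; rewrite -sumrB; apply: eq_bigr => l _; rewrite -mulrBr; congr (_ * _).
apply: (etrans (derive_ver (G z) (denergy_diff (0, delta_mx 0 l) Oz))).
under eq_bigr do rewrite mulrC.
apply: (etrans (spray_coordE l Oz)); congr (_ - dx l E z); apply/esym.
apply: (etrans (derive_hor2 (0, delta_mx 0 l) z.2 oU (energy_Ck 2) Oz)).
by apply: eq_bigr => k _; rewrite mulrC.
Qed.

(** The form of the fundamental tensor vanishes at the difference of two
    solutions. *)
Lemma spray_unique z q : slit O z ->
  (forall u, 'D_(0, q) ('D_(0, u) E) z =
    'D_(0, u) ('D_(z.2, 0) E) z - 'D_(u, 0) E z) -> q = G z.
Proof.
move=> Oz H; apply/eqP; rewrite -subr_eq0; apply/negPn/negP => qG.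
have := lf_posdef HL Oz qG; rewrite fundamental_quad//.
have := denergy_diff (0, q - G z) Oz.
have := H (q - G z); have := spray_EL (q - G z) Oz.
move: ('D_(0, q - G z) E) (_ - _ in X in _ = X -> _ = X -> _) => f c H1 H2 df.
have -> : (0, q - G z) = (0, q) - (0, G z) :> Z.
  by rewrite [RHS]pair_addE /= subr0.
by rewrite deriveD_dir// deriveN_dir// H1 H2 subrr mulr0 ltxx.
Qed.

Lemma dx_Ck m f k : Ck_on (slit O) m.+1 f -> Ck_on (slit O) m (dx k f).
Proof. exact: Ck_on_D. Qed.

Lemma dy_Ck m f k : Ck_on (slit O) m.+1 f -> Ck_on (slit O) m (dy k f).
Proof. exact: Ck_on_D. Qed.

Lemma fibre_Ck m k : Ck_on (slit O) m (fun z => z.2 0 k).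
Proof.
apply: (Ck_on_coord oU); apply: (Ck_on_linear oU m (L := snd : {linear Z -> rV})).
by move=> z; exact: cvg_snd.
Qed.

Lemma spray_Ck m i : Ck_on (slit O) m (spray L i).
Proof.
apply: (Ck_onM oU); first exact: Ck_on_cst.
apply: (Ck_on_sum oU) => l _; apply: (Ck_onM oU).
  apply: (Ck_on_invmx oU); first by move=> z; exact: fundamental_unit.
  move=> i' j'; apply: (Ck_on_eq (f := fun z => 2^-1 * dy j' (dy i' E) z)) => //.
    by move=> z Oz; rewrite fundamentalE// mxE.
  apply: (Ck_onM oU); first exact: Ck_on_cst.
  by apply: dy_Ck; apply: dy_Ck; exact: energy_Ck.
apply: (Ck_onD oU); last first.
  by apply: (Ck_onN oU); apply: dx_Ck; exact: energy_Ck.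
apply: (Ck_on_sum oU) => k _; apply: (Ck_onM oU); last exact: fibre_Ck.
by apply: dy_Ck; apply: dx_Ck; exact: energy_Ck.
Qed.

Lemma spray_diff i z : slit O z -> differentiable (spray L i) z.
Proof. exact: Ck_diff oU (spray_Ck 1 i). Qed.

Lemma riemann_Ck m i k : Ck_on (slit O) m (riemann L i k).
Proof.
have C2 j l p : Ck_on (slit O) m (dy l (dx j (spray L p))).
  by apply: dy_Ck; apply: dx_Ck; exact: spray_Ck.
have C3 j l p : Ck_on (slit O) m (dy l (dy j (spray L p))).
  by apply: dy_Ck; apply: dy_Ck; exact: spray_Ck.
have C1 l p : Ck_on (slit O) m (dy l (spray L p)).
  by apply: dy_Ck; exact: spray_Ck.
apply: (Ck_onD oU); last apply: (Ck_onN oU).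
  apply: (Ck_onD oU); last first.
    apply: (Ck_onM oU); first exact: Ck_on_cst.
    by apply: (Ck_on_sum oU) => j _; apply: (Ck_onM oU); [exact: spray_Ck|exact: C3].
  apply: (Ck_onD oU); first by apply: dx_Ck; exact: spray_Ck.
  apply: (Ck_onN oU); apply: (Ck_onM oU); first exact: Ck_on_cst.
  apply: (Ck_on_sum oU) => j _; apply: (Ck_onM oU); [exact: fibre_Ck|exact: C2].
apply: (Ck_onM oU); first exact: Ck_on_cst.
by apply: (Ck_on_sum oU) => j _; apply: (Ck_onM oU); exact: C1.
Qed.

Definition riemann_trace z : R := \sum_i riemann L i i z.

Lemma riemann_trace_Ck m : Ck_on (slit O) m riemann_trace.
Proof. by apply: (Ck_on_sum oU) => i _; exact: riemann_Ck. Qed.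

(** As L does not vanish on the slit bundle, the factor L^2 in the definition
    cancels the denominator of the Ricci scalar. *)
Lemma ricci_tensorE z : slit O z ->
  ricci_tensor L z = \matrix_(i, k) (2^-1 * dy k (dy i riemann_trace) z).
Proof.
move=> Oz; apply/matrixP => i k.
rewrite [LHS]mxE.
rewrite [RHS]mxE.
apply: (congr1 (fun c : R => 2^-1 * c)).
apply: near_eq_derive; near=> y; apply: near_eq_derive.
have Oy : slit O y by near: y; exact: open_nbhs_nbhs.
near=> x; have Ox : slit O x by near: x; exact: open_nbhs_nbhs.
rewrite /ricci_scalar mulrC divfK// sqrf_eq0; exact: finsler_neq0.
Unshelve. all: by end_near. Qed.

Lemma ricci_quad z v : slit O z ->
  quad_form (ricci_tensor L z) v = 2^-1 * 'D_(0, v) ('D_(0, v) riemann_trace) z.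
Proof.
move=> Oz; rewrite ricci_tensorE//.
by rewrite (quad_form_hessian _ _ oU (riemann_trace_Ck 2) Oz).
Qed.

Lemma ricci_tensor_Ck m i k : Ck_on (slit O) m (fun z => ricci_tensor L z i k).
Proof.
apply: (Ck_on_eq (f := fun z => 2^-1 * dy k (dy i riemann_trace) z)) => //.
  by move=> z Oz; rewrite ricci_tensorE// mxE.
apply: (Ck_onM oU); first exact: Ck_on_cst.
by apply: dy_Ck; apply: dy_Ck; exact: riemann_trace_Ck.
Qed.

(** The right side solves the Euler-Lagrange equations at (x, a y), all of whose
    terms are homogeneous. *)
Lemma spray_homog x y (a : R) : slit O (x, y) -> 0 < a ->
  G (x, a *: y) = a ^+ 2 *: G (x, y).
Proof.
have alg (s t r : R) : s = t - r -> a * (a ^+ 1 * t) - a ^+ 2 * r = a ^+ 2 * s.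
  by move=> ->; ring.
move=> Oz a0; have Oaz := slit_scale Oz a0.
apply/esym/spray_unique => // u.
have d1 (v : Z) z : slit O z -> differentiable ('D_v E) z by exact: denergy_diff.
have H0 := homog_ver (G (x, y)) oO (d1 (0, u)) (denergy_ver_homog u).
have H1 := homog_ver u oO (d1 (y, 0)) (denergy_hor_homog y).
have HE := spray_EL u Oz; rewrite /= in HE.
have e1 : (0, a ^+ 2 *: G (x, y)) = a ^+ 2 *: (0, G (x, y)) :> Z.
  by rewrite pair_scaleE /= scaler0.
have e2 : (a *: y, 0) = a *: (y, 0) :> Z by rewrite pair_scaleE /= scaler0.
have A : 'D_(0, a ^+ 2 *: G (x, y)) ('D_(0, u) E) (x, a *: y) =
    a ^+ 2 * 'D_(0, G (x, y)) ('D_(0, u) E) (x, y).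
  rewrite e1; apply: (etrans (deriveZ_dir _ _ (d1 (0, u) _ Oaz))).
  by apply: (congr1 (fun c : R => a ^+ 2 * c)); apply: (etrans (H0 _ _ _ Oz a0)); rewrite mul1r.
have Bu : 'D_(0, u) ('D_(a *: y, 0) E) (x, a *: y) =
       a * (a ^+ 1 * 'D_(0, u) ('D_(y, 0) E) (x, y)).
  rewrite -(H1 _ _ _ Oz a0) e2.
  have : is_derive ((x, a *: y) : Z) (0, u) (fun p => a * 'D_(y, 0) E p)
      (a * 'D_(0, u) ('D_(y, 0) E) (x, a *: y)).
    by apply: is_deriveZ; apply: derivableP; apply: diff_derivable; exact: d1.
  move=> [_ <-]; apply: near_eq_derive; near=> p.
  have Op : slit O p by near: p; exact: open_nbhs_nbhs.
  by rewrite deriveZ_dir//; exact: energy_diff.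
apply: (etrans A); apply/esym.
apply: (etrans (congr2 (fun s t : R => s - t) Bu (denergy_hor_homog u Oz a0))).
exact: alg HE.
Unshelve. all: by end_near. Qed.

(** Geodesics have constant speed. Tested on u = y, the Euler-Lagrange equations
    reduce to this by Euler's identity. *)
Lemma energy_conserved z : slit O z -> 'D_(z.2, - G z) E z = 0.
Proof.
have alg (c1 c2 a b d : R) : c1 = d - b -> c1 = c2 -> c2 = 1%:R * a ->
  d = 2%:R * b -> b - a = 0 by lra.
case: z => x y Oz.
have H1 := derive_swap (0, G (x, y)) (0, y) oU (energy_Ck 2) Oz.
have H2 := euler Oz (denergy_ver_homog (G (x, y))).
have H3 := euler Oz (denergy_hor_homog y).
have dE := energy_diff Oz.
apply: (etrans (derive_split _ _ dE)).
have -> : (0, - G (x, y)) = - (0, G (x, y)) :> Z.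
  by rewrite [RHS]pair_oppE /= oppr0.
apply: (etrans (congr1 (fun c : R => 'D_(y, 0) E (x, y) + c) (deriveN_dir _ dE))).
exact: alg (spray_EL y Oz) H1 H2 H3.
Qed.

Lemma spray_vec_is_derive z (v : Z) : slit O z ->
  is_derive z v G (\row_i 'D_v (spray L i) z).
Proof.
move=> Oz; apply/is_derive_row => i.
rewrite (_ : (fun p => _) = spray L i); last by apply/funext => p; rewrite mxE.
by rewrite mxE; apply: derivableP; exact: (Ck_on_derivable v (spray_Ck 1 i) Oz).
Qed.

(** The two sums of second derivatives of the spray make up a single derivative
    of dG^i/dy^k along (y, - G), the vector field whose integral curves are the
    geodesics; a change of chart respects this vector field. *)
Lemma riemannE i k z : slit O z ->
  riemann L i k z = dx k (spray L i) z
    - 2^-1 * 'D_(z.2, - G z) (dy k (spray L i)) z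
    - 4^-1 * (\sum_j dy j (spray L i) z * dy k (spray L j) z).
Proof.
have alg (a b c d e : R) : e = c - d -> a - 2^-1 * c + 2^-1 * d - b = a - 2^-1 * e - b.
  by move=> ->; ring.
move=> Oz; apply: alg.
have dk := Ck_diff oU (dy_Ck k (spray_Ck 2 i)) Oz.
apply: (etrans (derive_split z.2 (- G z) dk)); congr (_ + _).
  apply: (etrans (derive_hor z.2 dk)); apply: eq_bigr => j _.
  apply: (congr1 (fun c : R => z.2 0 j * c)).
  exact: (derive_swap (delta_mx 0 j, 0) (0, delta_mx 0 k) oU (spray_Ck 2 i) Oz).
apply: (etrans (derive_ver (- G z) dk)); rewrite -sumrN; apply: eq_bigr => j _.
rewrite [(- G z) 0 j]mxE mulNr [G z 0 j]mxE.
apply: (congr1 (fun c : R => - (spray L j z * c))).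
exact: (derive_swap (0, delta_mx 0 j) (0, delta_mx 0 k) oU (spray_Ck 2 i) Oz).
Qed.

End LocalFinsler.

(** * Change of chart *)

Section SecondDirectional.
Context {R : realType} {V : normedModType R} (B : coords V).
Implicit Types (U : set V) (f : V -> R).

Lemma derive2_coordsE U f x u v : open U -> Ck_on U 2 f -> U x ->
  'D_v ('D_u f) x = \sum_(i < coord_num B) coord_fun B i u * 'D_v ('D_(coord_vec B i) f) x.
Proof.
move=> oU Cf Ux.
have : is_derive x v
    (fun y => \sum_(i < coord_num B) coord_fun B i u * 'D_(coord_vec B i) f y)
    (\sum_(i < coord_num B) coord_fun B i u * 'D_v ('D_(coord_vec B i) f) x).
  apply: is_derive_bigsum => k _; apply: is_deriveZ; apply: derivableP.
  exact: (Ck_on_derivable v (Ck_on_D _ Cf) Ux).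
move=> [_ <-]; apply: near_eq_derive; near=> y; apply: derive_coordsE.
have Uy : U y by near: y; exact: open_nbhs_nbhs.
exact: (Ck_differentiable B oU Cf Uy).
Unshelve. all: by end_near. Qed.

Lemma derive3_coordsE U f x u v w : open U -> Ck_on U 3 f -> U x ->
  'D_w ('D_v ('D_u f)) x =
  \sum_(i < coord_num B) coord_fun B i u * 'D_w ('D_v ('D_(coord_vec B i) f)) x.
Proof.
move=> oU Cf Ux.
have : is_derive x w
    (fun y => \sum_(i < coord_num B) coord_fun B i u * 'D_v ('D_(coord_vec B i) f) y)
    (\sum_(i < coord_num B) coord_fun B i u * 'D_w ('D_v ('D_(coord_vec B i) f)) x).
  apply: is_derive_bigsum => k _; apply: is_deriveZ; apply: derivableP.
  exact: (Ck_on_derivable w (Ck_on_D v (Ck_on_D _ Cf)) Ux).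
move=> [_ <-]; apply: near_eq_derive; near=> y.
have Uy : U y by near: y; exact: open_nbhs_nbhs.
exact: (derive2_coordsE _ _ oU (Ck_onS Cf) Uy).
Unshelve. all: by end_near. Qed.

Lemma is_derive_dir2_line U f (P a b : R -> V) (dP da db : V) :
  open U -> Ck_on U 3 f -> U (P 0) ->
  is_derive (0 : R) 1 P dP -> is_derive (0 : R) 1 a da -> is_derive (0 : R) 1 b db ->
  is_derive (0 : R) 1 (fun t => 'D_(a t) ('D_(b t) f) (P t))
    ('D_dP ('D_(a 0) ('D_(b 0) f)) (P 0) + 'D_da ('D_(b 0) f) (P 0)
     + 'D_(a 0) ('D_db f) (P 0)).
Proof.
move=> oU Cf UP0 HP Ha Hb.
have UP : \forall h \near 0, U (P h).
  by apply: (is_derive_continuous HP); exact: open_nbhs_nbhs.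
pose N := coord_num B; pose e i := coord_vec B i; pose c i := coord_fun B i.
have : is_derive (0 : R) 1 (fun t => \sum_(i < N) c i (b t) * 'D_(a t) ('D_(e i) f) (P t))
  (\sum_(i < N) (c i (b 0) *: ('D_dP ('D_(a 0) ('D_(e i) f)) (P 0) + 'D_da ('D_(e i) f) (P 0))
    + 'D_(a 0) ('D_(e i) f) (P 0) *: c i db)).
  apply: is_derive_bigsum => i _; apply: is_deriveM; first exact: is_derive_coord.
  exact: (is_derive_dir B oU (Ck_on_D _ Cf) UP0 HP Ha).
have -> : \sum_(i < N) (c i (b 0) *: ('D_dP ('D_(a 0) ('D_(e i) f)) (P 0) + 'D_da ('D_(e i) f) (P 0))
    + 'D_(a 0) ('D_(e i) f) (P 0) *: c i db) =
    'D_dP ('D_(a 0) ('D_(b 0) f)) (P 0) + 'D_da ('D_(b 0) f) (P 0)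
     + 'D_(a 0) ('D_db f) (P 0).
  rewrite big_split/=; congr (_ + _).
    apply/esym; apply: (etrans (congr2 (fun s t : R => s + t)
      (derive3_coordsE _ _ _ oU Cf UP0) (derive2_coordsE _ _ oU (Ck_onS Cf) UP0))).
    by rewrite -big_split/=; apply: eq_bigr => i _; rewrite -mulrDr.
  apply/esym; apply: (etrans (derive2_coordsE _ _ oU (Ck_onS Cf) UP0)).
  by apply: eq_bigr => i _; rewrite mulrC.
apply: near_eq_is_derive; near=> h.
have Uh : U (P h) by near: h.
by apply/esym; exact: (derive2_coordsE _ _ oU (Ck_onS Cf) Uh).
Unshelve. all: by end_near. Qed.

Lemma is_derive_dir2 {T : normedModType R} U f (Psi a b : T -> V) z v dPsi da db :
  open U -> Ck_on U 3 f -> U (Psi z) ->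
  is_derive z v Psi dPsi -> is_derive z v a da -> is_derive z v b db ->
  is_derive z v (fun t => 'D_(a t) ('D_(b t) f) (Psi t))
    ('D_dPsi ('D_(a z) ('D_(b z) f)) (Psi z) + 'D_da ('D_(b z) f) (Psi z)
     + 'D_(a z) ('D_db f) (Psi z)).
Proof.
move=> oU Cf Uz /is_derive_lineP HP /is_derive_lineP Ha /is_derive_lineP Hb.
apply/is_derive_lineP.
have e0 : z + (0 : R) *: v = z by rewrite scale0r addr0.
have := is_derive_dir2_line oU Cf _ HP Ha Hb.
by rewrite e0; exact.
Qed.

End SecondDirectional.

Section MapDerivatives.
Context {R : realType} {n : nat}.
Local Notation rV := 'rV[R]_n.

Definition comp_fun (f : rV -> rV) (i : 'I_n) (x : rV) : R := f x 0 i.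
(** The differential of f, taken component by component: the chain rules above
    and the symmetry of second derivatives concern real functions. *)
Definition dvec (f : rV -> rV) (u x : rV) : rV := \row_i 'D_u (comp_fun f i) x.
Definition hvec (f : rV -> rV) (u v x : rV) : rV :=
  \row_i 'D_u ('D_v (comp_fun f i)) x.

Lemma comp_Ck U f m i : open U -> smooth_on U f -> Ck_on U m (comp_fun f i).
Proof. by move=> oU sf; exact: Ck_on_coord. Qed.

Lemma dvecE U f u x : open U -> smooth_on U f -> U x -> 'D_u f x = dvec f u x.
Proof.
move=> oU sf Ux; rewrite derive_mx; last exact: (Ck_on_derivable u (sf 1) Ux).
by apply/rowP => i; rewrite !mxE.
Qed.

Lemma comp_diff U f x i : open U -> smooth_on U f -> U x ->
  differentiable (comp_fun f i) x.
Proof.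
by move=> oU sf Ux; exact: (Ck_differentiable row_coords oU (comp_Ck 1 i oU sf) Ux).
Qed.

Lemma dvec0 f x : dvec f 0 x = 0.
Proof. by apply/rowP => i; rewrite !mxE derive0. Qed.

Lemma hvec0 f v x : hvec f 0 v x = 0.
Proof. by apply/rowP => i; rewrite !mxE derive0. Qed.

Lemma hvec_sym U f x u v : open U -> smooth_on U f -> U x ->
  hvec f u v x = hvec f v u x.
Proof.
move=> oU sf Ux; apply/rowP => i; rewrite [LHS]mxE.
rewrite [RHS]mxE.
have H := derive_swap u v oU (comp_Ck 2 i oU sf) Ux.
exact: H.
Qed.

Definition jac (f : rV -> rV) x : 'M[R]_n :=
  \matrix_(k, i) 'D_(delta_mx 0 k) (comp_fun f i) x.

Lemma dvec_jac U f u x : open U -> smooth_on U f -> U x ->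
  dvec f u x = u *m jac f x.
Proof.
move=> oU sf Ux; apply/rowP => i; rewrite !mxE.
have df := comp_diff i oU sf Ux.
rewrite {1}[u]row_sum_delta derive_sum_dir//; apply: eq_bigr => k _.
by rewrite deriveZ_dir// mxE.
Qed.

Lemma is_derive_map {T : normedModType R} (W : set rV) (phi : rV -> rV)
  (X : T -> rV) z v dX : open W -> smooth_on W phi -> W (X z) ->
  is_derive z v X dX -> is_derive z v (fun t => phi (X t)) (dvec phi dX (X z)).
Proof.
move=> oW sphi Wz HX; apply/is_derive_row => i; rewrite mxE.
exact: (is_derive_chain HX (comp_diff i oW sphi Wz)).
Qed.

Lemma is_derive_dvec {T : normedModType R} (W : set rV) (phi : rV -> rV)
  (X V : T -> rV) z v dX dV : open W -> smooth_on W phi -> W (X z) ->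
  is_derive z v X dX -> is_derive z v V dV ->
  is_derive z v (fun t => dvec phi (V t) (X t))
    (hvec phi dX (V z) (X z) + dvec phi dV (X z)).
Proof.
move=> oW sphi Wz HX HV; apply/is_derive_row => i; rewrite !mxE.
rewrite (_ : (fun p => _) = (fun t => 'D_(V t) (comp_fun phi i) (X t))); last first.
  by apply/funext => p; rewrite mxE.
exact: (is_derive_dir row_coords oW (comp_Ck 2 i oW sphi) Wz HX HV).
Qed.

End MapDerivatives.

Section ChartChange.
Context {R : realType} {n : nat}.
Local Notation rV := 'rV[R]_n.
Local Notation Z := ('rV[R]_n * 'rV[R]_n)%type.
Variables (W W' : set rV) (phi psi : rV -> rV).
Hypotheses (oW : open W) (oW' : open W').
Hypothesis phi_smooth : smooth_on W phi.
Hypothesis psi_smooth : smooth_on W' psi.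
Hypothesis phiW : forall x, W x -> W' (phi x).
Hypothesis phiK : forall x, W x -> psi (phi x) = x.

(** The chain rule for psi o phi, which is the identity near x. *)
Lemma dvec_inj u x : W x -> dvec phi u x = 0 -> u = 0.
Proof.
move=> Wx u0; apply/rowP => i.
have H1 : is_derive x u phi (dvec phi u x).
  by apply/is_derive_row => j; rewrite mxE; apply: derivableP;
     apply: diff_derivable; exact: (comp_diff j oW phi_smooth Wx).
have H2 := is_derive_chain H1 (comp_diff i oW' psi_smooth (phiW Wx)).
rewrite u0 derive0 in H2.
have H3 : is_derive x u (fun y : rV => y 0 i) 0.
  apply: near_eq_is_derive H2; near=> y; rewrite /comp_fun phiK//.
  by near: y; exact: open_nbhs_nbhs.
have : is_derive x u (id : rV -> rV) u by exact: is_derive_id.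
move=> /is_derive_row/(_ i) [_ <-]; rewrite mxE.
by case: H3.
Unshelve. all: by end_near. Qed.

Lemma jac_unit x : W x -> jac phi x \in unitmx.
Proof.
move=> Wx; rewrite -row_free_unit; apply: inj_row_free => v.
by rewrite -(dvec_jac _ oW phi_smooth Wx); exact: dvec_inj.
Qed.

Lemma dvec_surj x w : W x -> exists u, dvec phi u x = w.
Proof.
move=> Wx; exists (w *m invmx (jac phi x)).
by rewrite (dvec_jac _ oW phi_smooth Wx) mulmxKV// jac_unit.
Qed.

Lemma is_derive_id_fst (z v : Z) : is_derive z v (fun p : Z => p.1) v.1.
Proof. exact: is_derive_fst. Qed.

Lemma is_derive_id_snd (z v : Z) : is_derive z v (fun p : Z => p.2) v.2.
Proof. exact: is_derive_snd. Qed.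

(** The action of phi on tangent vectors. *)
Definition tmap (z : Z) : Z := (phi z.1, dvec phi z.2 z.1).

Lemma is_derive_tmap (z v : Z) : W z.1 ->
  is_derive z v tmap
    (dvec phi v.1 z.1, hvec phi v.1 z.2 z.1 + dvec phi v.2 z.1).
Proof.
move=> Wz; apply: is_derive_pair.
  exact: (is_derive_map oW phi_smooth Wz (is_derive_id_fst z v)).
exact: (is_derive_dvec oW phi_smooth Wz (is_derive_id_fst z v) (is_derive_id_snd z v)).
Qed.

Lemma slitW_open : open (slit W). Proof. exact: slit_open. Qed.

Lemma slitW_nbhs z : slit W z -> \forall p \near z, slit W p.
Proof. by move=> Wz; exact: open_nbhs_nbhs (conj slitW_open Wz). Qed.

Lemma tmap_slit O z : (forall x, W x -> O (phi x)) -> slit W z -> slit O (tmap z).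
Proof.
move=> WO [Wz z0]; split; first exact: WO.
by apply: contra_neq z0 => /(dvec_inj Wz).
Qed.

(** The differential of [tmap]. *)
Definition dtmap (z v : Z) : Z :=
  (dvec phi v.1 z.1, hvec phi v.1 z.2 z.1 + dvec phi v.2 z.1).

Lemma dtmap_ver z u : dtmap z (0, u) = (0, dvec phi u z.1).
Proof. by rewrite /dtmap /= dvec0 hvec0 add0r. Qed.

Lemma dtmap_hor z u : dtmap z (u, 0) = (dvec phi u z.1, hvec phi u z.2 z.1).
Proof. by rewrite /dtmap /= dvec0 addr0. Qed.

Section Pullback.
Variables (O2 : set rV) (f1 f2 : Z -> R).
Hypotheses (oO2 : open O2) (WO2 : forall x, W x -> O2 (phi x)).
Hypothesis f12 : forall z, slit W z -> f1 z = f2 (tmap z).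

Let oU2 : open (slit O2). Proof. exact: slit_open. Qed.

Lemma pullback_D z v : Ck_on (slit O2) 1 f2 -> slit W z ->
  'D_v f1 z = 'D_(dtmap z v) f2 (tmap z).
Proof.
move=> Cf Wz; have Tz := tmap_slit WO2 Wz.
have [_ <-] := is_derive_chain (is_derive_tmap v Wz.1) (Ck_diff oU2 Cf Tz).
apply: near_eq_derive; near=> p; apply: f12.
by near: p; exact: slitW_nbhs.
Unshelve. all: by end_near. Qed.

(** The image under [dtmap] of the fixed vertical direction u moves with the
    base point; the last term comes from this motion. *)
Lemma pullback_D2 z v u : Ck_on (slit O2) 2 f2 -> slit W z ->
  'D_v ('D_(0, u) f1) z =
  'D_(dtmap z v) ('D_(0, dvec phi u z.1) f2) (tmap z)
  + 'D_(0, hvec phi v.1 u z.1) f2 (tmap z).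
Proof.
move=> Cf Wz; have Tz := tmap_slit WO2 Wz.
have Hw : is_derive z v (fun p : Z => (0, dvec phi u p.1) : Z)
    (0, hvec phi v.1 u z.1).
  apply: (is_derive_pair (is_derive_cst (0 : rV) z v)).
  have := is_derive_dvec oW phi_smooth Wz.1 (is_derive_id_fst z v) (is_derive_cst u z v).
  by rewrite dvec0 addr0.
have [_ <-] := is_derive_dir phase_coords oU2 Cf Tz (is_derive_tmap v Wz.1) Hw.
apply: near_eq_derive; near=> p.
have Wp : slit W p by near: p; exact: slitW_nbhs.
by rewrite -dtmap_ver; exact: pullback_D (Ck_onS Cf) Wp.
Unshelve. all: by end_near. Qed.

(** Restricted to a fibre, [tmap] is linear, and no second derivative of phi is
    left. *)
Lemma pullback_ver2 z u : Ck_on (slit O2) 2 f2 -> slit W z ->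
  'D_(0, u) ('D_(0, u) f1) z =
  'D_(0, dvec phi u z.1) ('D_(0, dvec phi u z.1) f2) (tmap z).
Proof.
move=> Cf Wz; apply: (etrans (pullback_D2 (0, u) u Cf Wz)).
by rewrite hvec0 derive0 addr0 dtmap_ver.
Qed.

End Pullback.

Section SprayChange.
Variables (O1 O2 : set rV) (L1 L2 : Z -> R).
Hypotheses (HL1 : local_finsler O1 L1) (HL2 : local_finsler O2 L2).
Hypotheses (WO1 : W `<=` O1) (WO2 : forall x, W x -> O2 (phi x)).
Hypothesis L12 : forall z, slit W z -> L1 z = L2 (tmap z).

Local Notation E1 := (energy L1).
Local Notation E2 := (energy L2).
Local Notation G1 := (spray_vec L1).
Local Notation G2 := (spray_vec L2).

Let oO2 := lf_open HL2.
Let oU1 : open (slit O1). Proof. exact: slit_open (lf_open HL1). Qed.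
Let oU2 : open (slit O2). Proof. exact: slit_open (lf_open HL2). Qed.

Let E12 z : slit W z -> E1 z = E2 (tmap z).
Proof. by move=> Wz; rewrite /energy L12. Qed.

Let slitO1 z : slit W z -> slit O1 z.
Proof. by move=> [Wz z0]; split => //; exact: WO1. Qed.

(** It is enough that the right side solves the Euler-Lagrange equations of L2.
    The equations of L1, pulled back by [tmap], differ from these by terms with
    second derivatives of phi. Those that involve the test vector cancel by
    symmetry; the remaining one is the correction of the spray. *)
Lemma spray_change z : slit W z ->
  G2 (tmap z) = dvec phi (G1 z) z.1 - hvec phi z.2 z.2 z.1.
Proof.
have alg (a b c d e f g h : R) : a = b - c -> a = d -> b = e + f + g ->
  c = h + g -> d - f = e - h by lra.
move=> Wz; have Tz := tmap_slit WO2 Wz; have O1z := slitO1 Wz.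
apply/esym; apply: (spray_unique HL2 Tz) => w.
have [u uw] := dvec_surj w Wz.1.
have C2 m := energy_Ck HL2 m.
have dE2 := energy_diff HL2 Tz.
have dD2 v := denergy_diff HL2 v Tz.
pose A := dvec phi (G1 z) z.1; pose H := hvec phi z.2 z.2 z.1.
pose Hu := hvec phi z.2 u z.1; pose y := dvec phi z.2 z.1.
have e1 : 'D_(0, G1 z) ('D_(0, u) E1) z = 'D_(0, A) ('D_(0, w) E2) (tmap z).
  apply: (etrans (pullback_D2 oO2 WO2 E12 (0, G1 z) u (C2 2) Wz)).
  by rewrite hvec0 derive0 addr0 dtmap_ver uw.
have e2 : 'D_(0, u) ('D_(z.2, 0) E1) z =
    'D_(y, 0) ('D_(0, w) E2) (tmap z) + 'D_(0, H) ('D_(0, w) E2) (tmap z)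
    + 'D_(0, Hu) E2 (tmap z).
  apply: (etrans (derive_swap (0, u) (z.2, 0) oU1 (energy_Ck HL1 2) O1z)).
  apply: (etrans (pullback_D2 oO2 WO2 E12 (z.2, 0) u (C2 2) Wz)).
  by rewrite dtmap_hor uw (derive_split _ _ (dD2 (0, w))).
have e3 : 'D_(u, 0) E1 z = 'D_(w, 0) E2 (tmap z) + 'D_(0, Hu) E2 (tmap z).
  apply: (etrans (pullback_D oO2 WO2 E12 (u, 0) (C2 1) Wz)).
  rewrite dtmap_hor uw (hvec_sym u z.2 oW phi_smooth Wz.1).
  exact: derive_split.
have e4 := derive_swap (0, w) (y, 0) oU2 (C2 2) Tz.
have -> : (0, A - H) = (0, A) - (0, H) :> Z.
  by rewrite [RHS]pair_addE /= subr0.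
apply: (etrans (deriveD_dir _ _ (dD2 (0, w)))).
apply: (etrans (congr1 (fun c : R => 'D_(0, A) ('D_(0, w) E2) (tmap z) + c)
  (deriveN_dir _ (dD2 (0, w))))).
apply/esym; apply: (etrans (congr1 (fun c : R => c - 'D_(w, 0) E2 (tmap z)) e4)).
by apply/esym; exact: alg (spray_EL HL1 u O1z) e1 e2 e3.
Qed.

Local Notation phi_ := (comp_fun phi).

Let phiC m i : Ck_on W m (phi_ i). Proof. exact: comp_Ck. Qed.

Let phid i x : W x -> differentiable (phi_ i) x. Proof. exact: comp_diff. Qed.

Lemma spray_change_coord i z : slit W z ->
  spray L2 i (tmap z) =
  'D_(G1 z) (phi_ i) z.1 - 'D_(z.2) ('D_(z.2) (phi_ i)) z.1.
Proof.
by move=> /spray_change/(congr1 (fun u : rV => u 0 i)); rewrite !mxE.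
Qed.

Definition dspray z (v : Z) : rV := \row_i 'D_v (spray L1 i) z.

(** [spray_change] is an identity on an open set, hence can be differentiated,
    in any direction v. Vertical and horizontal directions give the laws for
    dG/dy and dG/dx. *)
Lemma spray_change_D i z v : slit W z ->
  'D_(dtmap z v) (spray L2 i) (tmap z) =
  ('D_(v.1) ('D_(G1 z) (phi_ i)) z.1 + 'D_(dspray z v) (phi_ i) z.1)
  - ('D_(v.1) ('D_(z.2) ('D_(z.2) (phi_ i))) z.1 + 'D_(v.2) ('D_(z.2) (phi_ i)) z.1
     + 'D_(z.2) ('D_(v.2) (phi_ i)) z.1).
Proof.
move=> Wz; have Tz := tmap_slit WO2 Wz; have O1z := slitO1 Wz.
have H1 := is_derive_chain (is_derive_tmap v Wz.1) (spray_diff HL2 i Tz).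
have H2 := is_derive_dir row_coords oW (phiC 2 i) Wz.1 (is_derive_id_fst z v)
  (spray_vec_is_derive HL1 v O1z).
have H3 := is_derive_dir2 row_coords oW (phiC 3 i) Wz.1 (is_derive_id_fst z v)
  (is_derive_id_snd z v) (is_derive_id_snd z v).
have [_ E] := is_deriveB H2 H3.
have [_ E1] := H1.
apply: (etrans (esym E1)); apply: (etrans _ E).
apply: near_eq_derive; near=> p.
have Wp : slit W p by near: p; exact: slitW_nbhs.
exact: spray_change_coord.
Unshelve. all: by end_near. Qed.

Local Notation ek k := (delta_mx 0 k : rV).

Lemma spray_change_ver i k z : slit W z ->
  'D_(0, dvec phi (ek k) z.1) (spray L2 i) (tmap z) =
  'D_(dspray z (0, ek k)) (phi_ i) z.1 - 2 * 'D_(z.2) ('D_(ek k) (phi_ i)) z.1.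
Proof.
have alg (a b c d e f g : R) : a = (b + c) - (d + e + f) -> b = 0 -> d = 0 -> e = f ->
  a = c - 2 * f by lra.
move=> Wz; rewrite -dtmap_ver.
apply: (alg _ _ _ _ _ _ 0 (spray_change_D i (0, ek k) Wz)).
- exact: derive0.
- exact: derive0.
- exact: (derive_swap (ek k) z.2 oW (phiC 2 i) Wz.1).
Qed.

Lemma spray_change_hor i k z : slit W z ->
  'D_(dvec phi (ek k) z.1, hvec phi z.2 (ek k) z.1) (spray L2 i) (tmap z) =
  'D_(G1 z) ('D_(ek k) (phi_ i)) z.1 + 'D_(dspray z (ek k, 0)) (phi_ i) z.1
  - 'D_(z.2) ('D_(z.2) ('D_(ek k) (phi_ i))) z.1.
Proof.
have alg (a b c d e f b' d' : R) : a = (b + c) - (d + e + f) -> b = b' -> d = d' ->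
  e = 0 -> f = 0 -> a = b' + c - d' by lra.
move=> Wz; rewrite (hvec_sym z.2 (ek k) oW phi_smooth Wz.1) -dtmap_hor.
apply: (alg _ _ _ _ _ _ _ _ (spray_change_D i (ek k, 0) Wz)).
- exact: (derive_swap (ek k) (G1 z) oW (phiC 2 i) Wz.1).
- apply: (etrans (derive_swap (ek k) z.2 oW (Ck_on_D z.2 (phiC 3 i)) Wz.1)).
  apply: near_eq_derive; near=> p.
  have Wp : W p.
    by near: p; exact: open_nbhs_nbhs (conj oW Wz.1).
  exact: (derive_swap (ek k) z.2 oW (phiC 2 i) Wp).
- exact: derive0.
- have : is_derive z.1 z.2 (fun _ : rV => 0 : R) 0 by exact: is_derive_cst.
  move=> [_ E]; apply: (etrans _ E); apply: near_eq_derive; near=> p.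
  exact: derive0.
Unshelve. all: by end_near. Qed.

(** [dtmap] maps the geodesic field (y, - G1) to (y, - G2), so that the law for
    dG/dy can be differentiated once more, along it. *)
Lemma spray_change_flow i k z : slit W z ->
  'D_((tmap z).2, - G2 (tmap z)) ('D_(0, dvec phi (ek k) z.1) (spray L2 i)) (tmap z)
  + 'D_(0, hvec phi z.2 (ek k) z.1) (spray L2 i) (tmap z) =
  'D_(z.2) ('D_(dspray z (0, ek k)) (phi_ i)) z.1
  + 'D_(\row_j 'D_(z.2, - G1 z) (dy k (spray L1 j)) z) (phi_ i) z.1
  - 2 * ('D_(z.2) ('D_(z.2) ('D_(ek k) (phi_ i))) z.1
         - 'D_(G1 z) ('D_(ek k) (phi_ i)) z.1).
Proof.
move=> Wz; have Tz := tmap_slit WO2 Wz; have O1z := slitO1 Wz.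
pose v : Z := (z.2, - G1 z).
have dtv : dtmap z v = ((tmap z).2, - G2 (tmap z)).
  rewrite /dtmap /= (spray_change Wz) opprB; congr (_, _ + _).
  by apply/rowP => j; rewrite !mxE deriveN_dir//; exact: phid Wz.1.
have Hw : is_derive z v (fun p : Z => (0, dvec phi (ek k) p.1) : Z)
    (0, hvec phi v.1 (ek k) z.1).
  apply: (is_derive_pair (is_derive_cst (0 : rV) z v)).
  have := is_derive_dvec oW phi_smooth Wz.1 (is_derive_id_fst z v) (is_derive_cst (ek k) z v).
  by rewrite dvec0 addr0.
have H1 := is_derive_dir phase_coords (slit_open oO2) (spray_Ck HL2 2 i) Tz
  (is_derive_tmap v Wz.1) Hw.
have Hd : is_derive z v (fun p => dspray p (0, ek k))
    (\row_j 'D_v (dy k (spray L1 j)) z).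
  apply/is_derive_row => j; rewrite mxE.
  rewrite (_ : (fun p => _) = dy k (spray L1 j)); last by apply/funext => p; rewrite mxE.
  by apply: derivableP; exact: (Ck_on_derivable v (dy_Ck k (spray_Ck HL1 2 j)) O1z).
have H2 := is_derive_dir row_coords oW (phiC 2 i) Wz.1 (is_derive_id_fst z v) Hd.
have H3 := is_derive_dir row_coords oW (Ck_on_D (ek k) (phiC 3 i)) Wz.1
  (is_derive_id_fst z v) (is_derive_id_snd z v).
have [_ EB] := is_deriveB H2 (is_deriveZ 2 H3).
have [_ EA] := H1.
have alg (a c d e g h : R) : a = c + d - 2 * (e + g) -> g = - h ->
  a = c + d - 2 * (e - h) by move=> -> ->.
have Hg : 'D_(- G1 z) ('D_(ek k) (phi_ i)) z.1 = - 'D_(G1 z) ('D_(ek k) (phi_ i)) z.1.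
  apply: deriveN_dir.
  exact: (Ck_differentiable row_coords oW (Ck_on_D (ek k) (phiC 2 i)) Wz.1).
have HAB : 'D_v (fun p : Z => 'D_(0, dvec phi (ek k) p.1) (spray L2 i) (tmap p)) z =
  'D_v ((fun t : Z => 'D_(dspray t (0, ek k)) (phi_ i) t.1) -
        2 \*: (fun t : Z => 'D_t.2 ('D_(ek k) (phi_ i)) t.1)) z.
  apply: near_eq_derive; near=> p.
  have Wp : slit W p by near: p; exact: slitW_nbhs.
  exact: spray_change_ver.
rewrite -dtv.
exact: (alg _ _ _ _ _ _ (etrans (esym EA) (etrans HAB EB)) Hg).
Unshelve. all: by end_near. Qed.

(** For a derivation D, the substitution K = A J turns D^2 J + P D J + S J = 0
    into an equation of the same form, whose coefficients P' and S' are
    determined by the first two hypotheses when A1 = D A and A2 = D^2 A. The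
    third hypothesis is the derivative of the first, with Q = D P and Q' = D P'.
    Eliminating A P, A S and A Q shows that A conjugates the curvature
    S - Q / 2 - P^2 / 4. *)
Lemma gauge_curvature (A A1 A2 P Q S P' Q' S' : 'M[R]_n) :
  P' *m A = A *m P - 2 *: A1 ->
  S' *m A + P' *m A1 = A *m S - A2 ->
  Q' *m A + P' *m A1 = A1 *m P + A *m Q - 2 *: A2 ->
  (S' - 2^-1 *: Q' - 4^-1 *: (P' *m P')) *m A =
  A *m (S - 2^-1 *: Q - 4^-1 *: (P *m P)).
Proof.
move=> H1 H2 H3.
have AP : A *m P = P' *m A + 2 *: A1 by rewrite H1 subrK.
have AS : A *m S = S' *m A + P' *m A1 + A2 by rewrite H2 subrK.
have AQ : A *m Q = Q' *m A + P' *m A1 - A1 *m P + 2 *: A2.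
  by rewrite H3 addrAC subrK addrAC subrr add0r.
have APP : A *m (P *m P) = P' *m P' *m A + 2 *: (P' *m A1) + 2 *: (A1 *m P).
  rewrite mulmxA AP mulmxDl -mulmxA AP mulmxDr -scalemxAr -scalemxAl.
  by rewrite mulmxA.
rewrite !mulmxBl !mulmxBr -!scalemxAl -!scalemxAr AS AQ APP.
move: (S' *m A) (Q' *m A) (P' *m P' *m A) (P' *m A1) (A1 *m P) => X1 X2 X3 X4 X5.
apply/matrixP => i j; rewrite !mxE.
by move: (X1 i j) (X2 i j) (X3 i j) (X4 i j) (X5 i j) (A2 i j) => *; field.
Qed.

Lemma mx_subE (A B C : 'M[R]_n) (a b : R) i k :
  (A - a *: B - b *: C) i k = A i k - a * B i k - b * C i k.
Proof. by rewrite !mxE. Qed.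

Lemma mulmx_subE (A B C : 'M[R]_n) (a : R) i k :
  (A *m B - a *: C) i k = \sum_j A i j * B j k - a * C i k.
Proof. by rewrite !mxE. Qed.

Lemma mulmx_addE (A B C D : 'M[R]_n) i k :
  (A *m B + C *m D) i k = \sum_j A i j * B j k + \sum_j C i j * D j k.
Proof. by rewrite !mxE. Qed.

Lemma mx_mulE (A B : 'M[R]_n) i k : (A *m B) i k = \sum_j A i j * B j k.
Proof. by rewrite mxE. Qed.

Lemma derive_row (f : rV -> R) x u : differentiable f x ->
  'D_u f x = \sum_j u 0 j * 'D_(ek j) f x.
Proof.
move=> df; rewrite {1}[u]row_sum_delta derive_sum_dir//.
by apply: eq_bigr => k _; rewrite deriveZ_dir.
Qed.

Definition mx_dy (L : Z -> R) z : 'M[R]_n := \matrix_(i, k) dy k (spray L i) z.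
Definition mx_dx (L : Z -> R) z : 'M[R]_n := \matrix_(i, k) dx k (spray L i) z.
Definition mx_flow (L : Z -> R) z : 'M[R]_n :=
  \matrix_(i, k) 'D_(z.2, - spray_vec L z) (dy k (spray L i)) z.
Definition mx_riemann (L : Z -> R) z : 'M[R]_n := \matrix_(i, k) riemann L i k z.

Lemma mx_riemannE O L z : local_finsler O L -> slit O z ->
  mx_riemann L z = mx_dx L z - 2^-1 *: mx_flow L z - 4^-1 *: (mx_dy L z *m mx_dy L z).
Proof.
move=> HL Oz; apply/matrixP => i k; rewrite [LHS]mxE (riemannE HL i k Oz).
rewrite mx_subE mx_mulE; congr (_ - _ * _ - _ * _).
- by rewrite mxE.
- by rewrite mxE.
- by apply: eq_bigr => j _; rewrite [X in _ = X * _]mxE [X in _ = _ * X]mxE.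
Qed.

(** The Jacobian matrix A of phi. [jac2] and [jac3] are its first and second
    derivatives along the geodesic field (y, - G1). *)
Definition jac1 (z : Z) : 'M[R]_n := \matrix_(i, k) 'D_(ek k) (phi_ i) z.1.
Definition jac2 (z : Z) : 'M[R]_n := \matrix_(i, k) 'D_(z.2) ('D_(ek k) (phi_ i)) z.1.
Definition jac3 (z : Z) : 'M[R]_n := \matrix_(i, k)
  ('D_(z.2) ('D_(z.2) ('D_(ek k) (phi_ i))) z.1 - 'D_(G1 z) ('D_(ek k) (phi_ i)) z.1).

Lemma mx_dyE L z i k : mx_dy L z i k = dy k (spray L i) z.
Proof. by rewrite mxE. Qed.

Lemma mx_dxE L z i k : mx_dx L z i k = dx k (spray L i) z.
Proof. by rewrite mxE. Qed.

Lemma mx_flowE L z i k :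
  mx_flow L z i k = 'D_(z.2, - spray_vec L z) (dy k (spray L i)) z.
Proof. by rewrite mxE. Qed.

Lemma jac1E z i k : jac1 z i k = 'D_(ek k) (phi_ i) z.1.
Proof. by rewrite mxE. Qed.

Lemma jac2E z i k : jac2 z i k = 'D_(z.2) ('D_(ek k) (phi_ i)) z.1.
Proof. by rewrite mxE. Qed.

Lemma jac3E z i k : jac3 z i k =
  'D_(z.2) ('D_(z.2) ('D_(ek k) (phi_ i))) z.1 - 'D_(G1 z) ('D_(ek k) (phi_ i)) z.1.
Proof. by rewrite mxE. Qed.

Lemma dvec_coord u x i : dvec phi u x 0 i = 'D_u (phi_ i) x.
Proof. by rewrite mxE. Qed.

Lemma hvec_coord u v x i : hvec phi u v x 0 i = 'D_u ('D_v (phi_ i)) x.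
Proof. by rewrite mxE. Qed.

Lemma dspray_coord z v i : dspray z v 0 i = 'D_v (spray L1 i) z.
Proof. by rewrite mxE. Qed.

(** This lemma and the next two are the hypotheses of [gauge_curvature], for
    P = dG/dy, S = dG/dx and Q the derivative of P along the geodesic field. *)
Lemma mx_dy_change z : slit W z ->
  mx_dy L2 (tmap z) *m jac1 z = jac1 z *m mx_dy L1 z - 2 *: jac2 z.
Proof.
move=> Wz; have Tz := tmap_slit WO2 Wz; apply/matrixP => i k.
have f1 : \sum_j mx_dy L2 (tmap z) i j * jac1 z j k =
    \sum_j dvec phi (ek k) z.1 0 j * dy j (spray L2 i) (tmap z).
  by apply: eq_bigr => j _; rewrite mx_dyE jac1E dvec_coord mulrC.
have f2 : \sum_j jac1 z i j * mx_dy L1 z j k =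
    \sum_j dspray z (0, ek k) 0 j * 'D_(ek j) (phi_ i) z.1.
  by apply: eq_bigr => j _; rewrite mx_dyE jac1E dspray_coord mulrC.
have E := spray_change_ver i k Wz.
have e1 := derive_ver (dvec phi (ek k) z.1) (spray_diff HL2 i Tz).
have e2 := derive_row (dspray z (0, ek k)) (phid i Wz.1).
apply: (etrans (mx_mulE _ _ i k)); apply: (etrans f1).
apply: (etrans (esym e1)); apply: (etrans E); apply/esym.
apply: (etrans (mulmx_subE _ _ _ _ i k)).
by apply: (congr2 (fun s t : R => s - 2 * t)) (etrans f2 (esym e2)) (jac2E z i k).
Qed.

Lemma mx_dx_change z : slit W z ->
  mx_dx L2 (tmap z) *m jac1 z + mx_dy L2 (tmap z) *m jac2 z
  = jac1 z *m mx_dx L1 z - jac3 z.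
Proof.
have alg (a g d y s : R) : a = g + d - y -> d = s -> a = s - 1 * (y - g).
  by move=> -> ->; ring.
move=> Wz; have Tz := tmap_slit WO2 Wz; apply/matrixP => i k.
have f1 : \sum_j mx_dx L2 (tmap z) i j * jac1 z j k =
    \sum_j dvec phi (ek k) z.1 0 j * dx j (spray L2 i) (tmap z).
  by apply: eq_bigr => j _; rewrite mx_dxE jac1E dvec_coord mulrC.
have f1' : \sum_j mx_dy L2 (tmap z) i j * jac2 z j k =
    \sum_j hvec phi z.2 (ek k) z.1 0 j * dy j (spray L2 i) (tmap z).
  by apply: eq_bigr => j _; rewrite mx_dyE jac2E hvec_coord mulrC.
have f2 : \sum_j jac1 z i j * mx_dx L1 z j k =
    \sum_j dspray z (ek k, 0) 0 j * 'D_(ek j) (phi_ i) z.1.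
  by apply: eq_bigr => j _; rewrite mx_dxE jac1E dspray_coord mulrC.
have E := spray_change_hor i k Wz.
have dg := spray_diff HL2 i Tz.
have e0 := derive_split (dvec phi (ek k) z.1) (hvec phi z.2 (ek k) z.1) dg.
have e1 := derive_hor (dvec phi (ek k) z.1) dg.
have e1' := derive_ver (hvec phi z.2 (ek k) z.1) dg.
have e2 := derive_row (dspray z (ek k, 0)) (phid i Wz.1).
apply: (etrans (mulmx_addE _ _ _ _ i k)).
apply: (etrans (congr2 (fun s t : R => s + t) f1 f1')).
apply: (etrans (esym (congr2 (fun s t : R => s + t) e1 e1'))).
apply: (etrans (esym e0)); apply/esym.
rewrite -[jac3 z]scale1r; apply: (etrans (mulmx_subE _ _ _ _ i k)).
apply: (etrans (congr2 (fun s t : R => s - 1 * t) f2 (jac3E z i k))).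
by apply/esym; exact: alg E e2.
Qed.

Lemma mx_flow_change z : slit W z ->
  mx_flow L2 (tmap z) *m jac1 z + mx_dy L2 (tmap z) *m jac2 z
  = jac2 z *m mx_dy L1 z + jac1 z *m mx_flow L1 z - 2 *: jac3 z.
Proof.
move=> Wz; have Tz := tmap_slit WO2 Wz; apply/matrixP => i k.
have f1 : \sum_j mx_flow L2 (tmap z) i j * jac1 z j k =
    \sum_j dvec phi (ek k) z.1 0 j * 'D_((tmap z).2, - G2 (tmap z)) (dy j (spray L2 i)) (tmap z).
  by apply: eq_bigr => j _; rewrite mx_flowE jac1E dvec_coord mulrC.
have f1' : \sum_j mx_dy L2 (tmap z) i j * jac2 z j k =
    \sum_j hvec phi z.2 (ek k) z.1 0 j * dy j (spray L2 i) (tmap z).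
  by apply: eq_bigr => j _; rewrite mx_dyE jac2E hvec_coord mulrC.
have f2 : \sum_j jac2 z i j * mx_dy L1 z j k =
    'D_(z.2) ('D_(dspray z (0, ek k)) (phi_ i)) z.1.
  apply/esym; apply: (etrans (derive2_coordsE row_coords (dspray z (0, ek k)) z.2 oW (phiC 2 i) Wz.1)); apply: eq_bigr => j _.
  by rewrite jac2E mx_dyE mulrC /= /row_fun /row_vec valK /= dspray_coord.
have f2' : \sum_j jac1 z i j * mx_flow L1 z j k =
    \sum_j (\row_j 'D_(z.2, - G1 z) (dy k (spray L1 j)) z) 0 j * 'D_(ek j) (phi_ i) z.1.
  by apply: eq_bigr => j _; rewrite mx_flowE jac1E [(\row_j _) 0 j]mxE mulrC.
have E := spray_change_flow i k Wz.
have dg := spray_diff HL2 i Tz.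
have e1 := derive_ver2 ((tmap z).2, - G2 (tmap z)) (dvec phi (ek k) z.1)
  (slit_open oO2) (spray_Ck HL2 2 i) Tz.
have e1' := derive_ver (hvec phi z.2 (ek k) z.1) dg.
have e2' := derive_row (\row_j 'D_(z.2, - G1 z) (dy k (spray L1 j)) z) (phid i Wz.1).
apply: (etrans (mulmx_addE _ _ _ _ i k)).
apply: (etrans (congr2 (fun s t : R => s + t) f1 f1')).
apply: (etrans (esym (congr2 (fun s t : R => s + t) e1 e1'))).
apply: (etrans E); apply/esym.
have mE (A B C D F : 'M[R]_n) (a : R) :
  (A *m B + C *m D - a *: F) i k =
  (\sum_j A i j * B j k + \sum_j C i j * D j k) - a * F i k.
  by rewrite !mxE.
apply: (etrans (mE _ _ _ _ _ _)).
by apply: (congr2 (fun s t : R => s - 2 * t))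
  (congr2 (fun s t : R => s + t) f2 (etrans f2' (esym e2'))) (jac3E z i k).
Qed.

Lemma mx_riemann_change z : slit W z ->
  mx_riemann L2 (tmap z) *m jac1 z = jac1 z *m mx_riemann L1 z.
Proof.
move=> Wz; have Tz := tmap_slit WO2 Wz; have O1z := slitO1 Wz.
rewrite (mx_riemannE HL2 Tz) (mx_riemannE HL1 O1z).
have H1 := mx_dy_change Wz; have H2 := mx_dx_change Wz.
have H3 := mx_flow_change Wz.
exact: gauge_curvature H1 H2 H3.
Qed.

Lemma riemann_trace_change z : slit W z ->
  riemann_trace L1 z = riemann_trace L2 (tmap z).
Proof.
move=> Wz.
have trE L p : riemann_trace L p = \tr (mx_riemann L p).
  by apply: eq_bigr => i _; rewrite mxE.
have Au : jac1 z \in unitmx.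
  have -> : jac1 z = (jac phi z.1)^T.
    by apply/matrixP => i k; rewrite mxE [RHS]mxE [RHS]mxE.
  by rewrite unitmx_tr jac_unit//; exact: Wz.1.
rewrite !trE -[mx_riemann L2 _](mulmxK Au) (mx_riemann_change Wz).
by rewrite mxtrace_mulC mulKmx.
Qed.

(** By [ricci_quad] the Ricci tensor is half the Hessian of the trace of the
    curvature along the fibre. The trace is invariant and fibres are mapped
    linearly. *)
Lemma ricci_change z v : slit W z ->
  quad_form (ricci_tensor L1 z) v =
  quad_form (ricci_tensor L2 (tmap z)) (dvec phi v z.1).
Proof.
move=> Wz; have Tz := tmap_slit WO2 Wz; have O1z := slitO1 Wz.
apply: (etrans (ricci_quad HL1 v O1z)); apply/esym.
apply: (etrans (ricci_quad HL2 _ Tz)); apply: (congr1 (fun c : R => 2^-1 * c)).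
apply/esym.
exact: (pullback_ver2 oO2 WO2 riemann_trace_change _ (riemann_trace_Ck HL2 2) Wz).
Qed.

End SprayChange.

End ChartChange.

(** * Primitives and weights *)

Section Monotone.
Context {R : realType}.

Lemma derive_ge0_le (f df : R -> R) (a b : R) : a <= b ->
  (forall t : R, t \in `[a, b] -> is_derive t 1 f (df t)) ->
  (forall t, t \in `[a, b] -> 0 <= df t) -> f a <= f b.
Proof.
move=> ab Hf df0.
have cf : {within `[a, b], continuous f}.
  by apply: derivable_within_continuous => t /Hf [].
have [c cab] := MVT_segment ab (fun t tab => Hf t (subset_itv_oo_cc tab)) cf.
by rewrite -subr_ge0 => ->; rewrite mulr_ge0 ?subr_ge0// df0.
Qed.

Lemma derive_eq_cst (f g df : R -> R) (a b : R) :
  (forall t, t \in `]a, b[ -> is_derive t 1 f (df t)) ->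
  (forall t, t \in `]a, b[ -> is_derive t 1 g (df t)) ->
  forall s t, s \in `]a, b[ -> t \in `]a, b[ -> f s - g s = f t - g t.
Proof.
move=> Hf Hg.
suff H s t : s <= t -> s \in `]a, b[ -> t \in `]a, b[ -> f s - g s = f t - g t.
  by move=> s t sab tab; have [st|/ltW ts] := leP s t; [exact: H|apply/esym/H].
move=> st sab tab.
have sub u : u \in `[s, t] -> u \in `]a, b[.
  rewrite !in_itv /= => /andP[su ut]; move: sab tab; rewrite !in_itv /=.
  by move=> /andP[as_ _] /andP[_ tb]; rewrite (lt_le_trans as_ su) (le_lt_trans ut tb).
have D u : u \in `[s, t] -> is_derive u 1 (fun x => f x - g x) 0.
  by move=> /sub uab; rewrite -(subrr (df u)); apply: is_deriveB; [exact: Hf|exact: Hg].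
have D' u : u \in `[s, t] -> is_derive u 1 (fun x => g x - f x) 0.
  by move=> /sub uab; rewrite -(subrr (df u)); apply: is_deriveB; [exact: Hg|exact: Hf].
apply/eqP; rewrite eq_le; apply/andP; split.
  exact: (derive_ge0_le (df := fun=> 0) st D (fun _ _ => lexx _)).
have := derive_ge0_le (df := fun=> 0) st D' (fun _ _ => lexx _).
by rewrite -lerN2 !opprB.
Qed.

Lemma primitive_bounded (g : R -> R) (N : R) : 0 < N -> continuous g ->
  exists F : R -> R, F 0 = 0 /\ forall t : R, t \in `]- N, N[ -> is_derive t 1 F (g t).
Proof.
move=> N0 cg; pose mu := @lebesgue_measure R.
have ig : mu.-integrable `[- N, N] (EFin \o g).
  by apply: continuous_compact_integrable; [exact: segment_compact|exact: continuous_subspaceT].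
pose F x := (\int[mu]_(t in [set` `[- N, x]]) (g t))%R.
exists (fun x => F x - F 0); split; first by rewrite subrr.
move=> t; rewrite in_itv /= => /andP[Nt tN].
have [dF F'] := continuous_FTC1_closed tN ig Nt (cg t).
rewrite -[X in is_derive _ _ _ X]subr0; apply: is_deriveB.
by split; [exact: dF|rewrite -derive1E; exact: F'].
Qed.

(** Primitives on ]-N, N[ that vanish at 0 extend one another as N grows. *)
Lemma primitive_exists (g : R -> R) : continuous g ->
  exists F : R -> R, F 0 = 0 /\ forall t : R, is_derive t 1 F (g t).
Proof.
move=> cg.
have HN (N : nat) : exists F : R -> R, F 0 = 0 /\
    forall t : R, t \in `](- (N.+1%:R)), N.+1%:R[ -> is_derive t 1 F (g t).
  exact: primitive_bounded.
have [F HF] := choice HN.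
have coh (N M : nat) t : (N <= M)%N -> `|t| < N.+1%:R -> F N t = F M t.
  move=> NM tN.
  have t_in (K : nat) : (N <= K)%N -> t \in `](- (K.+1%:R)), K.+1%:R[.
    move=> NK; rewrite in_itv /= -ltr_norml (lt_le_trans tN)// ler_nat ltnS.
    by [].
  have z_in (K : nat) : 0 \in `](- (K.+1%:R : R)), K.+1%:R[.
    by rewrite in_itv /= oppr_lt0 ltr0n.
  have sub s : s \in `](- (N.+1%:R : R)), N.+1%:R[ -> s \in `](- (M.+1%:R)), M.+1%:R[.
    by rewrite !in_itv /= -!ltr_norml => /lt_le_trans; apply; rewrite ler_nat ltnS.
  have := derive_eq_cst (HF N).2 (fun s sN => (HF M).2 s (sub s sN))
    (t_in N (leqnn _)) (z_in N).
  by rewrite (HF N).1 (HF M).1 subrr => /eqP; rewrite subr_eq0 => /eqP.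
pose idx (t : R) := Num.truncn `|t|.
have idxP t : `|t| < (idx t).+1%:R by rewrite /idx truncnS_gt.
exists (fun t => F (idx t) t); split; first exact: (HF _).1.
move=> t; pose M := (idx t).+1.
have dM : is_derive t 1 (F M) (g t).
  apply: (HF M).2; rewrite in_itv /= -ltr_norml (lt_trans (idxP t))//.
  by rewrite ltr_nat.
apply: near_eq_is_derive dM; near=> s.
have sM : `|s| < M%:R.
  near: s.
  apply: open_nbhs_nbhs; split; last exact: idxP.
  apply: (@open_comp _ _ (fun s : R => `|s|) [set s : R | s < M%:R]).
    by move=> s _; exact: norm_continuous.
  exact: open_lt.
apply/esym; apply: coh => //.
by rewrite /idx truncn_le_nat (lt_trans sM)// ltr_nat.
Unshelve. all: by end_near. Qed.

End Monotone.

Section Primitive.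
Context {R : realType} {n : nat}.
Local Notation rV := 'rV[R]_n.

Lemma primitive_row_exists (g : R -> rV) : exists F : R -> rV,
  continuous g -> F 0 = 0 /\ forall t : R, is_derive t 1 F (g t).
Proof.
have [cg|ncg] := pselect (continuous g); last by exists g.
have cgi i : continuous (fun t => g t 0 i).
  move=> t; apply: (@continuous_comp _ _ _ g (fun M : rV => M 0 i) t (cg t)).
  exact: coord_continuous.
have [F HF] := choice (fun i => primitive_exists (cgi i)).
exists (fun t => \row_i F i t) => _; split.
  by apply/rowP => i; rewrite !mxE (HF i).1.
move=> t; apply/is_derive_row => i.
rewrite (_ : (fun y => _) = F i); first exact: (HF i).2.
by apply/funext => y; rewrite mxE.
Qed.

Definition primitive (g : R -> rV) : R -> rV := sval (cid (primitive_row_exists g)).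

Lemma primitive0 g : continuous g -> primitive g 0 = 0.
Proof. by rewrite /primitive; case: cid => F /= H /H []. Qed.

Lemma is_derive_primitive g (t : R) : continuous g -> is_derive t 1 (primitive g) (g t).
Proof. by rewrite /primitive; case: cid => F /= H /H [_]; exact. Qed.

Lemma primitive_continuous g : continuous g -> continuous (primitive g).
Proof. by move=> cg t; exact: (is_derive_continuous (is_derive_primitive t cg)). Qed.

Lemma primitive_unique (F G g : R -> rV) : (forall t : R, is_derive t 1 F (g t)) ->
  (forall t : R, is_derive t 1 G (g t)) -> F 0 = G 0 -> F = G.
Proof.
move=> HF HG FG0; apply/funext => t; apply/rowP => i.
have Fi (s : R) := (is_derive_row _ _ _ _).1 (HF s) i.
have Gi (s : R) := (is_derive_row _ _ _ _).1 (HG s) i.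
have D (s : R) : is_derive s 1 (fun y => F y 0 i - G y 0 i) 0.
  by rewrite -(subrr (g s 0 i)); exact: is_deriveB.
have := is_derive_0_is_cst t 0 D; rewrite FG0 subrr => /eqP.
by rewrite subr_eq0 => /eqP.
Qed.

(** Twice the hyperbolic cosine of g. For the norm sup |f| / weight g,
    integration from 0 is a contraction as soon as the derivative of g is large;
    the hyperbolic cosine does this on both sides of 0. *)
Definition weight (g : R -> R) (t : R) : R := expR (g t) + expR (- g t).
Definition weight_prim (g : R -> R) (t : R) : R := expR (g t) - expR (- g t).

Lemma weight_parts (g : R -> R) (t d : R) : is_derive t 1 g d ->
  is_derive t 1 (fun s => expR (g s)) (expR (g t) * d) /\
  is_derive t 1 (fun s => expR (- g s)) (- (expR (- g t) * d)).
Proof.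
move=> Hg; split.
  exact: (@is_derive1_comp R expR g t _ _ (is_derive_expR (g t)) Hg).
have Hn : is_derive t 1 (fun s => - g s) (- d) by exact: is_deriveN.
have := @is_derive1_comp R expR (fun s => - g s) t _ _ (is_derive_expR (- g t)) Hn.
by rewrite mulrN.
Qed.

Lemma is_derive_weight_prim g (t d : R) : is_derive t 1 g d ->
  is_derive t 1 (weight_prim g) (d * weight g t).
Proof.
move=> /weight_parts[E1 E2]; have := is_deriveB E1 E2.
by rewrite opprK -mulrDl mulrC.
Qed.

Lemma weight_ge2 g t : 2 <= weight g t.
Proof.
rewrite /weight expRN; set e := expR _.
have e0 : 0 < e by exact: expR_gt0.
rewrite -subr_ge0 (_ : _ - _ = (e - 1) ^+ 2 / e); last by field; rewrite gt_eqF.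
by rewrite divr_ge0 ?sqr_ge0// ltW.
Qed.

Lemma weight_gt0 g t : 0 < weight g t.
Proof. by apply: lt_le_trans (weight_ge2 g t). Qed.

Lemma weight_prim_le g t : `|weight_prim g t| <= weight g t.
Proof.
rewrite /weight_prim (le_trans (ler_normB _ _))//.
by rewrite !ger0_norm ?expR_ge0.
Qed.

Variables g l : R -> R.
Hypotheses (g0 : g 0 = 0) (dg : forall t : R, is_derive t 1 g (l t)).

Lemma weight_continuous : continuous (weight g).
Proof.
move=> t; have [E1 E2] := weight_parts (dg t).
exact: (is_derive_continuous (is_deriveD E1 E2)).
Qed.

Lemma weight_prim0 : weight_prim g 0 = 0.
Proof. by rewrite /weight_prim g0 oppr0 subrr. Qed.

(** The derivative of [weight_prim g], twice the hyperbolic sine of g, is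
    l times the weight, so an integration divides the bound by l. *)
Lemma primitive_weight_le (f : R -> rV) (C : R) : 0 <= C -> continuous f ->
  (forall t, `|f t| <= C * (l t * weight g t)) ->
  forall t, `|primitive f t| <= C * weight g t.
Proof.
move=> C0 cf fC t.
have key (F df : R -> R) : F 0 = 0 -> (forall s : R, is_derive s 1 F (df s)) ->
    (forall s, `|df s| <= C * (l s * weight g s)) ->
    forall s, `|F s| <= C * `|weight_prim g s|.
  move=> F0 HF dfC s.
  have HS (e : R) (u : R) : is_derive u 1 (fun x => C * weight_prim g x + e * F x)
      (C * (l u * weight g u) + e * df u).
    by apply: is_deriveD; apply: is_deriveZ => //; apply: is_derive_weight_prim.
  have pos (e : R) u : `|e| <= 1 -> 0 <= C * (l u * weight g u) + e * df u.
    move=> e1; rewrite -[e * _]opprK subr_ge0 (le_trans _ (dfC u))//.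
    by rewrite (le_trans (ler_norm _))// normrN normrM ler_piMl.
  have one : `|1 : R| <= 1 by rewrite normr1.
  have mone : `|-1 : R| <= 1 by rewrite normrN normr1.
  have [s0|s0] := leP 0 s.
    have := derive_ge0_le s0 (fun u _ => HS 1 u) (fun u _ => pos 1 u one).
    have := derive_ge0_le s0 (fun u _ => HS (-1) u) (fun u _ => pos (-1) u mone).
    rewrite F0 weight_prim0 !mulr0 !addr0 mulN1r mul1r => A1 A2.
    have B : `|F s| <= C * weight_prim g s by rewrite ler_norml; apply/andP; split; lra.
    by rewrite (le_trans B)// ler_wpM2l// ler_norm.
  have := derive_ge0_le (ltW s0) (fun u _ => HS 1 u) (fun u _ => pos 1 u one).
  have := derive_ge0_le (ltW s0) (fun u _ => HS (-1) u) (fun u _ => pos (-1) u mone).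
  rewrite F0 weight_prim0 !mulr0 !addr0 mulN1r mul1r => A1 A2.
  have B : `|F s| <= - (C * weight_prim g s) by rewrite ler_norml; apply/andP; split; lra.
  by rewrite (le_trans B)// -mulrN ler_wpM2l// -normrN ler_norm.
have w0 : 0 <= C * weight g t by rewrite mulr_ge0// ltW// weight_gt0.
apply: row_normP => // j.
have Hj (s : R) := (is_derive_row _ _ _ _).1 (is_derive_primitive s cf) j.
have := key (fun s => primitive f s 0 j) (fun s => f s 0 j) _ Hj _ t.
rewrite primitive0// mxE => /(_ erefl).
move=> /(_ (fun s => le_trans (coord_le_norm _ _) (fC s))) H.
by rewrite (le_trans H)// ler_wpM2l// weight_prim_le.
Qed.

End Primitive.

(** * Second-order differential equations *)

Section FixedPoint.
Context {R : realType} {n : nat}.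
Local Notation rV := 'rV[R]_n.

Lemma half_power_small (C e : R) : 0 < e -> exists k : nat, C / 2 ^+ k < e.
Proof.
move=> e0; exists (Num.truncn `|C / e|); set k := Num.truncn _.
have kC : `|C / e| < k.+1%:R by exact: truncnS_gt.
have k2 : (k.+1)%:R <= 2 ^+ k :> R by rewrite -natrX ler_nat ltn_expl.
rewrite ltr_pdivrMr ?exprn_gt0// mulrC -ltr_pdivrMr//.
by rewrite (le_lt_trans (ler_norm _))// (lt_le_trans kC).
Qed.

Variables (om : R -> R) (Phi : (R -> rV) -> R -> rV) (C0 : R).
Hypothesis om_gt0 : forall t, 0 < om t.
Hypothesis om_cont : continuous om.
Hypothesis Phi_cont : forall v, continuous v -> continuous (Phi v).
Hypothesis Phi_contr : forall (u v : R -> rV) C, continuous u -> continuous v ->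
  0 <= C -> (forall t, `|u t - v t| <= C * om t) ->
  forall t, `|Phi u t - Phi v t| <= C / 2 * om t.
Hypothesis C0_ge0 : 0 <= C0.
Hypothesis Phi0_le : forall t, `|Phi (fun=> 0) t| <= C0 * om t.

Let U k := iter k Phi (fun=> 0).

Let Uc k : continuous (U k).
Proof. by elim: k => [|k IH]; [exact: cst_continuous|exact: Phi_cont]. Qed.

Let Ustep k t : `|U k.+1 t - U k t| <= C0 / 2 ^+ k * om t.
Proof.
elim: k t => [|k IH] t; first by rewrite /U /= subr0 expr0 divr1.
have := Phi_contr (@Uc k.+1) (@Uc k) _ IH t.
rewrite divr_ge0 ?exprn_ge0// => /(_ isT).
by rewrite exprSr invfM mulrA.
Qed.

Let Udist k m t : `|U (k + m)%N t - U k t| <= 2 * C0 / 2 ^+ k * om t.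
Proof.
suff : `|U (k + m)%N t - U k t| <= (2 * C0 / 2 ^+ k - 2 * C0 / 2 ^+ (k + m)) * om t.
  move=> /le_trans; apply; rewrite ler_wpM2r ?(ltW (om_gt0 t))//.
  by rewrite lerBlDr lerDl divr_ge0 ?exprn_ge0// mulr_ge0.
elim: m => [|m IH]; first by rewrite addn0 !subrr normr0 mul0r.
rewrite addnS -(subrKA (U (k + m)%N t)) (le_trans (ler_normD _ _))//.
rewrite (le_trans (lerD (Ustep _ _) IH))// -mulrDl ler_wpM2r ?(ltW (om_gt0 t))//.
rewrite addrCA lerD2l exprSr invfM.
set a := (2 ^+ (k + m))^-1; lra.
Qed.

Let Ulim t : exists l : rV, forall k, `|l - U k t| <= 2 * C0 / 2 ^+ k * om t.
Proof.
have cv : cvg ((fun k => U k t) @ \oo).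
  apply: cauchy_cvg; apply/cauchy_exP => _/posnumP[e].
  have [k ke] := half_power_small (2 * C0 * om t) (gt0 e).
  exists (U k t); exists k => // m /= km.
  rewrite -ball_normE /= distrC -(subnKC km) (le_lt_trans (Udist _ _ _))//.
  by rewrite mulrAC.
exists (lim ((fun k => U k t) @ \oo)) => k; apply/ler_addgt0Pl => e e0.
move/cvgrPdist_le : cv => /(_ e e0) [m _ mP].
have := mP (k + m)%N; rewrite /= leq_addl => /(_ isT) H.
rewrite -(subrKA (U (k + m)%N t)) (le_trans (ler_normD _ _))// lerD//.
Qed.

(** Picard iteration from 0. The norm sup |u| / om, infinite for some continuous
    u, is expressed through the bounds C that it admits; as om is continuous,
    convergence is locally uniform and the limit is continuous. *)
Lemma weighted_fixpoint : exists u, continuous u /\ forall t, Phi u t = u t.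
Proof.
have [u uP] := choice Ulim; exists u.
have uc : continuous u.
  move=> t; apply/cvgrPdist_le => e e0.
  have e3 : 0 < e / 3 by rewrite divr_gt0.
  have [k kP] := half_power_small (2 * C0 * (om t + 1)) e3.
  near=> s.
  have oms : om s <= om t + 1.
    near: s; have /cvgrPdist_le/(_ 1 ltr01) := @om_cont t.
    apply: filterS => s; rewrite ler_norml => /andP[H _]; lra.
  have Us : `|U k t - U k s| <= e / 3.
    by near: s; move/cvgrPdist_le: (@Uc k t); exact.
  have bnd (x : R) : om x <= om t + 1 -> `|u x - U k x| <= e / 3.
    move=> ox; rewrite (le_trans (uP _ _))// (le_trans _ (ltW kP))// mulrAC.
    by rewrite ler_wpM2r ?invr_ge0 ?exprn_ge0// ler_wpM2l// mulr_ge0.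
  have B1 := bnd t (ler_wpDr ler01 (lexx _)); have B2 := bnd s oms.
  have -> : u t - u s = (u t - U k t) + (U k t - U k s) + (U k s - u s).
    by rewrite subrKA addrA subrK.
  rewrite (le_trans (ler_normD _ _))// (le_trans (lerD (ler_normD _ _) (lexx _)))//.
  by move: B1 B2 Us; rewrite (distrC (u s)) => B1 B2 Us; lra.
split => // t; apply/eqP; rewrite -subr_eq0 -normr_eq0; apply/eqP/le_anti.
rewrite normr_ge0 andbT; apply/ler_addgt0Pl => e e0; rewrite addr0.
have [k kP] := half_power_small (4 * C0 * om t) e0.
have D0 : 0 <= 2 * C0 / 2 ^+ k by rewrite divr_ge0 ?exprn_ge0// mulr_ge0.
have H1 := Phi_contr uc (@Uc k) D0 (fun t => uP t k) t.
have H2 := uP t k.+1.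
rewrite -(subrKA (U k.+1 t)) (le_trans (ler_normD _ _))//.
rewrite (distrC (U k.+1 t)) (le_trans (lerD H1 H2))//.
rewrite -mulrDl (le_trans _ (ltW kP))// [leRHS]mulrAC.
rewrite ler_wpM2r ?(ltW (om_gt0 t))// exprSr invfM.
set a := (2 ^+ k)^-1.
have a0 : 0 <= a by rewrite invr_ge0 exprn_ge0.
have Ca : 0 <= C0 * a by rewrite mulr_ge0.
rewrite -!mulrA; lra.
Unshelve. all: by end_near. Qed.

End FixedPoint.

Section SecondOrder.
Context {R : realType} {n : nat}.
Local Notation rV := 'rV[R]_n.

Lemma primitiveB (f g : R -> rV) : continuous f -> continuous g ->
  primitive (fun t => f t - g t) = (fun t => primitive f t - primitive g t).
Proof.
move=> cf cg.
have cfg : continuous (fun t => f t - g t).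
  by move=> t; apply: continuousB; [exact: cf|exact: cg].
apply: (primitive_unique (g := fun t => f t - g t)).
- by move=> t; exact: is_derive_primitive.
- by move=> t; apply: is_deriveB; exact: is_derive_primitive.
- by rewrite !primitive0// subrr.
Qed.

Variables (H : R -> rV -> rV -> rV) (K : R -> R) (B : R) (x0 : rV).
Hypothesis H_cont : forall x v : R -> rV, continuous x -> continuous v ->
  continuous (fun s => H s (x s) (v s)).
Hypothesis H_lip : forall s x v x' v',
  `|H s x v - H s x' v'| <= K s * (`|x - x'| + `|v - v'|).
Hypothesis H_bnd : forall s, `|H s x0 0| <= B * (1 + K s).
Hypotheses (K_ge0 : forall s, 0 <= K s) (B_ge0 : 0 <= B).

(** The velocity v is the unknown of the fixed point problem. *)
Definition ode_position (v : R -> rV) (t : R) : rV := x0 + primitive v t.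
Definition ode_force (v : R -> rV) (s : R) : rV := H s (ode_position v s) (v s).

Lemma ode_position_cont v : continuous v -> continuous (ode_position v).
Proof.
by move=> cv t; apply: continuousD; [exact: cst_continuous|exact: primitive_continuous].
Qed.

Lemma ode_force_cont v : continuous v -> continuous (ode_force v).
Proof. by move=> cv; apply: H_cont => //; exact: ode_position_cont. Qed.

Section Weighted.
Variables g l : R -> R.
Hypotheses (g0 : g 0 = 0) (dg : forall t : R, is_derive t 1 g (l t)).
Hypothesis l_ge1 : forall t, 1 <= l t.
Hypothesis l_geK : forall t, 8 * K t <= l t.

Let l_gt0 t : 0 < l t. Proof. exact: lt_le_trans (l_ge1 t). Qed.

Let weight_le_deriv (C : R) t : 0 <= C -> C * weight g t <= C * (l t * weight g t).
Proof.
by move=> C0; rewrite ler_wpM2l// ler_peMl// ltW// weight_gt0.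
Qed.

Lemma ode_force_lip (C : R) u v : 0 <= C -> continuous u -> continuous v ->
  (forall t, `|u t - v t| <= C * weight g t) ->
  forall t, `|ode_force u t - ode_force v t| <= 2 * K t * C * weight g t.
Proof.
move=> C0 cu cv uv t.
have cuv : continuous (fun t => u t - v t).
  by move=> s; apply: continuousB; [exact: cu|exact: cv].
have Hx : `|ode_position u t - ode_position v t| <= C * weight g t.
  rewrite /ode_position opprD addrACA subrr add0r.
  have := primitive_weight_le g0 dg C0 cuv
    (fun t => le_trans (uv t) (weight_le_deriv t C0)) t.
  by rewrite primitiveB.
rewrite (le_trans (H_lip _ _ _ _ _))//.
rewrite (_ : 2 * K t * C * weight g t = K t * (C * weight g t + C * weight g t)); last by ring.
by rewrite ler_wpM2l// lerD.
Qed.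

(** A solution of x'' = H (t, x, x'), x (0) = x0, whose initial velocity is a
    prescribed functional c of its whole velocity. For constant c this is the
    initial value problem; other choices of c allow a condition at a later time
    instead. *)
Lemma ode_functional (c : (R -> rV) -> rV) :
  (forall u v C, continuous u -> continuous v -> 0 <= C ->
    (forall t, `|u t - v t| <= C * weight g t) -> `|c u - c v| <= C / 2) ->
  exists v, [/\ continuous v,
    forall t, v t = c v + primitive (ode_force v) t &
    forall t : R, is_derive t 1 v (ode_force v t)].
Proof.
move=> c_lip.
pose Phi v t := c v + primitive (ode_force v) t.
have PhiC v : continuous v -> continuous (Phi v).
  move=> cv t; apply: continuousD; first exact: cst_continuous.
  by apply: primitive_continuous; exact: ode_force_cont.
have contr u v C : continuous u -> continuous v -> 0 <= C ->
    (forall t, `|u t - v t| <= C * weight g t) ->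
    forall t, `|Phi u t - Phi v t| <= C / 2 * weight g t.
  move=> cu cv C_ge0 uv t.
  have cF : continuous (fun t => ode_force u t - ode_force v t).
    by move=> s; apply: continuousB; exact: ode_force_cont.
  have C40 : 0 <= C / 4 by rewrite divr_ge0.
  have A1 s : `|ode_force u s - ode_force v s| <= C / 4 * (l s * weight g s).
    rewrite (le_trans (ode_force_lip C_ge0 cu cv uv s))// mulrA.
    rewrite ler_wpM2r ?(ltW (weight_gt0 g s))//.
    by rewrite (_ : 2 * K s * C = C / 4 * (8 * K s)); [rewrite ler_wpM2l|field].
  have A2 := primitive_weight_le g0 dg C40 cF A1 t.
  rewrite primitiveB in A2; [|exact: ode_force_cont..].
  have H2 := c_lip u v C cu cv C_ge0 uv.
  have w2 := weight_ge2 g t.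
  rewrite /Phi opprD addrACA (le_trans (ler_normD _ _))// (le_trans (lerD H2 A2))//.
  (* The weight is at least 2, so the bound C / 2 from c and the bound C / 4
     times the weight from the integral add up to at most C / 2 times the
     weight. *)
  have A3 : C / 4 * 2 <= C / 4 * weight g t by rewrite ler_wpM2l// divr_ge0.
  move: A3; set w := weight g t; move=> A3; lra.
have c0 : continuous (fun _ : R => 0 : rV) by move=> ?; exact: cst_continuous.
have prim0 : primitive (fun _ : R => 0 : rV) = (fun _ : R => 0 : rV).
  apply: (primitive_unique (g := fun=> 0)).
  - by move=> t; exact: is_derive_primitive.
  - exact: primitive0.
have Phi0 t : `|Phi (fun=> 0) t| <= (`|c (fun=> 0)| + B * 2) * weight g t.
  have w2 := weight_ge2 g t.
  rewrite /Phi mulrDl (le_trans (ler_normD _ _))// lerD//.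
    by rewrite ler_peMr// (le_trans _ w2)// ler1n.
  have B20 : 0 <= B * 2 by rewrite mulr_ge0.
  apply: (primitive_weight_le g0 dg B20 (ode_force_cont c0)) => s.
  rewrite /ode_force /ode_position prim0 addr0 (le_trans (H_bnd s))// -mulrA.
  rewrite ler_wpM2l//.
  have w1 : l s * 2 <= l s * weight g s by rewrite ler_wpM2l ?weight_ge2// ltW.
  have := l_geK s; have := l_ge1 s; have := K_ge0 s; lra.
have C00 : 0 <= `|c (fun=> 0)| + B * 2 by rewrite addr_ge0// mulr_ge0.
have [v [cv vP]] := weighted_fixpoint (weight_gt0 g) (weight_continuous dg)
  PhiC contr C00 Phi0.
exists v; split => // t; first by rewrite -vP.
have D : is_derive t 1 (fun s => c v + primitive (ode_force v) s) (0 + ode_force v t).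
  exact: (is_deriveD (is_derive_cst (c v) t (1 : R))
    (is_derive_primitive t (ode_force_cont cv))).
rewrite add0r in D; apply: (near_eq_is_derive _ D); near=> s.
exact: vP.
Unshelve. all: by end_near. Qed.

Lemma is_derive_scalel (w : rV) (t : R) : is_derive t 1 (fun s : R => s *: w) w.
Proof.
apply/is_derive_row => i.
have : is_derive t 1 (fun s : R => w 0 i * s) (w 0 i *: 1 : R).
  by apply: is_deriveZ; exact: is_derive_id.
rewrite -[w 0 i *: 1]/(w 0 i * 1) mulr1.
by under [X in _ -> is_derive _ _ X _]eq_fun do rewrite mxE mulrC.
Qed.

End Weighted.

Lemma is_derive_ode_position v (t : R) : continuous v ->
  is_derive t 1 (ode_position v) (v t).
Proof.
move=> cv; rewrite -[X in is_derive _ _ _ X]add0r.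
exact: (is_deriveD (is_derive_cst x0 t (1 : R)) (is_derive_primitive t cv)).
Qed.

(** A Lipschitz constant that grows with time is absorbed by the weight, whose
    exponent has derivative 1 + 8 K. *)
Lemma ode_ivp (v0 : rV) : continuous K -> exists x v : R -> rV,
  [/\ x 0 = x0, v 0 = v0, forall t : R, is_derive t 1 x (v t) &
      forall t : R, is_derive t 1 v (H t (x t) (v t))].
Proof.
move=> cK; pose l t := 1 + 8 * K t.
have cl : continuous l.
  by move=> t; apply: cvgD; [exact: cvg_cst|apply: cvgM; [exact: cvg_cst|exact: cK]].
have [g [g0 dg]] := primitive_exists cl.
have [|||v [cv vE dv]] := @ode_functional g l g0 dg _ _ (fun=> v0).
- by move=> t; rewrite /l lerDl mulr_ge0.
- by move=> t; rewrite /l lerDr.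
- by move=> u v C _ _ C0 _; rewrite subrr normr0 divr_ge0.
exists (ode_position v), v; split => //.
- by rewrite /ode_position primitive0// addr0.
- by rewrite vE primitive0 ?addr0//; exact: ode_force_cont.
- by move=> t; exact: is_derive_ode_position.
Qed.

(** Integrating twice, x (1 / l) = x0 + c / l plus a double integral of the
    force; c is chosen to make this x1. The double integral is taken over a time
    1 / l, hence depends little on v when l is large. *)
Lemma ode_bvp (x1 : rV) (k l : R) : (forall t, K t = k) -> 1 <= l -> 8 * k <= l ->
  4 * k * weight id (1 : R) <= l -> exists x v : R -> rV,
  [/\ x 0 = x0, x l^-1 = x1, forall t : R, is_derive t 1 x (v t) &
      forall t : R, is_derive t 1 v (H t (x t) (v t))].
Proof.
move=> Kk l1 Kl KMl; have l0 : 0 < l by exact: lt_le_trans l1.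
have l00 : l != 0 by rewrite gt_eqF.
have k0 : 0 <= k by rewrite -(Kk 0).
pose g t := l * t.
have g0 : g 0 = 0 by rewrite /g mulr0.
have dg (t : R) : is_derive t 1 g l.
  have : is_derive t 1 g (l *: 1 : R) by apply: is_deriveZ; exact: is_derive_id.
  by rewrite -[l *: 1]/(l * 1) mulr1.
pose PP v := primitive (primitive (ode_force v)) l^-1.
pose c v := l *: (x1 - x0 - PP v).
have cP v : continuous v -> continuous (primitive (ode_force v)).
  by move=> cv; apply: primitive_continuous; exact: ode_force_cont.
have [|||v [cv vE dv]] := @ode_functional g (fun=> l) g0 dg _ _ c.
- by [].
- by move=> t; rewrite Kk.
- move=> u v C cu cv C0 uv.
  have cF : continuous (fun t => ode_force u t - ode_force v t).
    by move=> s; apply: continuousB; exact: ode_force_cont.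
  have KC0 : 0 <= 2 * k * C / l by rewrite divr_ge0 ?(ltW l0)// !mulr_ge0.
  have KC0' : 0 <= 2 * k * C / l / l by rewrite divr_ge0// ltW.
  have F1 s : `|ode_force u s - ode_force v s| <= 2 * k * C / l * (l * weight g s).
    rewrite [leRHS]mulrA divfK// -(Kk s).
    by apply: (@ode_force_lip g (fun=> l)).
  have H1 := primitive_weight_le g0 dg KC0 cF F1.
  rewrite primitiveB in H1; [|exact: ode_force_cont..].
  have cPB : continuous (fun t => primitive (ode_force u) t - primitive (ode_force v) t).
    by move=> s; apply: continuousB; exact: cP.
  have H2' s : `|primitive (ode_force u) s - primitive (ode_force v) s| <=
      2 * k * C / l / l * (l * weight g s).
    by rewrite [leRHS]mulrA divfK.
  have := primitive_weight_le g0 dg KC0' cPB H2' l^-1.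
  rewrite primitiveB; [|exact: cP..].
  (* The exponent l t is 1 at time 1 / l, so the weight at that time does not
     depend on l. *)
  have -> : weight g l^-1 = weight id (1 : R) by rewrite /weight /g mulfV.
  set M := weight id 1 in KMl * => H2.
  rewrite /c -scalerBr opprB addrCA addrAC subrr add0r normrZ gtr0_norm//.
  rewrite distrC mulrC -ler_pdivlMr// (le_trans H2)//.
  rewrite (_ : 2 * k * C / l / l * M = C / 2 * (4 * k * M / l) / l); last by field.
  rewrite ler_wpM2r ?invr_ge0 ?(ltW l0)// ler_piMr ?divr_ge0//.
  by rewrite ler_pdivrMr// mul1r.
exists (ode_position v), v; split => //.
- by rewrite /ode_position primitive0// addr0.
- rewrite /ode_position.
  have -> : primitive v = (fun t => t *: c v + primitive (primitive (ode_force v)) t).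
    apply: (primitive_unique (g := v)).
    + by move=> t; exact: is_derive_primitive.
    + move=> t; rewrite vE.
      exact: (is_deriveD (is_derive_scalel _ _) (is_derive_primitive t (cP v cv))).
    + by rewrite !primitive0// ?scale0r ?addr0//; exact: cP.
  by rewrite scalerA mulVf// scale1r -/(PP v) subrK addrC subrK.
- by move=> t; exact: is_derive_ode_position.
Qed.

End SecondOrder.

(** * Short geodesics with a prescribed end *)

Section MeanValue.
Context {R : realType} {n : nat}.
Local Notation rV := 'rV[R]_n.

Lemma derive_bounded_lip (f df : R -> rV) (B : R) : 0 <= B ->
  (forall t : R, is_derive t 1 f (df t)) -> (forall t, `|df t| <= B) ->
  forall s t, `|f t - f s| <= B * `|t - s|.
Proof.
move=> B0 Hf dfB s t; apply: row_normP => [|j]; first by rewrite mulr_ge0.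
have Hj (u : R) := (is_derive_row _ _ _ _).1 (Hf u) j.
have dj (c : R) : `|c| <= `|t - s| -> derivable (fun y => f y 0 j) (s + c *: 1) 1.
  by move=> _; case: (Hj (s + c *: 1)).
have st : s + (t - s) *: 1 = t by rewrite -[_ *: 1]/((t - s) * 1) mulr1 addrC subrK.
have [c _] := line_MVT dj; rewrite st !mxE => ->.
have [_ ->] := Hj (s + c *: 1).
by rewrite normrM mulrC ler_wpM2r// (le_trans (coord_le_norm _ _)).
Qed.

(** Each coordinate of v equals the mean velocity at some time in [0, T], and
    such a time is within 3 T of t. *)
Lemma mean_velocity (x v : R -> rV) (T B : R) : 0 < T -> 0 <= B ->
  (forall t : R, is_derive t 1 x (v t)) ->
  (forall s t, `|v t - v s| <= B * `|t - s|) ->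
  forall t, `|t| <= 2 * T -> `|v t - T^-1 *: (x T - x 0)| <= 3 * B * T.
Proof.
move=> T0 B0 Hx v_lip t; rewrite ler_norml => /andP[Tt tT].
apply: row_normP => [|j]; first by rewrite !mulr_ge0// ltW.
have Hj (u : R) := (is_derive_row _ _ _ _).1 (Hx u) j.
have cj : {within `[0, T], continuous (fun y => x y 0 j)}.
  by apply: derivable_within_continuous => u _; case: (Hj u).
have [c /[!in_itv]/= /andP[c0 cT] E] := MVT T0 (fun u _ => Hj u) cj.
rewrite !mxE E subr0 mulrC mulfK ?gt_eqF//.
have := le_trans (coord_le_norm (v t - v c) j) (v_lip c t); rewrite !mxE => /le_trans; apply.
rewrite (_ : 3 * B * T = B * (3 * T)); last by ring.
by rewrite ler_wpM2l// ler_norml; apply/andP; split; lra.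
Qed.

End MeanValue.

Section Lipschitz.
Context {R : realType} {V : normedModType R} (B : coords V).

Lemma C1_lipschitz (U : set V) (f : V -> R) x : open U -> Ck_on U 1 f -> U x ->
  exists r K : R, [/\ 0 < r, 0 <= K, forall y, `|y - x| <= r -> U y &
    forall y z, `|y - x| <= r -> `|z - x| <= r -> `|f y - f z| <= K * `|y - z|].
Proof.
move=> oU Cf Ux.
pose N := coord_num B; pose e i := coord_vec B i.
pose m := \sum_(i < N) (`|'D_(e i) f x| + 1).
have [d d0 Hd] : exists2 d : R, 0 < d & forall y, `|y - x| < d -> U y /\
    forall i : 'I_N, `|'D_(e i) f y| <= `|'D_(e i) f x| + 1.
  have : \forall y \near x, U y /\
      forall i : 'I_N, `|'D_(e i) f y| <= `|'D_(e i) f x| + 1.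
    apply: filterI; first exact: open_nbhs_nbhs.
    apply: filter_forall => i.
    have := Ck_on_continuous (Ck_on_D (e i) Cf) Ux.
    move=> /cvgrPdist_le/(_ 1 ltr01); apply: filterS => y H.
    rewrite -lerBlDl (le_trans _ H)// distrC.
    exact: lerB_dist.
  move=> /nbhs_ballP[d /= d0 H]; exists d => // y yd; apply: H.
  by rewrite -ball_normE /= distrC.
exists (d / 4), m; split.
- by rewrite divr_gt0.
- by rewrite sumr_ge0// => i _; rewrite addr_ge0.
- by move=> y yr; apply: (Hd y _).1; rewrite (le_lt_trans yr)// ltr_pdivrMr// ltr_pMr// ltr1n.
move=> y z yr zr.
have near_x (c : R) : `|c| <= `|1 : R| -> `|z + c *: (y - z) - x| < d.
  rewrite normr1 => c1; rewrite addrAC (le_lt_trans (ler_normD _ _))//.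
  have yz : `|y - z| <= d / 2.
    rewrite -(subrKA x) (le_trans (ler_normD _ _))// (distrC x).
    by rewrite (le_trans (lerD yr zr))//; lra.
  have : `|c *: (y - z)| <= d / 2.
    by rewrite normrZ (le_trans _ yz)// ler_piMl.
  by move=> H; rewrite (le_lt_trans (lerD zr H))//; lra.
have [c c1 E] := @line_MVT _ _ f z (y - z) 1
  (fun c hc => Ck_on_derivable (y - z) Cf (Hd _ (near_x c hc)).1).
rewrite scale1r [z + _]addrC subrK mul1r in E; rewrite E.
have [Uc bc] := Hd _ (near_x c c1).
rewrite (derive_coordsE B _ (Ck_differentiable B oU Cf Uc)).
rewrite (le_trans (ler_norm_sum _ _ _))// /m mulr_suml; apply: ler_sum => i _.
by rewrite normrM mulrC ler_pM// coord_fun_le.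
Qed.

End Lipschitz.

Section Clamp.
Context {R : realType} {n : nat}.
Local Notation rV := 'rV[R]_n.

(** The projection to the ball of radius r around c, for the maximum norm of the
    coordinates. *)
Definition clamp (r : R) (c x : rV) : rV :=
  \row_i (c 0 i + Num.max (- r) (Num.min r (x 0 i - c 0 i))).

Lemma clamp_in r c x : 0 <= r -> `|clamp r c x - c| <= r.
Proof.
move=> r0; apply: row_normP => // j; rewrite !mxE addrAC subrr add0r ler_norml.
by rewrite le_max lexx /= ge_max ge_min lexx andbT (le_trans _ r0)// oppr_le0.
Qed.

Lemma clamp_id r c x : `|x - c| <= r -> clamp r c x = x.
Proof.
move=> xr; apply/rowP => j; rewrite mxE.
have := le_trans (coord_le_norm (x - c) j) xr; rewrite !mxE ler_norml => /andP[a b].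
by rewrite (min_idPr b) (max_idPr a) addrCA subrr addr0.
Qed.

Lemma clamp_lip r c x y : `|clamp r c x - clamp r c y| <= `|x - y|.
Proof.
apply: row_normP => // j; rewrite !mxE opprD addrACA subrr add0r.
have := coord_le_norm (x - y) j; rewrite !mxE; apply: le_trans.
move: (x 0 j) (y 0 j) (c 0 j) => a b d.
have h1 := ler_norm (a - b).
have h2 : b - a <= `|a - b| by rewrite distrC; exact: ler_norm.
rewrite ler_norml !minEle.
case: (boolP (r <= a - d)); rewrite -?ltNge => ?;
  case: (boolP (r <= b - d)); rewrite -?ltNge => ?; rewrite !maxEle;
  (do ?(case: ifPn; rewrite -?ltNge => ?)); apply/andP; split; lra.
Qed.

End Clamp.

Section LocalGeodesics.
Context {R : realType} {n : nat}.
Local Notation rV := 'rV[R]_n.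
Local Notation Z := ('rV[R]_n * 'rV[R]_n)%type.
Variables (O : set rV) (L : Z -> R).
Hypothesis HL : local_finsler O L.
Hypothesis L_ge0 : forall z, slit O z -> 0 <= L z.
Local Notation G := (spray_vec L).

Lemma spray_lipschitz z : slit O z ->
  exists r K : R, [/\ 0 < r, 0 <= K, forall y, `|y - z| <= r -> slit O y &
    forall p q, `|p - z| <= r -> `|q - z| <= r -> `|G p - G q| <= K * `|p - q|].
Proof.
move=> Oz; have oU := slit_open (lf_open HL).
have /choice [r Hr] : forall i : 'I_n, exists r : R * R,
  [/\ 0 < r.1, 0 <= r.2, forall y, `|y - z| <= r.1 -> slit O y &
    forall p q, `|p - z| <= r.1 -> `|q - z| <= r.1 ->
      `|spray L i p - spray L i q| <= r.2 * `|p - q|].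
  move=> i; have [r [K HrK]] := C1_lipschitz phase_coords oU (spray_Ck HL 1 i) Oz.
  by exists (r, K).
have [d d0 Hd] := open_normP oU Oz.
pose r0 := \big[Num.min/d / 2]_i (r i).1; pose K0 := \sum_i (r i).2.
exists r0, K0; split.
- rewrite /r0; elim/big_ind: _ => [|x y x0 y0|i _]; first by rewrite divr_gt0.
    by rewrite lt_min x0.
  by have [] := Hr i.
- by rewrite sumr_ge0// => i _; have [] := Hr i.
- move=> y yr; apply: Hd; rewrite (le_lt_trans yr)// (@le_lt_trans _ _ (d / 2))//.
    exact: bigmin_le_id.
  by rewrite ltr_pdivrMr// ltr_pMr// ltr1n.
move=> p q pr qr; apply: row_normP; first by rewrite mulr_ge0// sumr_ge0// => i _; have [] := Hr i.
move=> i; have [_ _ _ H] := Hr i; rewrite !mxE.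
have ri : r0 <= (r i).1 by exact: bigmin_le_cond.
rewrite (le_trans (H _ _ (le_trans pr ri) (le_trans qr ri)))// ler_wpM2r//.
rewrite /K0 (bigD1 i)//= lerDl sumr_ge0// => j _.
by have [] := Hr j.
Qed.

(** Outside a box around (x0, w) the spray is replaced by its value at the
    clamped point, and becomes bounded and globally Lipschitz, as [ode_bvp]
    demands. For T small the solution does not leave the box: its velocity is
    close to its mean velocity, which is w up to (x0 - p) / T. *)
Lemma local_bvp (x0 w : rV) : O x0 -> w != 0 ->
  exists rho T : R, [/\ 0 < rho, 0 < T & forall p, `|p - x0| < rho ->
    exists x v : R -> rV, [/\ x 0 = p, x T = x0 + T *: w &
      forall t : R, t \in `]- T, 2 * T[ ->
        [/\ slit O (x t, v t), is_derive t 1 x (v t) &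
            is_derive t 1 v (- G (x t, v t))]]].
Proof.
move=> Ox0 w0.
have Oz : slit O (x0, w) by split.
have [r [K [r0 K0 rO rK]]] := spray_lipschitz Oz.
pose cl (x v : rV) : Z := (clamp r x0 x, clamp r w v).
have cl_in x v : `|cl x v - (x0, w)| <= r.
  by apply: pair_normP => /=; apply: clamp_in; exact: ltW.
pose H (s : R) (x v : rV) : rV := - G (cl x v).
pose B := `|G (x0, w)| + K * r.
have B0 : 0 <= B by rewrite addr_ge0// mulr_ge0// ltW.
have HB s x v : `|H s x v| <= B.
  rewrite /H normrN -(subrK (G (x0, w)) (G _)) addrC (le_trans (ler_normD _ _))//.
  rewrite lerD2l (le_trans (rK _ _ (cl_in x v) _)) ?subrr ?normr0 ?(ltW r0)//.
  by rewrite ler_wpM2l.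
have H_lip s x v x' v' : `|H s x v - H s x' v'| <= K * (`|x - x'| + `|v - v'|).
  rewrite /H -opprD normrN (le_trans (rK _ _ (cl_in x v) (cl_in x' v')))//.
  rewrite ler_wpM2l//; apply: pair_normP => /=.
    by rewrite (le_trans (clamp_lip _ _ _ _))// lerDl.
  by rewrite (le_trans (clamp_lip _ _ _ _))// lerDr.
have H_cont (x v : R -> rV) : continuous x -> continuous v ->
    continuous (fun s => H s (x s) (v s)).
  move=> cx cv t; apply/cvgrPdist_le => e e0.
  have K1 : 0 < 2 * (K + 1) by rewrite mulr_gt0// ltr_wpDl.
  have eK : 0 < e / (2 * (K + 1)) by rewrite divr_gt0.
  near=> s.
  have xs : `|x t - x s| <= e / (2 * (K + 1)).
    by near: s; move/cvgrPdist_le: (cx t); exact.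
  have vs : `|v t - v s| <= e / (2 * (K + 1)).
    by near: s; move/cvgrPdist_le: (cv t); exact.
  have Hs : `|H t (x t) (v t) - H s (x s) (v s)| <= K * (`|x t - x s| + `|v t - v s|).
    exact: H_lip.
  rewrite (le_trans Hs)// (le_trans (ler_wpM2l K0 (lerD xs vs)))//.
  rewrite (_ : K * (e / (2 * (K + 1)) + e / (2 * (K + 1))) = e * (K / (K + 1))); last by field; rewrite gt_eqF// ltr_wpDl.
  by rewrite ler_piMr ?(ltW e0)// ler_pdivrMr ?mul1r ?lerDl// ltr_wpDl.
have HB' x s : `|H s x 0| <= B * (1 + K).
  by rewrite (le_trans (HB s x 0))// ler_peMr// lerDl.
pose M := weight id (1 : R).
have M0 : 0 <= M by rewrite ltW// weight_gt0.
(* The first three terms are for the conditions of [ode_bvp]; the fourth keeps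
   the velocity, and the fifth the position, in the box. *)
pose l := 1 + 8 * K + 4 * K * M + 6 * B / r + 4 * (`|w| + r) / r.
have a1 : 0 <= 8 * K by rewrite mulr_ge0.
have a2 : 0 <= 4 * K * M by rewrite !mulr_ge0.
have a3 : 0 <= 6 * B / r by rewrite divr_ge0 ?mulr_ge0// ltW.
have a4 : 0 <= 4 * (`|w| + r) / r by rewrite divr_ge0 ?mulr_ge0 ?addr_ge0// ltW.
have l1 : 1 <= l by rewrite /l; lra.
have l0 : 0 < l by exact: lt_le_trans l1.
have T0 : 0 < l^-1 by rewrite invr_gt0.
have T1 : l^-1 <= 1 by rewrite invf_le1.
have half (c : R) : 2 * c / r <= l -> c * l^-1 <= r / 2.
  rewrite !ler_pdivrMr// => h.
  by move: h; set q := l * r; rewrite (_ : r / 2 * l = q / 2) /q; [lra|ring].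
have TB : 3 * B * l^-1 <= r / 2.
  by apply: half; rewrite (_ : 2 * (3 * B) = 6 * B); [rewrite /l; lra|ring].
have Tw : 2 * (`|w| + r) * l^-1 <= r / 2.
  apply: half; rewrite (_ : 2 * (2 * (`|w| + r)) = 4 * (`|w| + r)); last by ring.
  by rewrite /l; lra.
exists (l^-1 * (r / 2)), l^-1; split => //; first by rewrite mulr_gt0// divr_gt0.
move=> p px.
have [||x [v [x_0 x_T Hx Hv]]] := @ode_bvp R n H (fun=> K) B p H_cont H_lip (HB' p)
  (fun=> K0) B0 (x0 + l^-1 *: w) K l (fun=> erefl) l1.
- by rewrite /l; lra.
- by rewrite /l -/M; lra.
exists x, v; split; [exact: x_0|exact: x_T|].
move=> t; rewrite in_itv /= => /andP[Tt tT].
have vlip := derive_bounded_lip B0 Hv (fun t => HB t (x t) (v t)).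
have vm := mean_velocity T0 B0 Hx vlip.
have Em : l^-1^-1 *: (x l^-1 - x 0) - w = l *: (x0 - p).
  rewrite x_0 x_T invrK addrAC scalerDr scalerA mulfV ?gt_eqF// scale1r addrK.
  by [].
have vw s : `|s| <= 2 * l^-1 -> `|v s - w| <= r.
  move=> sT; rewrite -(subrKA (l^-1^-1 *: (x l^-1 - x 0))) Em.
  rewrite (le_trans (ler_normD _ _))// (le_trans (lerD (vm s sT) (lexx _)))//.
  rewrite normrZ gtr0_norm// distrC.
  have : l * `|p - x0| <= r / 2.
    by rewrite mulrC -ler_pdivlMr// mulrC ltW.
  lra.
have tT2 : `|t| <= 2 * l^-1.
  rewrite ler_norml (ltW tT) andbT (le_trans _ (ltW Tt))// lerN2.
  by rewrite ler_peMl ?(ltW T0)// ler1n.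
have xt : `|x t - x0| <= r.
  rewrite -(subrKA p) (le_trans (ler_normD _ _))//.
  have p2 : `|p - x0| <= r / 2 by rewrite (le_trans (ltW px))// ler_piMl// divr_ge0// ltW.
  suff : `|x t - p| <= r / 2 by lra.
  rewrite (le_trans _ Tw)//; apply: row_normP => [|j].
    by rewrite !mulr_ge0 ?addr_ge0 ?(ltW r0) ?(ltW T0).
  have Hj (u : R) := (is_derive_row _ _ _ _).1 (Hx u) j.
  have dj (c : R) : `|c| <= `|t| -> derivable (fun y => x y 0 j) (0 + c *: 1) 1.
    by move=> _; case: (Hj (0 + c *: 1)).
  have tt : 0 + t *: 1 = t by rewrite -[_ *: 1]/(t * 1) mulr1 add0r.
  have [c ct] := line_MVT dj; rewrite tt x_0 !mxE => ->.
  have [_ ->] := Hj (0 + c *: 1).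
  have cc : 0 + c *: 1 = c by rewrite -[_ *: 1]/(c * 1) mulr1 add0r.
  rewrite cc normrM mulrAC ler_pM//.
  rewrite (le_trans (coord_le_norm _ _))//.
  have := vw c (le_trans ct tT2); rewrite -{2}(subrK w (v c)) => H1.
  by rewrite (le_trans (ler_normD _ _))// addrC lerD2l.
have vt : `|v t - w| <= r by exact: vw.
have clE : cl (x t) (v t) = (x t, v t) by rewrite /cl !clamp_id.
split; [by apply: rO; exact: pair_normP|exact: Hx|].
by have := Hv t; rewrite /H clE.
Unshelve. all: by end_near. Qed.

Lemma finsler_constant (a b : R) (x v : R -> rV) :
  (forall t : R, t \in `]a, b[ -> [/\ slit O (x t, v t), is_derive t 1 x (v t) &
            is_derive t 1 v (- G (x t, v t))]) ->
  forall s t, s \in `]a, b[ -> t \in `]a, b[ -> L (x s, v s) = L (x t, v t).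
Proof.
move=> H s t sab tab.
have dE (u : R) : u \in `]a, b[ -> is_derive u 1 (fun u => energy L (x u, v u)) 0.
  move=> /H [Ou dx dv].
  have := is_derive_chain (is_derive_pair dx dv) (energy_diff HL Ou).
  by rewrite (energy_conserved HL Ou).
have d0 (u : R) : u \in `]a, b[ -> is_derive u 1 (fun _ : R => 0 : R) 0.
  by move=> _; exact: is_derive_cst.
have := derive_eq_cst dE d0 sab tab; rewrite !subr0 /energy => /eqP.
have [Os _ _] := H s sab; have [Ot _ _] := H t tab.
by rewrite eqrXn2 ?L_ge0// => /eqP.
Qed.

Lemma is_derive_reparam {m} (f : R -> 'rV[R]_m) (a t : R) d :
  is_derive (a * t) 1 f d -> is_derive t 1 (fun s => f (a * s)) (a *: d).
Proof.
move=> /is_derive_row Hf; apply/is_derive_row => i; rewrite mxE mulrC.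
have Ha : is_derive t 1 (fun s : R => a * s) (a *: 1 : R).
  by apply: is_deriveZ; exact: is_derive_id.
have := @is_derive1_comp R (fun y => f y 0 i) (fun s => a * s) t _ _ (Hf i) Ha.
by rewrite -[a *: 1]/(a * 1) mulr1.
Qed.

(** The solutions of [local_bvp] have constant nonzero speed; a linear change of
    time makes it 1, and solutions remain solutions because the spray is
    homogeneous of degree 2. *)
Lemma local_geodesics (x0 w : rV) : O x0 -> w != 0 ->
  exists (rho : R) (x1 : rV), 0 < rho /\ forall p, `|p - x0| < rho ->
    exists (a b T : R) (X V : R -> rV),
      [/\ 0 \in `]a, b[, T \in `]a, b[, X 0 = p, X T = x1 &
      forall s : R, s \in `]a, b[ ->
        [/\ slit O (X s, V s), is_derive s 1 X (V s),
            is_derive s 1 V (- G (X s, V s)) & L (X s, V s) = 1]].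
Proof.
move=> Ox0 w0; have [rho [T [rho0 T0 H]]] := local_bvp Ox0 w0.
exists rho, (x0 + T *: w); split => // p /H [x [v [x_0 x_T Hxv]]].
have in0 : 0 \in `]- T, 2 * T[ by rewrite in_itv /=; apply/andP; split; lra.
pose l := L (x 0, v 0).
have lE t : t \in `]- T, 2 * T[ -> L (x t, v t) = l.
  by move=> tT; exact: finsler_constant Hxv _ _ tT in0.
have l0 : 0 < l.
  have [Oz0 _ _] := Hxv 0 in0.
  by rewrite lt_neqAle L_ge0// andbT eq_sym (finsler_neq0 HL).
have l00 : l != 0 by rewrite gt_eqF.
have li0 : 0 < l^-1 by rewrite invr_gt0.
have scale s : s \in `](- T * l), (2 * T * l)[ -> l^-1 * s \in `]- T, 2 * T[.
  by rewrite !in_itv /= [l^-1 * s]mulrC ltr_pdivlMr// ltr_pdivrMr.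
exists (- T * l), (2 * T * l), (T * l), (fun s => x (l^-1 * s)),
  (fun s => l^-1 *: v (l^-1 * s)); split.
- by rewrite in_itv /= mulNr oppr_lt0 !mulr_gt0.
- rewrite in_itv /= mulNr ltr_pM2r//.
  by apply/andP; split; [rewrite -mulNr ltr_pM2r//; lra|lra].
- by rewrite mulr0.
- by rewrite mulrC mulfK.
move=> s /scale sT; have [Os Hx Hv] := Hxv _ sT; split.
- exact: slit_scale.
- exact: is_derive_reparam.
- rewrite (spray_homog HL Os li0) expr2 -scalerA -scalerN.
  apply: is_deriveZ; rewrite -scalerN; exact: is_derive_reparam.
- rewrite (lf_homog HL Os li0) expr1 (lE _ sT) mulVf//.
Qed.

End LocalGeodesics.

(** * Charts of a Finsler manifold *)

Section FinslerManifold.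
Context {R : realType} {n : nat} {M : manifold R n} (F : finsler M).
Local Notation rV := 'rV[R]_n.
Local Notation Z := ('rV[R]_n * 'rV[R]_n)%type.
Implicit Types (a b : chart_idx M).

Definition chart_image a : set rV := @chart R n M a @` chart_dom a.
Definition overlap a b : set rV := @chart R n M a @` (chart_dom a `&` chart_dom b).

Lemma finsler_is_local a : local_finsler (chart_image a) (finsler_fun F a).
Proof.
split.
- exact: chart_image_open.
- exact: finsler_smooth.
- by move=> x y l [Ox _] l0; rewrite expr1 finsler_homogeneous.
- exact: finsler_posdef.
Qed.

Lemma overlap_sub a b : overlap a b `<=` chart_image a.
Proof. by move=> _ [p [pa pb] <-]; exists p. Qed.

Lemma overlapP a b z : overlap a b z ->
  [/\ chart_image a z, chart_dom a (chart_inv a z), chart_dom b (chart_inv a z)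
    & chart a (chart_inv a z) = z].
Proof.
by move=> [p [pa pb] <-]; rewrite (chartK pa); split => //; exists p.
Qed.

Lemma overlap_open a b : open (overlap a b).
Proof.
rewrite openE => z Wz; have [Oz za zb zK] := overlapP Wz.
rewrite /interior; near=> y.
have Oy : chart_image a y.
  by near: y; apply: open_nbhs_nbhs; split => //; exact: chart_image_open.
have yb : chart_dom b (chart_inv a y).
  near: y; apply: (chart_inv_continuous Oz).
  by apply: open_nbhs_nbhs; split => //; exact: chart_dom_open.
case: Oy => p pa pE; exists p; last by [].
by split => //; move: yb; rewrite -pE (chartK pa).
Unshelve. all: by end_near. Qed.

Lemma transition_overlap a b x : overlap a b x -> overlap b a (transition a b x).
Proof.
by move=> [p [pa pb] <-]; rewrite /transition /= (chartK pa); exists p.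
Qed.

Lemma transition_image a b x : overlap a b x -> chart_image b (transition a b x).
Proof. by move=> /transition_overlap/overlap_sub. Qed.

Lemma transitionK a b x : overlap a b x -> transition b a (transition a b x) = x.
Proof.
by move=> [p [pa pb] <-]; rewrite /transition /= (chartK pa) (chartK pb).
Qed.

Lemma finsler_transition a b z : slit (overlap a b) z ->
  finsler_fun F a z = finsler_fun F b (tmap (transition a b) z).
Proof.
case: z => x y [/= Wx y0]; rewrite /tmap /=.
rewrite -(dvecE y (@overlap_open a b) (@transition_smooth _ _ M a b) Wx).
by case: Wx => p [pa pb] <-; rewrite -(finsler_compat F _ pa pb) {2}/transition /= (chartK pa).
Qed.

Local Notation Smooth a b := (@transition_smooth _ _ M a b).

Lemma spray_transition a b z : slit (overlap a b) z ->
  spray_vec (finsler_fun F b) (tmap (transition a b) z) =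
  dvec (transition a b) (spray_vec (finsler_fun F a) z) z.1
  - hvec (transition a b) z.2 z.2 z.1.
Proof.
exact: (spray_change (@overlap_open a b) (@overlap_open b a) (Smooth a b) (Smooth b a)
  (@transition_overlap a b) (@transitionK a b) (finsler_is_local a) (finsler_is_local b)
  (@overlap_sub a b) (@transition_image a b) (@finsler_transition a b)).
Qed.

Lemma ricci_transition a b z v : slit (overlap a b) z ->
  quad_form (ricci_tensor (finsler_fun F a) z) v =
  quad_form (ricci_tensor (finsler_fun F b) (tmap (transition a b) z))
    (dvec (transition a b) v z.1).
Proof.
exact: (ricci_change (@overlap_open a b) (@overlap_open b a) (Smooth a b) (Smooth b a)
  (@transition_overlap a b) (@transitionK a b) (finsler_is_local a) (finsler_is_local b)
  (@overlap_sub a b) (@transition_image a b) (@finsler_transition a b)).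
Qed.

(** By homogeneity L (x, 0) is its own double. *)
Lemma slit_of_unit a x y : chart_image a x -> finsler_fun F a (x, y) = 1 ->
  slit (chart_image a) (x, y).
Proof.
move=> Ox L1; split => //=; apply/eqP => y0.
have h : finsler_fun F a (x, 2 *: y) = 2 * finsler_fun F a (x, y).
  exact: finsler_homogeneous.
by move: h; rewrite y0 scaler0 -y0 L1; lra.
Qed.

(** A geodesic satisfies its equation in all charts. The second derivative in
    chart b of a curve solving the equation in chart a contains the second
    differential of the transition map, which [spray_transition] cancels. *)
Lemma geodesic_of_chart a (J : set R) (X V : R -> rV) : open J ->
  (forall s : R, J s -> [/\ slit (chart_image a) (X s, V s), is_derive s 1 X (V s),
     is_derive s 1 V (- spray_vec (finsler_fun F a) (X s, V s)) &
     finsler_fun F a (X s, V s) = 1]) ->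
  arclength_geodesic F J (fun s => chart_inv a (X s)).
Proof.
move=> oJ H s Js; have [[Os Vs] HX HV L1] := H s Js.
split.
  apply: (@continuous_comp _ _ _ X); first exact: (is_derive_continuous HX).
  exact: (chart_inv_continuous Os).
move=> b cb.
have Ws : overlap a b (X s).
  case: Os => p pa /= pE; exists p => //; split => //.
  by move: cb; rewrite -pE (chartK pa).
pose phi := transition a b.
have oW := @overlap_open a b; have sphi := Smooth a b.
rewrite -[local_curve _ _]/(fun t => phi (X t)).
have d1 (t : R) : J t -> overlap a b (X t) ->
    is_derive t 1 (fun t => phi (X t)) (dvec phi (V t) (X t)).
  by move=> Jt Wt; have [_ Ht _ _] := H t Jt; exact: (is_derive_map oW sphi Wt Ht).
have D1 : \forall t \near s, derive1 (fun t => phi (X t)) t = dvec phi (V t) (X t).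
  near=> t.
  have Jt : J t by near: t; exact: open_nbhs_nbhs (conj oJ Js).
  have Wt : overlap a b (X t).
    by near: t; apply: (is_derive_continuous HX); exact: open_nbhs_nbhs (conj oW Ws).
  by rewrite derive1E; case: (d1 t Jt Wt).
have D2 : is_derive s 1 (derive1 (fun t => phi (X t)))
    (hvec phi (V s) (V s) (X s) + dvec phi (- spray_vec (finsler_fun F a) (X s, V s)) (X s)).
  apply: near_eq_is_derive (is_derive_dvec oW sphi Ws HX HV).
  by near=> t; apply/esym; near: t.
have Wz : slit (overlap a b) (X s, V s) by split.
have velE : velocity (fun s => chart_inv a (X s)) b s = tmap phi (X s, V s).
  congr (_, _); rewrite -[local_curve _ _]/(fun t => phi (X t)).
  exact: (nbhs_singleton D1).
split.
- by case: (d1 s Js Ws).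
- by case: D2.
- by rewrite velE -finsler_transition.
- move=> i; rewrite velE derive1nS derive1n1 derive1E.
  case: D2 => _ ->.
  have := congr1 (fun u : rV => u 0 i) (spray_transition Wz).
  rewrite !mxE /= => ->.
  have dphi := comp_diff i oW sphi Ws.
  by rewrite deriveN_dir// addrA subrK subrr.
Unshelve. all: by end_near. Qed.

End FinslerManifold.

(** * Projective parameters from linear equations *)

Section LinearODE.
Context {R : realType}.

Definition jacobi_solution (Q w w' : R -> R) :=
  forall t : R, is_derive t 1 w (w' t) /\ is_derive t 1 w' (- (Q t * w t)).

Lemma jacobi_exists (Q : R -> R) (s0 a b : R) : continuous Q -> (forall t, 0 <= Q t) ->
  exists w w' : R -> R, [/\ w s0 = a, w' s0 = b & jacobi_solution Q w w'].
Proof.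
move=> cQ Q0.
pose K t := Q (s0 + t); pose x0 : 'rV[R]_1 := const_mx a.
pose H (t : R) (x v : 'rV[R]_1) := - K t *: x.
have cK : continuous K.
  move=> t; apply: (@continuous_comp _ _ _ (fun t : R => s0 + t)); last exact: cQ.
  by apply: cvgD; [exact: cvg_cst|exact: cvg_id].
have H_cont (x v : R -> 'rV[R]_1) : continuous x -> continuous v ->
    continuous (fun s => H s (x s) (v s)).
  by move=> cx _ t; apply: cvgZ; [apply: cvgN; exact: cK|exact: cx].
have H_lip s x v x' v' : `|H s x v - H s x' v'| <= K s * (`|x - x'| + `|v - v'|).
  rewrite /H -scalerBr normrZ normrN (ger0_norm (Q0 _)).
  by apply: ler_wpM2l; [exact: Q0|rewrite lerDl].
have H_bnd s : `|H s x0 0| <= `|x0| * (1 + K s).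
  rewrite /H normrZ normrN (ger0_norm (Q0 _)) mulrC.
  by apply: ler_wpM2l => //; rewrite lerDr.
have [x [v [x_0 v_0 Hx Hv]]] := @ode_ivp R 1 H K _ x0 H_cont H_lip H_bnd
  (fun s => Q0 _) (normr_ge0 _) (const_mx b) cK.
exists (fun t => x (t - s0) 0 0), (fun t => v (t - s0) 0 0).
rewrite subrr x_0 v_0 !mxE; split => // t.
have sh (f : R -> R) d : is_derive (t - s0) 1 f d -> is_derive t 1 (fun t => f (t - s0)) d.
  move=> [df <-]; have : derivable f (t + - s0) 1 by [].
  by move=> /is_derive_translate.
split.
  apply: (sh (fun t => x t 0 0)).
  exact: ((is_derive_row _ _ _ _).1 (Hx (t - s0)) 0).
apply: (sh (fun t => v t 0 0)).
have := (is_derive_row _ _ _ _).1 (Hv (t - s0)) 0.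
by rewrite /H mxE /K [s0 + _]addrC subrK mulNr.
Qed.

Lemma jacobi_lin Q w w' y y' (a b : R) : jacobi_solution Q w w' -> jacobi_solution Q y y' ->
  jacobi_solution Q (fun t => a * w t + b * y t) (fun t => a * w' t + b * y' t).
Proof.
move=> Hw Hy t; have [w1 w2] := Hw t; have [y1 y2] := Hy t; split.
  by apply: is_deriveD; exact: is_deriveZ.
have H : is_derive t 1 (fun t => a * w' t + b * y' t)
    (a * - (Q t * w t) + b * - (Q t * y t)).
  exact: (is_deriveD (is_deriveZ a w2) (is_deriveZ b y2)).
by rewrite (_ : - _ = a * - (Q t * w t) + b * - (Q t * y t)); [|ring].
Qed.

Lemma jacobi_reverse Q w w' : jacobi_solution Q w w' ->
  jacobi_solution (fun t => Q (- t)) (fun t => w (- t)) (fun t => - w' (- t)).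
Proof.
move=> H t; have [H1 H2] := H (- t).
have Hn : is_derive t 1 (fun s : R => - s) (- (1 : R)).
  by apply: is_deriveN; exact: is_derive_id.
split.
  have := @is_derive1_comp R w (fun s => - s) t _ _ H1 Hn.
  by rewrite mulrN1.
have := is_deriveN (@is_derive1_comp R w' (fun s => - s) t _ _ H2 Hn).
by rewrite mulrN1 opprK.
Qed.

Lemma wronskian_cst Q w w' y y' : jacobi_solution Q w w' -> jacobi_solution Q y y' ->
  forall s t, w' s * y s - w s * y' s = w' t * y t - w t * y' t.
Proof.
move=> Hw Hy s t; apply: (is_derive_0_is_cst (f := fun t => w' t * y t - w t * y' t)) => {s}t.
have [w1 w2] := Hw t; have [y1 y2] := Hy t.
have H : is_derive t 1 (fun t => w' t * y t - w t * y' t)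
    ((w' t * y' t + y t * - (Q t * w t)) - (w t * - (Q t * y t) + y' t * w' t)).
  exact: (is_deriveB (is_deriveM w2 y1) (is_deriveM w1 y2)).
by rewrite (_ : 0 = (w' t * y' t + y t * - (Q t * w t))
  - (w t * - (Q t * y t) + y' t * w' t)); [|ring].
Qed.

Lemma jacobi_cont Q w w' : jacobi_solution Q w w' -> continuous w.
Proof. by move=> H t; exact: (is_derive_continuous (H t).1). Qed.

(** As long as w is positive it is concave, hence below its tangent at s0, which
    crosses 0. *)
Lemma jacobi_first_zero Q w w' (s0 : R) : (forall t, 0 <= Q t) -> jacobi_solution Q w w' ->
  0 < w s0 -> w' s0 < 0 ->
  exists b, [/\ s0 < b, w b = 0 & forall t, t \in `[s0, b[ -> 0 < w t].
Proof.
move=> Q0 Hw w0 w'0.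
pose A : set R := [set t | s0 <= t /\ w t <= 0].
have A0 : A !=set0.
  pose T := s0 + w s0 / (- w' s0).
  have T0 : s0 <= T by rewrite lerDl divr_ge0 ?(ltW w0)// oppr_ge0 ltW.
  have [//|H] := pselect (A !=set0).
  have pos t : s0 <= t -> 0 < w t.
    by move=> st; rewrite ltNge; apply/negP => wt; apply: H; exists t.
  have dw' (t : R) : t \in `[s0, T] -> is_derive t 1 (fun t => - w' t) (Q t * w t).
    by move=> _; rewrite -[X in is_derive _ _ _ X]opprK; apply: is_deriveN; exact: (Hw t).2.
  have w'le t : t \in `[s0, T] -> w' t <= w' s0.
    rewrite in_itv /= => /andP[st tT]; rewrite -lerN2.
    have sub u : u \in `[s0, t] -> u \in `[s0, T].
      by rewrite !in_itv /= => /andP[-> /le_trans]; exact.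
    have Qw u : u \in `[s0, t] -> 0 <= Q u * w u.
      by rewrite in_itv /= => /andP[su _]; rewrite mulr_ge0// ltW// pos.
    exact: (derive_ge0_le (f := fun t => - w' t) st (fun u ut => dw' u (sub u ut)) Qw).
  have dg (t : R) : t \in `[s0, T] ->
      is_derive t 1 (fun t => w' s0 * t - w t) (w' s0 - w' t).
    move=> _; have := is_deriveB (is_deriveZ (w' s0) (is_derive_id t (1 : R))) (Hw t).1.
    by rewrite -[w' s0 *: 1]/(w' s0 * 1) mulr1.
  have H2 := derive_ge0_le T0 dg (fun t tT => etrans (subr_ge0 _ _) (w'le t tT)).
  have H3 : w' s0 * T = w' s0 * s0 - w s0.
    rewrite /T mulrDr; congr (_ + _); rewrite invrN mulrN mulrN mulrCA mulfV ?mulr1//.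
    by rewrite lt_eqF.
  by have := pos T T0; lra.
have infA : has_inf A by split => //; exists s0 => t [].
pose b := inf A.
have sb : s0 <= b by apply: lb_le_inf => // t [].
have lb t : A t -> b <= t by move=> At; exact: inf_lbound infA.2 _ At.
have pos_lt t : s0 <= t -> t < b -> 0 < w t.
  by move=> st tb; rewrite ltNge; apply/negP => wt; move: tb; rewrite ltNge lb.
have cw := jacobi_cont Hw.
have wb_le : w b <= 0.
  rewrite leNgt; apply/negP => wb.
  have [d d0 Hd] := continuous_normP (cw b) wb.
  have [t At tb] := inf_adherent d0 infA.
  have := lb t At; rewrite le_eqVlt => /orP[/eqP bt|bt].
    by have := At.2; rewrite -bt leNgt wb.
  have : `|t - b| < d by rewrite gtr0_norm ?subr_gt0// ltrBlDl.
  move=> /Hd; rewrite ltr_norml => /andP[h _].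
  by have := At.2; lra.
have sb' : s0 < b.
  by rewrite lt_neqAle sb andbT; apply/eqP => E; move: wb_le; rewrite -E leNgt w0.
exists b; split => //; last first.
  by move=> t; rewrite in_itv /= => /andP[st tb]; exact: pos_lt.
apply/eqP; rewrite eq_le wb_le leNgt /=; apply/negP => wb.
have wb' : 0 < - w b by rewrite oppr_gt0.
have [d d0 Hd] := continuous_normP (cw b) wb'.
pose t := Num.max s0 (b - d / 2).
have tb : t < b by rewrite /t gt_max sb' ltrBlDr ltrDl divr_gt0.
have st : s0 <= t by rewrite /t le_max lexx.
have td : b - d / 2 <= t by rewrite /t le_max lexx orbT.
have : `|t - b| < d by rewrite ltr_norml; apply/andP; split; lra.
move=> /Hd; rewrite ltr_norml => /andP[_ h].
by have := pos_lt t st tb; lra.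
Qed.

End LinearODE.

Section Schwarzian.
Context {R : realType}.

Lemma is_derive_quot (f g : R -> R) (t df dg : R) : g t != 0 ->
  is_derive t 1 f df -> is_derive t 1 g dg ->
  is_derive t 1 (fun t => f t / g t) ((df * g t - f t * dg) / g t ^+ 2).
Proof.
move=> gt0 Hf Hg.
have H : is_derive t 1 (fun t => f t / g t) (f t * (- (g t) ^- 2 * dg) + (g t)^-1 * df).
  exact: (is_deriveM Hf (is_deriveV gt0 Hg)).
rewrite (_ : (df * g t - f t * dg) / g t ^+ 2 = f t * (- (g t) ^- 2 * dg) + (g t)^-1 * df)//.
by field.
Qed.

(** Here p''/p' = - 2 g'/g, so that
    {p, t} = (p''/p')' - (p''/p')^2 / 2 = - 2 g''/g. *)
Lemma schwarzian_jacobi (Q p g g' : R -> R) (J : set R) (C : R) : open J -> C != 0 ->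
  jacobi_solution Q g g' -> (forall t, J t -> 0 < g t) ->
  (forall t : R, J t -> is_derive t 1 p (C / g t ^+ 2)) ->
  forall t : R, J t -> [/\ derivable p t 1, derivable (derive1 p) t 1,
    derivable (derive1n 2 p) t 1, derive1 p t != 0 & schwarzian p t = 2 * Q t].
Proof.
move=> oJ C0 Hg gpos Hp t Jt.
have nJ s : J s -> \forall u \near s, J u by move=> Js; exact: open_nbhs_nbhs (conj oJ Js).
have D1 s : J s -> derive1 p s = C / g s ^+ 2.
  by move=> Js; rewrite derive1E; case: (Hp s Js).
have Hp2 (s : R) : J s -> is_derive s 1 (derive1 p) (- (2 * C) * g' s / g s ^+ 3).
  move=> Js; have gs := gpos s Js; have gs0 : g s != 0 by rewrite gt_eqF.
  have H : is_derive s 1 (fun s => C / (g s * g s))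
      ((0 * (g s * g s) - C * (g s * g' s + g s * g' s)) / (g s * g s) ^+ 2).
    apply: (is_derive_quot (f := fun=> C)); first by rewrite mulf_neq0.
    exact: (is_deriveM (Hg s).1 (Hg s).1).
  rewrite (_ : - (2 * C) * g' s / g s ^+ 3 =
    (0 * (g s * g s) - C * (g s * g' s + g s * g' s)) / (g s * g s) ^+ 2); last by field.
  apply: near_eq_is_derive H; near=> u; rewrite D1 ?expr2//.
  by near: u; exact: nJ.
have D2 s : J s -> derive1n 2 p s = - (2 * C) * g' s / g s ^+ 3.
  by move=> Js; rewrite derive1nS derive1n1 derive1E; case: (Hp2 s Js).
have Hp3 (s : R) : J s -> is_derive s 1 (derive1n 2 p)
    (2 * C * Q s / g s ^+ 2 + 6 * C * g' s ^+ 2 / g s ^+ 4).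
  move=> Js; have gs := gpos s Js; have gs0 : g s != 0 by rewrite gt_eqF.
  have H : is_derive s 1 (fun s => (- (2 * C) * g' s) / (g s * (g s * g s)))
      (((- (2 * C) * - (Q s * g s)) * (g s * (g s * g s))
       - (- (2 * C) * g' s) * (g s * (g s * g' s + g s * g' s) + (g s * g s) * g' s))
       / (g s * (g s * g s)) ^+ 2).
    apply: is_derive_quot; first by rewrite !mulf_neq0.
      exact: (is_deriveZ (- (2 * C)) (Hg s).2).
    exact: (is_deriveM (Hg s).1 (is_deriveM (Hg s).1 (Hg s).1)).
  rewrite (_ : 2 * C * Q s / g s ^+ 2 + 6 * C * g' s ^+ 2 / g s ^+ 4 =
      (((- (2 * C) * - (Q s * g s)) * (g s * (g s * g s))
       - (- (2 * C) * g' s) * (g s * (g s * g' s + g s * g' s) + (g s * g s) * g' s))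
       / (g s * (g s * g s)) ^+ 2)); last by field.
  apply: near_eq_is_derive H; near=> u; rewrite D2; last by near: u; exact: nJ.
  by rewrite !exprS expr0 mulr1.
have gt := gpos t Jt; have gt0 : g t != 0 by rewrite gt_eqF.
split.
- by case: (Hp t Jt).
- by case: (Hp2 t Jt).
- by case: (Hp3 t Jt).
- by rewrite D1// mulf_neq0// invr_neq0// expf_neq0.
rewrite /schwarzian derive1nS derive1E; have [_ ->] := Hp3 t Jt.
rewrite D2// D1//; field.
by rewrite gt0.
Unshelve. all: by end_near. Qed.

(** The derivative of y / w is D / w^2, hence y stays above w until w vanishes,
    at b. There y cannot vanish as well, for D is not 0. *)
Lemma jacobi_half_window (Q w w' y y' : R -> R) (s0 D : R) : (forall t, 0 <= Q t) ->
  jacobi_solution Q w w' -> jacobi_solution Q y y' ->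
  0 < D -> (forall t, y' t * w t - y t * w' t = D) -> 0 < w s0 -> w s0 <= y s0 -> w' s0 < 0 ->
  exists b, [/\ s0 < b, w b = 0, 0 < y b & forall t, t \in `[s0, b[ -> 0 < w t /\ 0 < y t].
Proof.
move=> Q0 Hw Hy D0 HD w0 wy w'0.
have [b [sb wb wpos]] := jacobi_first_zero Q0 Hw w0 w'0.
have ypos t : t \in `[s0, b[ -> 0 < y t.
  move=> tsb; have wt := wpos t tsb; move: tsb; rewrite in_itv /= => /andP[st tb].
  have dr (u : R) : u \in `[s0, t] -> is_derive u 1 (fun u => y u / w u) (D / w u ^+ 2).
    rewrite in_itv /= => /andP[su ut].
    have wu : 0 < w u by apply: wpos; rewrite in_itv /= su (le_lt_trans ut).
    rewrite -(HD u); apply: is_derive_quot; [by rewrite gt_eqF|exact: (Hy u).1|exact: (Hw u).1].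
  have dr0 u : u \in `[s0, t] -> 0 <= D / w u ^+ 2.
    by move=> _; rewrite divr_ge0 ?sqr_ge0// ltW.
  have := derive_ge0_le st dr dr0.
  have r1 : 1 <= y s0 / w s0 by rewrite ler_pdivlMr// mul1r.
  move=> /(le_trans r1); rewrite ler_pdivlMr// mul1r.
  exact: lt_le_trans.
exists b; split => //; last by move=> t tsb; split; [exact: wpos|exact: ypos].
rewrite lt_neqAle; apply/andP; split.
  apply/eqP => yb; have := HD b; rewrite wb -yb mulr0 mul0r subrr => E.
  by move: D0; rewrite -E ltxx.
rewrite leNgt; apply/negP => yb.
have yb' : 0 < - y b by rewrite oppr_gt0.
have cy := jacobi_cont Hy.
have [d d0 Hd] := continuous_normP (cy b) yb'.
pose t := Num.max s0 (b - d / 2).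
have tb : t < b by rewrite /t gt_max sb ltrBlDr ltrDl divr_gt0.
have st : s0 <= t by rewrite /t le_max lexx.
have td : b - d / 2 <= t by rewrite /t le_max lexx orbT.
have : `|t - b| < d by rewrite ltr_norml; apply/andP; split; lra.
move=> /Hd; rewrite ltr_norml => /andP[_ h].
have : 0 < y t by apply: ypos; rewrite in_itv /= st.
lra.
Qed.

(** The left end is found by reversing time, which exchanges the roles of
    w and y. *)
Lemma jacobi_window (Q w w' y y' : R -> R) (s0 D : R) : (forall t, 0 <= Q t) ->
  jacobi_solution Q w w' -> jacobi_solution Q y y' ->
  0 < D -> (forall t, y' t * w t - y t * w' t = D) -> 0 < w s0 -> w s0 = y s0 ->
  w' s0 < 0 -> 0 < y' s0 ->
  exists a b, [/\ a < s0 < b, (y a = 0 /\ 0 < w a), (w b = 0 /\ 0 < y b) &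
    forall t, t \in `]a, b[ -> 0 < w t /\ 0 < y t].
Proof.
move=> Q0 Hw Hy D0 HD w0 wy w'0 y'0.
have wy_le : w s0 <= y s0 by rewrite wy.
have [b [sb wb yb pos_b]] := jacobi_half_window Q0 Hw Hy D0 HD w0 wy_le w'0.
have HD' t : - w' (- t) * y (- t) - w (- t) * - y' (- t) = D.
  by rewrite -(HD (- t)); ring.
have y0 : 0 < y (- - s0) by rewrite opprK -wy.
have yw_le : y (- - s0) <= w (- - s0) by rewrite opprK wy.
have y'0' : - y' (- - s0) < 0 by rewrite opprK oppr_lt0.
have [a' [sa ya wa pos_a]] := jacobi_half_window (s0 := - s0) (fun t => Q0 (- t))
  (jacobi_reverse Hy) (jacobi_reverse Hw) D0 HD' y0 yw_le y'0'.
exists (- a'), b; split => //; first by rewrite sb ltrNl sa.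
move=> t; rewrite in_itv /= => /andP[at_ tb].
have [st|/ltW ts] := leP s0 t; first by apply: pos_b; rewrite in_itv /= st.
by have := pos_a (- t); rewrite in_itv /= lerN2 ts ltrNl at_ opprK => /(_ isT) [].
Qed.

(** With w = T v - u and y = T v + u as in [jacobi_window],
    p = (y - w) / (y + w) = u / (T v) takes the values -1 and 1 at the ends of
    the window. The radius d is independent of e: it only has to make v > 1 / 2
    and |u| < 1. *)
Lemma projective_reparametrization (Q : R -> R) (s0 : R) : continuous Q ->
  (forall t, 0 <= Q t) ->
  exists d : R, 0 < d /\ forall e : R, 0 < e -> exists (a b : R) (p : R -> R),
  [/\ a < b, forall t : R, t \in `]a, b[ -> [/\ derivable p t 1, derivable (derive1 p) t 1,
       derivable (derive1n 2 p) t 1, derive1 p t != 0 & schwarzian p t = 2 * Q t],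
      set_bij `]a, b[%classic (@funk_interval R) p &
      forall t, `|t - s0| < d -> (t \in `]a, b[) /\ `|p t| < e].
Proof.
move=> cQ Q0.
have [v [v' [v0 v'0 Hv]]] := jacobi_exists s0 1 0 cQ Q0.
have [u [u' [u0 u'0 Hu]]] := jacobi_exists s0 0 1 cQ Q0.
have cv := jacobi_cont Hv; have cu := jacobi_cont Hu.
have half : (0 : R) < 2^-1 by rewrite invr_gt0.
have [d1 d10 Hd1] := continuous_normP (cv s0) half.
have [d2 d20 Hd2] := continuous_normP (cu s0) ltr01.
exists (Num.min d1 d2); split; first by rewrite lt_min d10.
have near t : `|t - s0| < Num.min d1 d2 -> 2^-1 < v t /\ `|u t| < 1.
  rewrite lt_min => /andP[/Hd1 + /Hd2]; rewrite v0 u0 subr0 => h1 h2; split => //.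
  by move: h1; rewrite ltr_norml => /andP[h _]; lra.
(* Where v > 1 / 2 and |u| < 1, the choice T >= 2 makes w and y positive, and
   T >= 2 / e makes |u / (T v)| < e. *)
move=> e e0; pose T := 4 + 2 / e.
have e20 : 0 < 2 / e by rewrite divr_gt0.
have T0 : 0 < T by rewrite /T; lra.
pose w t := T * v t + (-1) * u t; pose w' t := T * v' t + (-1) * u' t.
pose y t := T * v t + 1 * u t; pose y' t := T * v' t + 1 * u' t.
have Hw : jacobi_solution Q w w' by exact: jacobi_lin.
have Hy : jacobi_solution Q y y' by exact: jacobi_lin.
have D0 : 0 < 2 * T by rewrite mulr_gt0.
have HD t : y' t * w t - y t * w' t = 2 * T.
  rewrite (wronskian_cst Hy Hw t s0) /y' /w /y /w' v0 v'0 u0 u'0; ring.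
have [||||a [b [/andP[as0 sb] [ya wa] [wb yb] pos]]] := jacobi_window (s0 := s0) Q0 Hw Hy D0 HD.
- by rewrite /w v0 u0; lra.
- by rewrite /w /y v0 u0; ring.
- by rewrite /w' v'0 u'0; lra.
- by rewrite /y' v'0 u'0; lra.
pose g t := 1 * w t + 1 * y t; pose g' t := 1 * w' t + 1 * y' t.
have Hg : jacobi_solution Q g g' by exact: jacobi_lin.
pose p t := (y t - w t) / g t.
have gE t : g t = 2 * T * v t by rewrite /g /w /y; ring.
have pE t : y t - w t = 2 * u t by rewrite /w /y; ring.
have gpos t : t \in `[a, b] -> 0 < g t.
  rewrite in_itv /= => /andP[]; rewrite le_eqVlt => /orP[/eqP <- _|at_].
    by rewrite /g ya; lra.
  rewrite le_eqVlt => /orP[/eqP ->|tb]; first by rewrite /g wb; lra.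
  by have [|h1 h2] := pos t; [rewrite in_itv /= at_|rewrite /g; lra].
have dp (t : R) : t \in `[a, b] -> is_derive t 1 p (4 * T / g t ^+ 2).
  move=> tab; have gt := gpos t tab; have gt0 : g t != 0 by rewrite gt_eqF.
  have H : is_derive t 1 p (((y' t - w' t) * g t - (y t - w t) * g' t) / g t ^+ 2).
    apply: (is_derive_quot gt0 _ (Hg t).1).
    exact: (is_deriveB (Hy t).1 (Hw t).1).
  rewrite (_ : 4 * T = (y' t - w' t) * g t - (y t - w t) * g' t)//.
  have := HD t; rewrite /g /g'; move: (y' t) (w' t) (y t) (w t) => A B C D h.
  by rewrite (_ : 4 * T = 2 * (2 * T)); [rewrite -h; ring|ring].
have itvW t : t \in `]a, b[ -> t \in `[a, b] by exact: subset_itv_oo_cc.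
have ab : a < b by exact: lt_trans sb.
have p_incr s t : s \in `[a, b] -> t \in `[a, b] -> s < t -> p s < p t.
  move=> sab tab st.
  have sub r : r \in `[s, t] -> r \in `[a, b].
    move: sab tab; rewrite !in_itv /= => /andP[as_ _] /andP[_ tb] /andP[sr rt].
    by rewrite (le_trans as_ sr) (le_trans rt tb).
  have cp : {within `[s, t], continuous p}.
    by apply: derivable_within_continuous => r /sub/dp [].
  have [c cst] := MVT st (fun r rst => dp r (sub r (subset_itv_oo_cc rst))) cp.
  have cab := sub c (subset_itv_oo_cc cst).
  have gc := gpos c cab.
  rewrite -subr_gt0 => ->; rewrite mulr_gt0 ?subr_gt0//.
  by rewrite divr_gt0 ?exprn_gt0// mulr_gt0.
exists a, b, p; split; [exact: ab| | |].
- have oJ : open (`]a, b[%classic : set R) by exact: interval_open.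
  have T4 : 4 * T != 0 by rewrite mulf_neq0// gt_eqF.
  have gJ t : (`]a, b[%classic : set R) t -> 0 < g t by move=> /itvW; exact: gpos.
  have dJ (t : R) : (`]a, b[%classic : set R) t -> is_derive t 1 p (4 * T / g t ^+ 2).
    by move=> /itvW; exact: dp.
  have S := schwarzian_jacobi oJ T4 Hg gJ dJ.
  by move=> t tab; exact: S.
- have aab : a \in `[a, b] by rewrite in_itv /= lexx ltW.
  have bab : b \in `[a, b] by rewrite in_itv /= lexx ltW.
  have pa : p a = -1 by rewrite /p /g ya sub0r mulr0 addr0 mul1r mulNr mulfV// gt_eqF.
  have pb : p b = 1 by rewrite /p /g wb subr0 mulr0 add0r mul1r mulfV// gt_eqF.
  split.
  + move=> t tab; rewrite /funk_interval /= -pa -pb; move: (tab).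
    rewrite /= in_itv /= => /andP[at_ tb].
    by rewrite !p_incr// itvW.
  + move=> s t; rewrite !inE => sab tab pst; apply/eqP; rewrite eq_le !leNgt.
    apply/andP; split; apply/negP => st.
      by have := p_incr _ _ (itvW _ tab) (itvW _ sab) st; rewrite pst ltxx.
    by have := p_incr _ _ (itvW _ sab) (itvW _ tab) st; rewrite pst ltxx.
  + move=> r; rewrite /funk_interval /= => /andP[r1 r2].
    have cp : {within `[a, b], continuous p}.
      by apply: derivable_within_continuous => t /dp [].
    have [|c cab pc] := IVT (ltW ab) cp (v := r).
      by rewrite pa pb ge_min le_max (ltW r1) (ltW r2) orbT.
    exists c => //=; move: cab; rewrite !in_itv /= => /andP[ac cb].
    rewrite !lt_neqAle ac cb !andbT; apply/andP; split; apply/eqP => E.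
      by move: r1; rewrite -pc -E pa ltxx.
    by move: r2; rewrite -pc E pb ltxx.
move=> t td; have [vt ut] := near t td.
have wpos s : `|s - s0| < Num.min d1 d2 -> 0 < w s /\ 0 < y s.
  move=> /near[vs us]; move: us; rewrite ltr_norml => /andP[us1 us2].
  have : 2 < T * v s.
    have : T * 2^-1 < T * v s by rewrite ltr_pM2l.
    by rewrite /T; lra.
  by rewrite /w /y => h; split; lra.
have tab : t \in `]a, b[.
  rewrite in_itv /= !ltNge; apply/andP; split; apply/negP => h.
    have [|_ ya0] := wpos a.
      apply: le_lt_trans td; rewrite ltr0_norm ?subr_lt0// opprB.
      by rewrite ler_normr; apply/orP; right; lra.
    by move: ya0; rewrite ya ltxx.
  have [|wb0 _] := wpos b.
    apply: le_lt_trans td; rewrite gtr0_norm ?subr_gt0//.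
    by rewrite ler_normr; apply/orP; left; lra.
  by move: wb0; rewrite wb ltxx.
split; first exact: tab.
have vt0 : 0 < v t by exact: lt_trans vt.
have Tv : 0 < 2 * T * v t by rewrite mulr_gt0.
have -> : `|p t| = 2 * `|u t| / (2 * T * v t).
  by rewrite /p pE gE normrM normfV (gtr0_norm Tv) normrM gtr0_norm.
rewrite ltr_pdivrMr//.
have h1 : T * 2^-1 < T * v t by rewrite ltr_pM2l.
have h2 : e * T = 4 * e + 2 by rewrite /T mulrDr mulrCA mulfV ?gt_eqF// mulr1 mulrC.
have h3 : e * (T * 2^-1) < e * (T * v t) by rewrite ltr_pM2l.
move: h2 h3; rewrite mulrA => h2; rewrite h2 => h3.
have -> : e * (2 * T * v t) = 2 * (e * (T * v t)) by ring.
by lra.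
Qed.

End Schwarzian.

(** * The Funk distance *)

Section FunkDistance.
Context {R : realType}.
Variable k : R.
Hypothesis k0 : 0 < k.

Lemma funk_distE (a b : R) : funk_interval a -> funk_interval b ->
  funk_dist k a b = (2 * k)^-1 *
    (`|(ln (1 - a) - ln (1 - b)) - (ln (1 + a) - ln (1 + b))|
     + ((ln (1 - a) - ln (1 - b)) + (ln (1 + a) - ln (1 + b)))).
Proof.
move=> /andP[a1 a2] /andP[b1 b2]; rewrite /funk_dist.
have pa : 1 - a \is Num.pos by rewrite posrE; lra.
have pa' : 1 + a \is Num.pos by rewrite posrE; lra.
have pb : 1 - b \is Num.pos by rewrite posrE; lra.
have pb' : 1 + b \is Num.pos by rewrite posrE; lra.
have sq (c : R) : 1 - c ^+ 2 = (1 - c) * (1 + c) by ring.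
rewrite !sq !ln_div ?rpredM// !lnM//; congr (_ * (`|_| + _)); ring.
Qed.

Lemma ln_ler (x y : R) : 0 < x -> x <= y -> ln x <= ln y.
Proof. by move=> x0 xy; rewrite ler_ln// posrE// (lt_le_trans x0). Qed.

(** With A = ln ((1 - a) / (1 - b)) and B = ln ((1 + a) / (1 + b)), the distance
    is max (A, B) / k, and one of the two is non-negative according to the order
    of a and b. *)
Lemma funk_dist_ge0 (a b : R) : funk_interval a -> funk_interval b ->
  0 <= funk_dist k a b.
Proof.
move=> Ia Ib; rewrite funk_distE//; move: Ia Ib => /andP[a1 a2] /andP[b1 b2].
apply: mulr_ge0; first by rewrite invr_ge0 mulr_ge0// ltW.
have [ab|/ltW ba] := leP a b.
  have h : ln (1 - b) <= ln (1 - a) by apply: ln_ler; lra.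
  set x := _ - _ in h *; set A := ln (1 - a) - ln (1 - b).
  have : 0 <= A by rewrite subr_ge0.
  set B := ln (1 + a) - ln (1 + b) => A0.
  by have := ler_norm (A - B); lra.
have h : ln (1 + b) <= ln (1 + a) by apply: ln_ler; lra.
set A := ln (1 - a) - ln (1 - b).
set B := ln (1 + a) - ln (1 + b).
have B0 : 0 <= B by rewrite subr_ge0.
by have := ler_norm (B - A); rewrite distrC; lra.
Qed.

Lemma funk_dist_small (e : R) : 0 < e -> exists2 d : R, 0 < d <= 1 &
  forall a b : R, `|a| < d -> `|b| < d -> funk_dist k a b < e.
Proof.
move=> e0; pose h := e * k / 8.
have h0 : 0 < h by rewrite divr_gt0// mulr_gt0.
have [d d0 Hd] := continuous_normP (continuous_ln (ltr01 : 0 < (1 : R))) h0.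
exists (Num.min d 1); first by rewrite lt_min d0 ltr01 ge_min lexx orbT.
move=> a b; rewrite !lt_min => /andP[ad a1] /andP[bd b1].
have Ia : funk_interval a by rewrite /funk_interval /= -ltr_norml.
have Ib : funk_interval b by rewrite /funk_interval /= -ltr_norml.
have sm (c : R) : `|c| < d -> `|ln (1 + c)| < h.
  by move=> cd; have := Hd (1 + c); rewrite addrAC subrr add0r ln1 subr0; apply.
have A1 := sm a ad; have B1 := sm b bd.
have A2 := sm (- a) _; have B2 := sm (- b) _; rewrite !normrN in A2 B2.
have {}A2 := A2 ad; have {}B2 := B2 bd.
rewrite funk_distE// mulrC ltr_pdivrMr ?mulr_gt0//.
move: A1 B1 A2 B2; move: (ln (1 + a)) (ln (1 + b)) (ln (1 - a)) (ln (1 - b)) => A B A' B'.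
rewrite !ltr_norml => /andP[? ?] /andP[? ?] /andP[? ?] /andP[? ?].
have -> : e * (2 * k) = 16 * h by rewrite /h; field.
have : `|A' - B' - (A - B)| < 4 * h + h by rewrite ltr_norml; apply/andP; split; lra.
lra.
Qed.

End FunkDistance.

(** * Points joined by short chains *)

Section Connectedness.

(** All points near x are related to one z, hence to each other: classes are
    open. The complement of a class is a union of classes, and so open as
    well. *)
Lemma connected_relation (T : topologicalType) (E : T -> T -> Prop) :
  connected [set: T] -> (forall x y, E x y -> E y x) ->
  (forall x y z, E x y -> E y z -> E x z) ->
  (forall x : T, exists z, \forall y \near x, E y z) -> forall x y, E x y.
Proof.
move=> cT Es Et Eloc x y.
have Eloc' z : exists2 w, E z w & nbhs z [set y | E y w].
  have [w zw] := Eloc z; have nw : nbhs z [set y | E y w] by exact: zw.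
  by exists w => //; exact: (nbhs_singleton nw).
have Er z : E z z by have [w zw _] := Eloc' z; exact: Et zw (Es _ _ zw).
pose A := [set y | E x y].
have Aop : open A.
  rewrite openE => z xz; have [w zw nw] := Eloc' z.
  by apply: filterS nw => z' z'w; exact: Et (Et _ _ _ xz zw) (Es _ _ z'w).
have Acl : closed A.
  rewrite -openC openE => z xz; have [w zw nw] := Eloc' z.
  apply: filterS nw => z' z'w xz'; apply: xz.
  exact: Et (Et _ _ _ xz' z'w) (Es _ _ zw).
have AT : A = [set: T].
  apply: cT; first by exists x; exact: Er.
    by exists A => //; rewrite setTI.
  by exists A => //; rewrite setTI.
by have : A y by rewrite AT.
Qed.

End Connectedness.

Section Chains.
Context {R : realType} {n : nat} {M : manifold R n} (F : finsler M) (k : R).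

(** The Funk distance is not symmetric; smallness in both orders makes this
    relation symmetric. *)
Definition link (x y : M) : Prop := forall e : R, 0 < e ->
  exists (f : R -> M) (a b : R),
    [/\ projective_map F f, funk_interval a /\ funk_interval b, f a = x, f b = y &
        funk_dist k a b < e /\ funk_dist k b a < e].

Lemma link_sym x y : link x y -> link y x.
Proof.
move=> H e /H [f [a [b [pf [Ia Ib] fa fb [ab ba]]]]].
by exists f, b, a.
Qed.

(** Links, not segments, are strung together: the segments are chosen anew for
    each bound on the total length. *)
Inductive linked (x : M) : M -> Prop :=
| linked_one y : link x y -> linked x y
| linked_rcons y z : linked x y -> link y z -> linked x z.

Lemma linked_trans x y z : linked x y -> linked y z -> linked x z.
Proof.
move=> xy; elim=> [w yw|w w' _ IH ww']; first exact: linked_rcons yw.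
exact: linked_rcons IH ww'.
Qed.

Lemma linked_sym x y : linked x y -> linked y x.
Proof.
elim=> [z xz|z w _ IH zw]; first exact/linked_one/link_sym.
exact: linked_trans (linked_one (link_sym zw)) IH.
Qed.

Lemma linked_chain x y : linked x y -> forall e : R, 0 < e ->
  exists m pt a b f, is_chain F x y m pt a b f /\
    \sum_(i < m) funk_dist k (a i) (b i) < e.
Proof.
elim=> [z xz|z w _ IH zw] e e0.
  have [f [a [b [pf [Ia Ib] fa fb [ab _]]]]] := xz e e0.
  exists 1%N, (fun i => if i is 0 then x else z), (fun=> a), (fun=> b), (fun=> f).
  split; last by rewrite big_ord1.
  by split => // -[|//] _.
have e2 : 0 < e / 2 by rewrite divr_gt0.
have [m [pt [a [b [f [[m0 pt0 ptm Hc] sm]]]]]] := IH _ e2.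
have [f' [a' [b' [pf [Ia Ib] fa fb [ab _]]]]] := zw _ e2.
exists m.+1, (fun i => if (i <= m)%N then pt i else w),
  (fun i => if (i < m)%N then a i else a'), (fun i => if (i < m)%N then b i else b'),
  (fun i => if (i < m)%N then f i else f'); split.
  split => //; first by rewrite ltnn.
  move=> i; rewrite ltnS leq_eqVlt => /orP[/eqP ->|im].
    by rewrite /= !ltnn eqxx ptm.
  by rewrite /= im orbT; exact: Hc.
rewrite big_ord_recr /= ltnn (splitr e) ltrD//.
rewrite (_ : \sum_(i < m) _ = \sum_(i < m) funk_dist k (a i) (b i))//.
by apply: eq_bigr => i _; rewrite ltn_ord.
Qed.

Lemma pseudo_dist_eq0 x y : 0 < k -> linked x y -> pseudo_dist F k x y = 0%E.
Proof.
move=> k0 xy; apply/eqP; rewrite eq_le; apply/andP; split.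
  apply/lee_addgt0Pr => e e0; rewrite add0e.
  have [m [pt [a [b [f [ch sm]]]]]] := linked_chain xy e0.
  apply: (@le_trans _ _ (\sum_(i < m) funk_dist k (a i) (b i))%:E).
    by apply: ereal_inf_lbound; exists m, pt, a, b, f.
  by rewrite lee_fin ltW.
apply/ereal_infP => _ [m [pt [a [b [f [[_ _ _ Hc] ->]]]]]].
rewrite lee_fin sumr_ge0// => i _.
by have [Ia Ib _ _ _] := Hc i (ltn_ord i); exact: funk_dist_ge0.
Qed.

End Chains.

(** * The relation along complete geodesics *)

Section CompleteGeodesics.
Context {R : realType} {n : nat} {M : manifold R n} (F : finsler M).
Local Notation rV := 'rV[R]_n.
Local Notation Z := ('rV[R]_n * 'rV[R]_n)%type.
Hypothesis n2 : (2 <= n)%N.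
Implicit Types (a b : chart_idx M) (c : R -> M).

Lemma velocity_slit (J : set R) c a s : arclength_geodesic F J c -> J s ->
  chart_dom a (c s) -> slit (chart_image a) (velocity c a s).
Proof.
move=> Hc Js sa; have [_ /(_ a sa)[_ _ F1 _]] := Hc s Js.
by apply: slit_of_unit F1; exists (c s).
Qed.

Lemma velocity_transition (J : set R) c a b s : arclength_geodesic F J c -> J s ->
  chart_dom a (c s) -> chart_dom b (c s) ->
  velocity c b s = tmap (transition a b) (velocity c a s).
Proof.
move=> Hc Js sa sb; have [cc /(_ a sa)[da _ _ _]] := Hc s Js.
have Ws : overlap a b (local_curve c a s) by exists (c s).
have E : \forall t \near s, transition a b (local_curve c a t) = local_curve c b t.
  near=> t; have ta : chart_dom a (c t).
    by near: t; apply: cc; exact: open_nbhs_nbhs (conj (chart_dom_open a) sa).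
  by rewrite /transition /local_curve /= (chartK ta).
have H := is_derive_map (@overlap_open _ _ _ a b) (@transition_smooth _ _ M a b) Ws
  (derivableP da).
have [_ D] := near_eq_is_derive E H.
rewrite /velocity /tmap /=; congr (_, _); first exact: esym (nbhs_singleton E).
by rewrite !derive1E.
Unshelve. all: by end_near. Qed.

Lemma velocity_continuous (J : set R) c a s : arclength_geodesic F J c -> J s ->
  chart_dom a (c s) -> {for s, continuous (velocity c a)}.
Proof.
move=> Hc Js sa; have [_ /(_ a sa)[d1 d2 _ _]] := Hc s Js.
exact: (is_derive_continuous (is_derive_pair (derivableP d1) (derivableP d2))).
Qed.

Definition chart_at (p : M) : chart_idx M := sval (cid (chart_cover p)).

Lemma chart_atP p : chart_dom (chart_at p) p.
Proof. by rewrite /chart_at; case: cid. Qed.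

Definition ricci_in a (z : Z) : R :=
  quad_form (ricci_tensor (finsler_fun F a) z) z.2.

(** The chart is chosen at each point; [ricci_alongE] shows that any other chart
    gives the same value. *)
Definition ricci_along c (s : R) : R :=
  ricci_in (chart_at (c s)) (velocity c (chart_at (c s)) s).

Lemma ricci_alongE (J : set R) c a s : arclength_geodesic F J c -> J s ->
  chart_dom a (c s) -> ricci_along c s = ricci_in a (velocity c a s).
Proof.
move=> Hc Js sa; have sb := chart_atP (c s).
rewrite /ricci_along /ricci_in.
set b := chart_at (c s) in sb *.
have Wz : slit (overlap a b) (velocity c a s).
  by split; [exists (c s)|case: (velocity_slit Hc Js sa)].
rewrite (velocity_transition Hc Js sa sb).
by apply/esym; exact: (ricci_transition F _ Wz).
Qed.

Lemma ricci_along_continuous c : arclength_geodesic F setT c -> continuous (ricci_along c).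
Proof.
move=> Hc s; have sa := chart_atP (c s); set a := chart_at (c s) in sa.
have oU := slit_open (@chart_image_open _ _ M a).
have C : Ck_on (slit (chart_image a)) 0 (ricci_in a).
  apply: (Ck_on_sum oU) => i _; apply: (Ck_on_sum oU) => j _.
  apply: (Ck_onM oU); last exact: (fibre_Ck (finsler_is_local F a)).
  apply: (Ck_onM oU); last exact: (fibre_Ck (finsler_is_local F a)).
  exact: (ricci_tensor_Ck (finsler_is_local F a)).
have c1 := Ck_on_continuous C (velocity_slit Hc I sa).
have c2 := continuous_comp (velocity_continuous Hc I sa) c1.
have [cc _] := Hc s I.
have E : \forall t \near s, (ricci_in a \o velocity c a) t = ricci_along c t.
  near=> t; apply/esym; apply: (ricci_alongE Hc) => //.
  by near: t; apply: cc; exact: open_nbhs_nbhs (conj (chart_dom_open a) sa).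
rewrite /continuous_at -(nbhs_singleton E).
by apply: cvg_trans c2; exact: near_eq_cvg.
Unshelve. all: by end_near. Qed.

Lemma ricci_along_ge0 c s : ricci_psd F -> arclength_geodesic F setT c ->
  0 <= ricci_along c s.
Proof.
move=> psd Hc; apply: psd; exact: velocity_slit Hc I (chart_atP _).
Qed.

(** For given e the geodesic itself, in the parameter of
    [projective_reparametrization], is a projective map that takes parameters
    close to 0 at s and s0. *)
Lemma geodesic_locally_linked (k : R) c (s0 : R) : 0 < k -> ricci_psd F ->
  arclength_geodesic F setT c -> \forall s \near s0, link F k (c s) (c s0).
Proof.
move=> k0 psd Hc.
have n1 : 0 < n%:R - 1 :> R by rewrite subr_gt0 ltr1n.
pose Q s := ricci_along c s / (n%:R - 1).
have Q0 s : 0 <= Q s by rewrite divr_ge0 ?ricci_along_ge0// ltW.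
have cQ : continuous Q.
  by move=> s; apply: cvgM; [exact: ricci_along_continuous|exact: cvg_cst].
have [d [d0 Hd]] := projective_reparametrization s0 cQ Q0.
apply/nbhs_ballP; exists d => // s /=; rewrite -ball_normE /= distrC => sd e e0.
have [h /andP[h0 h1] Hh] := funk_dist_small k0 e0.
have [a [b [p [ab dp bij small]]]] := Hd h h0.
have [sab ps] := small s sd.
have s0d : `|s0 - s0| < d by rewrite subrr normr0.
have [s0ab ps0] := small s0 s0d.
pose J : set R := `]a, b[%classic.
(* f is c composed with the inverse of p on ]-1, 1[. *)
pose f u := c (xget 0 [set t | J t /\ p t = u]).
have fp t : J t -> f (p t) = c t.
  move=> Jt; rewrite /f; congr c.
  have [|Jx px] := xgetPex 0 (_ : exists x, [set t' | J t' /\ p t' = p t] x).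
    by exists t.
  by case: bij => _ inj _; apply: inj => //; rewrite inE.
have in1 t : `|p t| < h -> funk_interval (p t).
  by move=> pt; rewrite /funk_interval /= -ltr_norml (lt_le_trans pt).
exists f, (p s), (p s0); split.
- exists J, c, p; split => //.
  + split; [exact: interval_open|exact: interval_is_interval|by exists s0].
  + by move=> t _; exact: Hc.
  + move=> t Jt; have [p1 p2 p3 p4 p5] := dp t Jt; split => // a' ta.
    rewrite p5 /Q (ricci_alongE Hc I ta) /ricci_in; field.
    by rewrite gt_eqF.
- by split; exact: in1.
- exact: fp.
- exact: fp.
- by split; exact: Hh.
Unshelve. all: by end_near. Qed.

Lemma geodesic_linked (k : R) c (s t : R) : 0 < k -> ricci_psd F ->
  arclength_geodesic F setT c -> linked F k (c s) (c t).
Proof.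
move=> k0 psd Hc.
apply: (@connected_relation R (fun s t => linked F k (c s) (c t))).
- by apply/connected_intervalP => x y _ _ z _.
- by move=> x y; exact: linked_sym.
- by move=> x y z; exact: linked_trans.
move=> x; exists x; have H := geodesic_locally_linked x k0 psd Hc.
by apply: filterS H => y; exact: linked_one.
Qed.

(** [local_geodesics] in a chart around x; by completeness the short geodesics
    are parts of geodesics defined on the whole line. *)
Lemma geodesics_to_common_point (x : M) : complete_finsler F ->
  exists z : M, \forall y \near x, exists c (s t : R),
    [/\ arclength_geodesic F setT c, c s = y & c t = z].
Proof.
move=> complete; have xa := chart_atP x; set a := chart_at x in xa.
pose w : rV := const_mx 1.
have w0 : w != 0.
  have i0 : 'I_n by exact: Ordinal (ltnW n2).
  by apply/eqP => /(congr1 (fun v : rV => v 0 i0)); rewrite !mxE => /eqP; rewrite oner_eq0.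
have L0 z : slit (chart_image a) z -> 0 <= finsler_fun F a z.
  by move=> [Oz _]; exact: finsler_ge0.
have Ox : chart_image a (chart a x) by exists x.
have [rho [x1 [rho0 H]]] := local_geodesics (finsler_is_local F a) L0 Ox w0.
exists (chart_inv a x1); near=> y.
have ya : chart_dom a y.
  by near: y; exact: open_nbhs_nbhs (conj (chart_dom_open a) xa).
have yr : `|chart a y - chart a x| < rho.
  near: y; move/cvgrPdist_lt: (chart_continuous xa) => /(_ rho rho0).
  by apply: filterS => y; rewrite distrC.
have [l [r [T [X [V [zJ TJ X0 XT HX]]]]]] := H _ yr.
have oJ : open (`]l, r[%classic : set R) by exact: interval_open.
have Hg := geodesic_of_chart oJ HX.
have iJ : open_interval (`]l, r[%classic : set R).
  by split; [exact: oJ|exact: interval_is_interval|exists 0].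
have [c [Hc cE]] := complete _ _ iJ Hg.
exists c, 0, T; split => //; first by rewrite cE// X0 chartK.
by rewrite cE// XT.
Unshelve. all: by end_near. Qed.

End CompleteGeodesics.

Theorem theorem2 (R : realType) (n : nat) (M : manifold R n) (F : finsler M)
    (k : R) :
  (2 <= n)%N -> 0 < k ->
  connected [set: M] -> complete_finsler F -> ricci_psd F ->
  forall x y : M, pseudo_dist F k x y = 0%E.
Proof.
move=> n2 k0 cM complete psd x y; apply: pseudo_dist_eq0 => //.
apply: (@connected_relation M (linked F k)) => //.
- by move=> {}x {}y; exact: linked_sym.
- by move=> {}x {}y z; exact: linked_trans.
move=> {}x; have [z H] := geodesics_to_common_point n2 x complete.
exists z; apply: filterS H => {}y [c [s [t [Hc <- <-]]]].
exact: geodesic_linked.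
Qed.
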